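(* Let $N$ be a complex manifold with $n=\dim(N)\geq 2$, containing an embedded projective line $L$. Suppose $f:N\to N$ is a dominant holomorphic map such that $L$ is invariant and transversally superattracting with degree $a$, and such that $f|L$ is conjugate to $z\mapsto z^b$ with $b\geq 2$, having invariant circle $S\subset L$ (corresponding to $\{|z|=1\}$). If $a\geq b$, then $\mathcal{W}^s_{\rm loc}(S)$ has real analytic regularity, i.e. it is a real analytic submanifold of $N$ of real dimension $2n-1$.
   Context: Transversally superattracting with degree $a$: for any point $\eta\in L$, any holomorphic function $\chi$ defined near $\eta$ and vanishing along $L$, and any point $\xi\in L$ with $f(\xi)=\eta$, the holomorphic function $\chi\circ f$ near $\xi$ vanishes to order at least $a$ along $L$. Local stable manifold: given a neighborhood $\Omega$ of $S$, $\mathcal{W}^s_{\rm loc}(S):=\{x\in N : f^k x\in\Omega \text{ for all } k\ge 0 \text{ and } f^k x\to S \text{ as } k\to\infty\}$. The neighborhood $\Omega$ is implicit in the notation; an assertion about $\mathcal{W}^s_{\rm loc}(S)$ means that it holds for every sufficiently small neighborhood $\Omega$ of $S$. *)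

(* Defs.v *)
From HB Require Import structures.
From mathcomp Require Import all_boot all_order all_algebra.
From mathcomp Require Import complex.
From mathcomp Require Import all_classical all_reals all_analysis.
Set Implicit Arguments.
Unset Strict Implicit.
Unset Printing Implicit Defensive.
Import Order.TTheory GRing.Theory Num.Theory.
Import numFieldNormedType.Exports.
Local Open Scope classical_set_scope.
Local Open Scope ring_scope.
Local Open Scope complex_scope.

(* MathComp-Analysis attaches its norm, topology and differentiability to an
   abstract [numFieldType]; naming R[i] as a structure gives access to them. *)
Definition Cplx (R : realType) : numClosedFieldType := R[i].

Record chart (T V : topologicalType) := Chart {
  dom : set T;
  fwd : T -> V;
  bwd : V -> T;
  dom_open : open dom;
  cod_open : open (fwd @` dom);
  fwdK : forall x, dom x -> bwd (fwd x) = x;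
  fwd_cont : forall x, dom x -> {for x, continuous fwd};
  bwd_cont : forall x, dom x -> {for fwd x, continuous bwd} }.

Record complexManifold (R : realType) (n : nat) := ComplexManifold {
  carrier :> topologicalType;
  manifold_hausdorff : hausdorff_space carrier;
  manifold_second_countable : @second_countable carrier;
  atlas : set (chart carrier 'rV[Cplx R]_n);
  atlas_cover : forall x, exists2 c, atlas c & dom c x;
  atlas_compat : forall c d, atlas c -> atlas d -> forall x, dom c x ->
    dom d x -> differentiable (fwd d \o bwd c) (fwd c x) }.

Section Holomorphy.
Variables (R : realType) (n : nat) (N : complexManifold R n).
Implicit Types (f : N -> N) (L : set N) (x : N).

Definition holomorphic f := continuous f /\
  forall x c d, atlas c -> atlas d -> dom c x -> dom d (f x) ->
    differentiable (fwd d \o f \o bwd c) (fwd c x).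

Definition nondegenerate_at f x :=
  forall c d, atlas c -> atlas d -> dom c x -> dom d (f x) ->
    \det ('J (fwd d \o f \o bwd c) (fwd c x)) != 0.

(* The Jacobian determinant vanishes identically on no connected component. *)
Definition dominant f :=
  forall x, exists2 y, connected_component setT x y & nondegenerate_at f y.

Definition holomorphic_fun_near (chi : N -> Cplx R) x :=
  \forall y \near x, forall c, atlas c -> dom c y ->
    differentiable (chi \o bwd c) (fwd c y).

Definition vanishes_along_near L (chi : N -> Cplx R) x :=
  \forall y \near x, L y -> chi y = 0.

Fixpoint partial (s : seq 'I_n) (g : 'rV[Cplx R]_n -> Cplx R) :=
  if s is i :: s' then 'D_(delta_mx 0 i) (partial s' g) else g.

Definition vanishing_order_ge (a : nat) (g : N -> Cplx R) x :=
  forall c, atlas c -> dom c x -> forall s : seq 'I_n, (size s < a)%N ->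
    partial s (g \o bwd c) (fwd c x) = 0.

Definition vanishes_to_order_along_near L (a : nat) (g : N -> Cplx R) x :=
  \forall y \near x, L y -> vanishing_order_ge a g y.

Definition transversally_superattracting f L (a : nat) :=
  forall eta (chi : N -> Cplx R), L eta ->
    holomorphic_fun_near chi eta -> vanishes_along_near L chi eta ->
    forall xi, L xi -> f xi = eta ->
      vanishes_to_order_along_near L a (chi \o f) xi.

Definition immersed_curve (h : Cplx R -> N) := continuous h /\
  forall z c, atlas c -> dom c (h z) ->
    differentiable (fwd c \o h) z /\ 'D_1 (fwd c \o h) z != 0.

End Holomorphy.

(* C u {oo}, with [None] the point at infinity and the two standard charts
   z and 1/z, inverted below. *)
Definition P1 (R : realType) : Type := option (Cplx R).

Definition aff0 (R : realType) (z : Cplx R) : P1 R := Some z.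

Definition affoo (R : realType) (w : Cplx R) : P1 R :=
  if w == 0 then None else Some w^-1.

Definition P1_power (R : realType) (b : nat) (p : P1 R) : P1 R :=
  omap (fun z => z ^+ b) p.

Definition unit_circle (R : realType) : set (P1 R) :=
  [set p | exists2 z : Cplx R, p = Some z & `|z| = 1].
Arguments unit_circle : clear implicits.

Section Dynamics.
Variables (R : realType) (n : nat) (N : complexManifold R n).

(* Holomorphic embedding of P^1 in N; as P^1 is compact and N Hausdorff, an
   injective immersion is a homeomorphism onto its (closed) image. *)
Definition P1_embedding (iota : P1 R -> N) :=
  [/\ injective iota, immersed_curve (iota \o @aff0 R)
    & immersed_curve (iota \o @affoo R)].

Definition embedded_projective_line (L : set N) :=
  exists2 iota : P1 R -> N, P1_embedding iota & L = range iota.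

(* Being an embedding, iota is biholomorphic from P^1 onto L. *)
Definition conjugates_power (f : N -> N) (L : set N) (b : nat)
    (iota : P1 R -> N) :=
  [/\ P1_embedding iota, L = range iota
    & forall p, f (iota p) = iota (P1_power b p)].

(* N carries no metric; for compact S (the only use) this agrees with the
   distance to S tending to 0, for any metric inducing the topology. *)
Definition tends_to_set (u : nat -> N) (S : set N) :=
  forall U : set N, open U -> S `<=` U -> \forall k \near \oo, U (u k).

Definition local_stable_manifold (f : N -> N) (S Omega : set N) : set N :=
  [set x | (forall k, Omega (iter k f x)) /\
           tends_to_set (fun k => iter k f x) S].

End Dynamics.

Section RealAnalytic.
Variable R : realType.

(* Near p, g is the sum of a power series sum_alpha coef(alpha) h^alpha that
   converges absolutely on a polydisc; [K] truncates every exponent at K. *)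
Definition real_analytic_fun_at (m : nat) (g : 'rV[R]_m -> R) (p : 'rV[R]_m) :=
  exists (coef : {ffun 'I_m -> nat} -> R) (r : R),
  [/\ 0 < r,
      exists M : R, forall K : nat,
        \sum_(alpha : {ffun 'I_m -> 'I_K})
          `|coef [ffun i => val (alpha i)]| * r ^+ (\sum_i alpha i)%N <= M
    & forall h : 'rV[R]_m, (forall i, `|h 0 i| < r) ->
        (fun K : nat => \sum_(alpha : {ffun 'I_m -> 'I_K})
          coef [ffun i => val (alpha i)] * \prod_i h 0 i ^+ alpha i) @ \oo
        --> g (p + h)].

Definition real_analytic_at (m k : nat) (F : 'rV[R]_m -> 'rV[R]_k)
    (p : 'rV[R]_m) :=
  forall j, real_analytic_fun_at (fun x => F x 0 j) p.

Definition realify (n : nat) (z : 'rV[Cplx R]_n) : 'rV[R]_(n + n) :=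
  row_mx (\row_j complex.Re (z 0 j)) (\row_j complex.Im (z 0 j)).

Definition complexify (n : nat) (x : 'rV[R]_(n + n)) : 'rV[Cplx R]_n :=
  \row_j (Complex (x 0 (lshift n j)) (x 0 (rshift n j)) : Cplx R).

Variables (n : nat) (N : complexManifold R n).

(* Chart of the real analytic manifold of dimension 2n underlying N. *)
Definition real_analytic_chart (kappa : chart N 'rV[R]_(n + n)) :=
  forall c, atlas c -> forall x, dom c x -> dom kappa x ->
    real_analytic_at (fwd kappa \o bwd c \o @complexify n)
      (realify (fwd c x)) /\
    real_analytic_at (@realify n \o fwd c \o bwd kappa) (fwd kappa x).

(* Slice charts: W is locally the vanishing locus of the coordinates of index
   d, d + 1, ..., 2n - 1 (indices start at 0). *)
Definition real_analytic_submanifold (W : set N) (d : nat) :=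
  (d <= n + n)%N /\
  forall x, W x -> exists kappa : chart N 'rV[R]_(n + n),
    [/\ real_analytic_chart kappa, dom kappa x
      & forall y, dom kappa y ->
          (W y <-> forall j : 'I_(n + n), (d <= j)%N -> fwd kappa y 0 j = 0)].

End RealAnalytic.

(* Main.v *)
(* Near L, in a chart i, let z_i be a holomorphic extension of the coordinate of
   L = P^1 (or the inverse of one). The excess
   e = |x - (point of L with coordinate z(x))| / |z(x)|^b satisfies
   e(f x) <= k e(x)^2 because a >= b >= 2, whatever the position of z on P^1,
   while z_j(f x) = z_i(x)^b (1 + O(e)). Hence, as in Boettcher's theorem,
     B = log z_0 + sum_k b^-(k+1) log (z_(k+1) o f^(k+1) / (z_k o f^k)^b)
   converges near S. Its real part u does not depend on the charts used, and
   u o f = b u. So u vanishes on the local stable set, and conversely an orbit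
   with u = 0 whose excess tends to 0 has |z| -> 1. It remains to see that B is
   holomorphic with nonzero derivative along L; then Re B is a real analytic
   coordinate cutting out the stable manifold.

   The partial sums are defined along chart indices that are valid only on
   shrinking balls around a given point, so they do not converge uniformly.
   They do approximate B, on a ball of radius r_k -> 0, up to o(r_k), and this
   is enough for complex differentiability: Goursat's subdivision argument only
   uses approximation of that kind, and it yields Cauchy's formula. *)

Require Import Defs.
From HB Require Import structures.
From mathcomp Require Import all_boot all_order all_algebra.
From mathcomp Require Import complex.
From mathcomp Require Import all_classical all_reals all_analysis.
From mathcomp Require Import perm ring lra.
Set Implicit Arguments.
Unset Strict Implicit.
Unset Printing Implicit Defensive.
Import Order.TTheory GRing.Theory Num.Theory.
Import numFieldNormedType.Exports.
Local Open Scope classical_set_scope.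
Local Open Scope ring_scope.
Local Open Scope complex_scope.

(** * Modulus, sup norm and ultrafilter limits *)

(* To be called before [lra], which reifies the whole context. *)
Ltac drop_order := repeat match goal with
  | H : is_true (Order.le _ _) |- _ => clear H
  | H : is_true (Order.lt _ _) |- _ => clear H
  | H : is_true (andb _ _) |- _ => clear H
  | H : @eq _ _ _ |- _ => clear H
  end.

(** The threshold [eps] on the excess links the two rates of the proof. One constant [k1] bounds
    both the quadratic growth of the excess and the Lipschitz constant of f in the charts. Once eps
    * k1 <= 1 / (2 * k1), the excess contracts by 1 / (2 * k1) at each step, so the K-th partial sum
    of B is accurate to order (2 * k1 * b)^-K, while chart indices chosen along the orbit of x stay
    valid on a ball of radius comparable to k1^-K. The quotient of the two tends to 0. A contraction
    of unspecified rate would not give this; the square in e(f x) <= k e(x)^2 makes the rate as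
    small as needed.

    The condition a >= b enters through the normalisation. When both charts are of the same type,
    |z(f x)| is comparable to |z(x)|^b. The distance d to L becomes at most a multiple of d^a, hence
    of d^b for small d, and the new excess is then bounded by the b-th power of the old one.

    Nondegeneracy of B is read off on L alone: there every step ratio is 1 and B is a branch of log
    z. The derivative stays nonzero near the circle by continuity. *)

Section ComplexBasics.
Variable R : realType.
Local Notation C := (Cplx R).
Implicit Types z w : C.

Lemma eps_le0 (x : R) : (forall e, 0 < e -> x <= e) -> x <= 0.
Proof. by move=> h; apply/ler_addgt0Pr => e e0; rewrite add0r h. Qed.

(* The norm of MathComp's complex numbers takes its values in the complex
   numbers; [cabs] and [vn] are its real-valued forms. *)
Definition cabs z : R := complex.Re `|z|.

Lemma cabsE z : `|z| = (cabs z)%:C :> C.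
Proof. by []. Qed.

Lemma cabs_sqrt z : cabs z = Num.sqrt (complex.Re z ^+ 2 + complex.Im z ^+ 2).
Proof. by case: z. Qed.

Lemma cabs_ge0 z : 0 <= cabs z.
Proof. by rewrite cabs_sqrt sqrtr_ge0. Qed.

Lemma cabs0 : cabs 0 = 0.
Proof. by rewrite /cabs normr0. Qed.

Lemma cabs1 : cabs 1 = 1.
Proof. by rewrite /cabs normr1. Qed.

Lemma cabs_eq0 z : (cabs z == 0) = (z == 0).
Proof. by rewrite -(inj_eq (@complexI R)) -cabsE normr_eq0. Qed.

Lemma cabs_gt0 z : (0 < cabs z) = (z != 0).
Proof. by rewrite lt_neqAle cabs_ge0 andbT eq_sym cabs_eq0. Qed.

Lemma cabsM z w : cabs (z * w) = cabs z * cabs w.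
Proof. by apply: complexI; rewrite -cabsE normrM !cabsE rmorphM. Qed.

Lemma cabsN z : cabs (- z) = cabs z.
Proof. by rewrite /cabs normrN. Qed.

Lemma cabsV z : cabs z^-1 = (cabs z)^-1.
Proof.
have [->|z0] := eqVneq z 0; first by rewrite invr0 cabs0 invr0.
have n0 : cabs z != 0 by rewrite cabs_eq0.
by apply: (mulfI n0); rewrite -cabsM !divff // cabs1.
Qed.

Lemma cabsX z k : cabs (z ^+ k) = cabs z ^+ k.
Proof. by elim: k => [|k ih]; rewrite ?expr0 ?cabs1 // !exprS cabsM ih. Qed.

Lemma cabsD z w : cabs (z + w) <= cabs z + cabs w.
Proof. by rewrite -lecR rmorphD -!cabsE ler_normD. Qed.

Lemma cabsB z w : cabs (z - w) <= cabs z + cabs w.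
Proof. by rewrite -(cabsN w) cabsD. Qed.

Lemma cabs_sub z w : cabs (z - w) = cabs (w - z).
Proof. by rewrite -cabsN opprB. Qed.

Lemma cabs_tri z w : cabs z - cabs w <= cabs (z - w).
Proof. by rewrite lerBlDr -{1}(subrK w z) cabsD. Qed.

Lemma cabs_real (x : R) : cabs x%:C = `|x|.
Proof. by rewrite cabs_sqrt /= expr0n addr0 sqrtr_sqr. Qed.

Lemma cabs_nat k : cabs k%:R = k%:R.
Proof. by rewrite -(rmorph_nat (real_complex R)) cabs_real normr_nat. Qed.

Lemma Re_le_cabs z : `|complex.Re z| <= cabs z.
Proof. by rewrite cabs_sqrt -sqrtr_sqr ler_wsqrtr // lerDl sqr_ge0. Qed.

Lemma Im_le_cabs z : `|complex.Im z| <= cabs z.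
Proof. by rewrite cabs_sqrt -sqrtr_sqr ler_wsqrtr // lerDr sqr_ge0. Qed.

Lemma cabs_le_ReIm z : cabs z <= `|complex.Re z| + `|complex.Im z|.
Proof.
rewrite {1}(complexE z) (le_trans (cabsD _ _)) // cabsM !cabs_real.
have -> : cabs ('i%C : C) = 1 by rewrite cabs_sqrt /= expr0n add0r expr1n sqrtr1.
by rewrite mul1r.
Qed.

Lemma cabs_sum (I : Type) (s : seq I) (P : pred I) (F : I -> C) :
  cabs (\sum_(i <- s | P i) F i) <= \sum_(i <- s | P i) cabs (F i).
Proof.
elim/big_ind2 : _ => [|x y u v|//]; first by rewrite cabs0.
by move=> h k; exact: le_trans (cabsD _ _) (lerD h k).
Qed.

Lemma cabs_prod (I : Type) (s : seq I) (P : pred I) (F : I -> C) :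
  cabs (\prod_(i <- s | P i) F i) = \prod_(i <- s | P i) cabs (F i).
Proof. by rewrite (big_morph _ cabsM cabs1). Qed.

Lemma ReD z w : complex.Re (z + w) = complex.Re z + complex.Re w.
Proof. by case: z w => ? ? []. Qed.

Lemma ImD z w : complex.Im (z + w) = complex.Im z + complex.Im w.
Proof. by case: z w => ? ? []. Qed.

Lemma ReN z : complex.Re (- z) = - complex.Re z.
Proof. by case: z. Qed.

Lemma ImN z : complex.Im (- z) = - complex.Im z.
Proof. by case: z. Qed.

Lemma ReM z w : complex.Re (z * w) =
  complex.Re z * complex.Re w - complex.Im z * complex.Im w.
Proof. by case: z w => ? ? []. Qed.

Lemma ImM z w : complex.Im (z * w) =
  complex.Re z * complex.Im w + complex.Im z * complex.Re w.
Proof. by case: z w => ? ? []. Qed.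

Lemma Cplx_eq z w : complex.Re z = complex.Re w ->
  complex.Im z = complex.Im w -> z = w.
Proof. by case: z w => ? ? [? ?] /= -> ->. Qed.

Section Vectors.
Variable n : nat.
Implicit Types u v : 'rV[C]_n.

Definition vn v : R := \big[Num.max/0]_(i : 'I_1 * 'I_n) cabs (v i.1 i.2).

Lemma normvE v : `|v| = (vn v)%:C.
Proof.
rewrite [LHS]mx_normE /vn.
apply: (big_ind2 (fun (a : {nonneg C}) b => a%:num = b%:C)) => //= a b c d ha hc.
rewrite num_max ha hc.
case: (leP b d) => h; first by rewrite max_r // lecR.
by rewrite max_l // lecR ltW.
Qed.

Lemma vn_ge0 v : 0 <= vn v.
Proof. by rewrite -lecR -normvE normr_ge0. Qed.

Lemma vn_le v r : 0 <= r -> (forall i, cabs (v 0 i) <= r) -> vn v <= r.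
Proof. by move=> r0 h; apply/bigmax_leP; split => // -[i j] _ /=; rewrite ord1. Qed.

Lemma cabs_le_vn v i : cabs (v 0 i) <= vn v.
Proof. by rewrite /vn (bigD1 (0, i)) //= le_max lexx. Qed.

Lemma vn0 : vn 0 = 0.
Proof. by apply: complexI; rewrite -normvE normr0. Qed.

Lemma vnN v : vn (- v) = vn v.
Proof. by apply: complexI; rewrite -!normvE normrN. Qed.

Lemma vnD u v : vn (u + v) <= vn u + vn v.
Proof. by have := ler_normD u v; rewrite !normvE -rmorphD lecR. Qed.

Lemma vn_sub u v : vn (u - v) = vn (v - u).
Proof. by rewrite -vnN opprB. Qed.

Lemma vn_tri u v (w : 'rV[C]_n) : vn (u - w) <= vn (u - v) + vn (v - w).
Proof. by rewrite (le_trans _ (vnD _ _)) // addrA subrK. Qed.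

Lemma vnZ c v : vn (c *: v) = cabs c * vn v.
Proof. by apply: complexI; rewrite -normvE normrZ rmorphM cabsE normvE. Qed.

Lemma vn_eq0 v : (vn v == 0) = (v == 0).
Proof. by rewrite -(inj_eq (@complexI R)) -normvE normr_eq0. Qed.

Lemma nbhs_vn (p : 'rV[C]_n) (P : set 'rV[C]_n) : nbhs p P <->
  exists2 e : R, 0 < e & forall y, vn (y - p) < e -> P y.
Proof.
split=> [/nbhs_normP[e /= e0 h]|[e e0 h]].
  have er : (complex.Re e)%:C = e by apply: RRe_real; exact: gtr0_real.
  exists (complex.Re e); first by rewrite -ltcR er.
  by move=> y yp; apply: h; rewrite /= -er distrC normvE ltcR.
apply/(@nbhs_normP _ ('rV[C]_n : normedModType C)); exists e%:C => /=.
  by rewrite ltcR.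
by move=> y /=; rewrite distrC normvE ltcR; exact: h.
Qed.

End Vectors.

Lemma nbhs_cabs z (P : set C) : nbhs z P <->
  exists2 e : R, 0 < e & forall y, cabs (y - z) < e -> P y.
Proof.
split=> [/nbhs_normP[e /= e0 h]|[e e0 h]].
  have er : (complex.Re e)%:C = e by apply: RRe_real; exact: gtr0_real.
  exists (complex.Re e); first by rewrite -ltcR er.
  by move=> y yp; apply: h; rewrite /= -er distrC cabsE ltcR.
apply/(@nbhs_normP _ (C : normedModType C)); exists e%:C => /=.
  by rewrite ltcR.
by move=> y /=; rewrite distrC cabsE ltcR; exact: h.
Qed.

Lemma cabs_cvg (T : Type) (F : set_system T) (FF : Filter F) (u : T -> C) l :
  (u @ F --> l) <-> forall e : R, 0 < e -> \forall x \near F, cabs (u x - l) < e.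
Proof.
split=> h.
  move=> e e0; apply: (h [set y | cabs (y - l) < e]).
  by apply/nbhs_cabs; exists e.
move=> P /nbhs_cabs[e e0 hP]; rewrite /nbhs /= /filter_app.
by apply: filterS (h e e0) => x; exact: hP.
Qed.

Lemma continuous_cabs (T : topologicalType) (u : T -> C) x :
  {for x, continuous u} <->
  forall e : R, 0 < e -> \forall y \near x, cabs (u y - u x) < e.
Proof. exact: cabs_cvg. Qed.

Lemma continuous_vn (T : topologicalType) n (u : T -> 'rV[C]_n) x :
  {for x, continuous u} <->
  forall e : R, 0 < e -> \forall y \near x, vn (u y - u x) < e.
Proof.
split=> h.
  move=> e e0; apply: (h [set y | vn (y - u x) < e]).
  by apply/nbhs_vn; exists e.
move=> P /nbhs_vn[e e0 hP]; rewrite /nbhs /= /filter_app.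
by apply: filterS (h e e0) => y; exact: hP.
Qed.

(** The disc is a closed part of the image of a compact square of R x R under (x, y) -> x + i y. *)
Lemma compact_disc z (r : R) : compact [set w : C | cabs (w - z) <= r].
Proof.
pose A := [set x : R * R | cabs (Complex x.1 x.2 - z) <= r].
pose toC (x : R * R) : C := Complex x.1 x.2.
have toC_dist (x y : R * R) : cabs (toC x - toC y) <= `|x.1 - y.1| + `|x.2 - y.2|.
  by rewrite (le_trans (cabs_le_ReIm _)) // ReD ImD ReN ImN.
have toC_cont : continuous toC.
  move=> x; apply/continuous_cabs => e e0.
  have e2 : 0 < e / 2 by rewrite divr_gt0.
  exists (ball x.1 (e / 2), ball x.2 (e / 2)) => /=.
    by split; exact: nbhsx_ballx.
  move=> y [/= y1 y2]; apply: le_lt_trans (toC_dist _ _) _.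
  rewrite distrC [X in _ + X]distrC (splitr e).
  by rewrite ltrD.
pose B := [set x : R * R | (`[complex.Re z - r, complex.Re z + r]%classic x.1 /\
  `[complex.Im z - r, complex.Im z + r]%classic x.2)].
have cB : compact B.
  by apply: compact_setX; exact: segment_compact.
have -> : [set w : C | cabs (w - z) <= r] = [set w | cabs (w - z) <= r] `&` (toC @` B).
  apply/seteqP; split=> [w wr|w []//]; split => //=.
  exists (complex.Re w, complex.Im w); last by case: (w).
  have := le_trans (Re_le_cabs (w - z)) wr; have := le_trans (Im_le_cabs (w - z)) wr.
  rewrite ReD ImD ReN ImN !ler_norml => /andP[h1 h2] /andP[h3 h4].
  rewrite /B /= !in_itv /=; split; lra.
rewrite setIC; apply: compact_closedI.
  apply: continuous_compact cB.
  by apply: continuous_subspaceT.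
have -> : [set w : C | cabs (w - z) <= r] = ~` [set w | r < cabs (w - z)].
  by apply/seteqP; split => w /=; rewrite leNgt => /negP.
apply: open_closedC; rewrite openE => w /= wr; apply/nbhs_cabs.
exists (cabs (w - z) - r); first by rewrite subr_gt0.
move=> y yw; have := cabs_tri (w - z) (y - z).
have -> : w - z - (y - z) = w - y by ring.
by rewrite (cabs_sub w y) => h; change (r < cabs (y - z)); lra.
Qed.

Section UltraLimit.

(* Limits along an ultrafilter exist for every bounded sequence, so that circle
   means can be defined without any convergence statement. *)
Definition nat_ultra : set_system nat :=
  sval (cid (@ultraFilterLemma nat \oo _)).

Lemma nat_ultraP : UltraFilter nat_ultra /\ \oo `<=` nat_ultra.
Proof. by rewrite /nat_ultra; case: cid => F []. Qed.

#[local] Instance nat_ultra_filter : UltraFilter nat_ultra.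
Proof. exact: (proj1 nat_ultraP). Qed.

Lemma fmap_ultra (S T : Type) (F : set_system S) (h : S -> T) :
  UltraFilter F -> UltraFilter (h @ F).
Proof.
move=> FU; split; first exact: fmap_proper_filter.
move=> G GP sFG; apply/seteqP; split => // A GA.
have [//|FA] := in_ultra_setVsetC (h @^-1` A) FU.
have /(filterI GA) : G (~` A) by apply: sFG.
by rewrite setICr => /filter_not_empty.
Qed.

Definition bdd (u : nat -> C) := exists M : R, forall k, cabs (u k) <= M.

Definition LIM (u : nat -> C) : C := lim (u @ nat_ultra).

Lemma Cplx_hausdorff : hausdorff_space C.
Proof. exact: norm_hausdorff. Qed.

(** A bounded sequence pushes [nat_ultra] forward to an ultrafilter containing a compact disc, and
    such an ultrafilter converges. *)
Lemma LIM_cvg u : bdd u -> u @ nat_ultra --> LIM u.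
Proof.
move=> [M uM]; have := @compact_disc 0 M; rewrite compact_ultra => /(_ (u @ nat_ultra)).
case=> [||l [_ hl]].
- exact: fmap_ultra.
-   by apply: filterS (filterT : nat_ultra setT) => k _ /=; rewrite subr0.
- by apply/cvg_ex; exists l.
Qed.

Lemma LIM_uniq u l : u @ nat_ultra --> l -> LIM u = l.
Proof. by move=> h; apply: cvg_lim h; exact: Cplx_hausdorff. Qed.

Lemma LIM_lin c u v : bdd u -> bdd v ->
  LIM (fun k => c * u k + v k) = c * LIM u + LIM v.
Proof.
move=> bu bv; apply: LIM_uniq; apply: cvgD; last exact: LIM_cvg.
by apply: cvgM; [exact: cvg_cst|exact: LIM_cvg].
Qed.

Lemma LIM_near u l (M : R) : bdd u ->
  (exists k0, forall k, (k0 <= k)%N -> cabs (u k - l) <= M) ->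
  cabs (LIM u - l) <= M.
Proof.
move=> bu [k0 hk]; apply/ler_addgt0Pr => e e0.
have /cabs_cvg /(_ e e0) h1 := LIM_cvg bu.
have h2 : nat_ultra [set k | (k0 <= k)%N].
  by apply: (proj2 nat_ultraP); exists k0.
have [k [k1 k2]] := filter_ex (filterI h1 h2).
have := hk k k2; have := cabsD (LIM u - u k) (u k - l).
rewrite addrA subrK (cabs_sub (LIM u)); move: k1 => /=; lra.
Qed.

Lemma LIM_eq u l : bdd u ->
  (forall e : R, 0 < e -> exists k0, forall k, (k0 <= k)%N -> cabs (u k - l) <= e) ->
  LIM u = l.
Proof.
move=> bu h; apply/eqP; rewrite -subr_eq0 -cabs_eq0 eq_le cabs_ge0 andbT.
by apply: eps_le0 => e e0; apply: LIM_near => //; exact: h.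
Qed.

Lemma LIM_le u (M : R) : (forall k, cabs (u k) <= M) -> cabs (LIM u) <= M.
Proof.
move=> h; rewrite -[LIM u]subr0; apply: LIM_near; first by exists M.
by exists 0%N => k _; rewrite subr0.
Qed.

End UltraLimit.

(** * First-order expansions and differentiability *)

Section Differentials.

(** Differentiability as an explicit expansion with real bounds, here and in [vderiv], where v holds
    the partial derivatives. Estimates are made on these forms and translated back at the end. *)
Definition cderiv (g : C -> C) z d := forall e : R, 0 < e ->
  exists2 r : R, 0 < r & forall h, cabs h < r ->
    cabs (g (z + h) - g z - d * h) <= e * cabs h.

Definition vderiv n (g : 'rV[C]_n -> C) p (v : 'rV[C]_n) := forall e : R, 0 < e ->
  exists2 r : R, 0 < r & forall h, vn h < r ->
    cabs (g (p + h) - g p - \sum_i v 0 i * h 0 i) <= e * vn h.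

Lemma differentiable_eps (V W : normedModType C) (f : V -> W) x :
  differentiable f x -> forall e : R, 0 < e ->
  \forall h \near (0 : V), `|f (x + h) - f x - 'd f x h| <= e%:C * `|h|.
Proof.
move=> /diff_locally /eqaddoP h e e0; have /h : 0 < e%:C :> C by rewrite ltcR.
by apply: filterS => y /=; rewrite fctE /= opprD addrA (addrC y).
Qed.

Lemma row_sum_delta n (v : 'rV[C]_n) : v = \sum_i v 0 i *: delta_mx 0 i.
Proof. exact: row_sum_delta. Qed.

Lemma differentiable_vderiv n (g : 'rV[C]_n -> C) p : differentiable g p ->
  vderiv g p (\row_i 'D_(delta_mx 0 i) g p).
Proof.
move=> dg e e0; have /nbhs_vn[r r0 hr] := differentiable_eps dg e0.
exists r => // h; rewrite -{1}[h]subr0 => /hr.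
suff -> : 'd g p h = \sum_i (\row_i 'D_(delta_mx 0 i) g p) 0 i * h 0 i.
  by rewrite cabsE normvE -rmorphM lecR.
rewrite {1}(row_sum_delta h) linear_sum; apply: eq_bigr => i _.
by rewrite linearZ /= mxE deriveE // mulrC.
Qed.

(** The expansion determines the differential, which is zero. The general case reduces to this one
    by subtracting the linear part. *)
Lemma flat_differentiable (V W : normedModType C) (g : V -> W) p :
  (forall e : R, 0 < e -> \forall h \near (0 : V),
     `|g (h + p) - g p| <= e%:C * `|h|) -> differentiable g p.
Proof.
move=> h.
have H : g \o shift p = cst (g p) + \0 +o_ 0 id.
  apply/eqaddoP => e' e'0.
  have er : (complex.Re e')%:C = e' by apply: RRe_real; exact: gtr0_real.
  have /h : 0 < complex.Re e' by rewrite -ltcR er.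
  by apply: filterS => y; rewrite er !fctE /= addr0.
have c0 : continuous (\0 : V -> W) by exact: cst_continuous.
by apply/diff_locallyP; split; rewrite (diff_unique c0 H).
Qed.

Lemma vderiv_differentiable n (g : 'rV[C]_n -> C) p v : vderiv g p v ->
  differentiable g p.
Proof.
move=> h.
pose L := \sum_i (v 0 i *: (fun x : 'rV[C]_n => x 0 i : C)).
have LE x : L x = \sum_i v 0 i * x 0 i by rewrite /L fct_sumE.
have dL : differentiable L p.
  apply: differentiable_sum => i; apply: differentiableZ.
  exact: differentiable_coord.
have -> : g = (g - L) + L by rewrite subrK.
apply: differentiableD; last exact: dL.
apply: (@flat_differentiable ('rV[C]_n) C) => e e0.
have [r r0 hr] := h e e0; apply/nbhs_vn; exists r => // y; rewrite subr0 => /hr.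
have LD : L (y + p) = L p + \sum_i v 0 i * y 0 i.
  by rewrite !LE -big_split /=; apply: eq_bigr => i _; rewrite mxE addrC mulrDr.
rewrite (normvE y) cabsE -rmorphM lecR => k; apply: le_trans k.
rewrite !fctE LD (addrC y) le_eqVlt; apply/orP; left; apply/eqP; congr (cabs _); ring.
Qed.

(** Both v and the vector of partial derivatives give a first-order expansion at p; comparing the
    two on a small multiple of a basis vector identifies their entries. *)
Lemma vderiv_partial n (g : 'rV[C]_n -> C) p v i : vderiv g p v ->
  'D_(delta_mx 0 i) g p = v 0 i.
Proof.
move=> h; have d := vderiv_differentiable h.
have h' := differentiable_vderiv d.
set w := \row_i _ in h'; have -> : 'D_(delta_mx 0 i) g p = w 0 i by rewrite mxE.
apply/eqP; rewrite -subr_eq0 -cabs_eq0 eq_le cabs_ge0 andbT.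
apply: eps_le0 => e e0; have e2 : 0 < e / 2 by rewrite divr_gt0.
have [r r0 hr] := h _ e2; have [s s0 hs] := h' _ e2.
pose t := Num.min r s / 2.
have t0 : 0 < t by rewrite divr_gt0 // lt_min r0.
have trs : t < Num.min r s by rewrite /t ltr_pdivrMr // ltr_pMr ?ltr1n // lt_min r0.
pose y : 'rV[C]_n := t%:C *: delta_mx 0 i.
have yE j : y 0 j = if j == i then t%:C else 0.
  by rewrite !mxE eqxx /=; case: eqP; rewrite ?mulr1 ?mulr0.
have ny : vn y <= t.
  apply: vn_le; first exact: ltW.
  move=> j; rewrite yE; case: eqP => _; last by rewrite cabs0 ltW.
  by rewrite cabs_real ger0_norm // ltW.
have S u : \sum_j u 0 j * y 0 j = u 0 i * t%:C.
  rewrite (bigD1 i) //= yE eqxx big1 ?addr0 // => j ji.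
  by rewrite yE (negbTE ji) mulr0.
have /hr : vn y < r by rewrite (le_lt_trans ny) // (lt_le_trans trs) // ge_min lexx.
have /hs : vn y < s by rewrite (le_lt_trans ny) // (lt_le_trans trs) // ge_min lexx orbT.
rewrite !S => h1 h2.
have := cabsB (g (p + y) - g p - v 0 i * t%:C) (g (p + y) - g p - w 0 i * t%:C).
have -> : g (p + y) - g p - v 0 i * t%:C - (g (p + y) - g p - w 0 i * t%:C) =
   (w 0 i - v 0 i) * t%:C by ring.
rewrite cabsM cabs_real ger0_norm ?(ltW t0) // => h3.
rewrite -(ler_pM2r t0) (le_trans h3) // (le_trans (lerD h2 h1)) //.
by rewrite -mulrDl -splitr ler_pM2l.
Qed.

End Differentials.

End ComplexBasics.

(** * Goursat's subdivision argument *)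

Section Goursat.
Variable R : realType.
Local Notation C := (Cplx R).
Implicit Types (F G : C -> C) (Phi : R -> R -> C).

(* Path integrals are trapezoidal sums along dyadic subdivisions, up to a
   factor 2; they are exact on affine functions. *)
Definition edge F (p q : C) : C := (F p + F q) * (q - p).

Fixpoint psum F (g : R -> C) (k : nat) (u v : R) : C :=
  if k is k'.+1 then psum F g k' u ((u + v) / 2) + psum F g k' ((u + v) / 2) v
  else edge F (g u) (g v).

Lemma psumB F G g k u v :
  psum (fun z => F z - G z) g k u v = psum F g k u v - psum G g k u v.
Proof.
elim: k u v => [|k ih] u v /=; first by rewrite /edge; ring.
rewrite !ih; ring.
Qed.

Lemma psum_affine (a b : C) g k u v : psum (fun z => a + b * z) g k u v =
  (2 * a * g v + b * g v ^+ 2) - (2 * a * g u + b * g u ^+ 2).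
Proof.
elim: k u v => [|k ih] u v /=; first by rewrite /edge; ring.
rewrite !ih; ring.
Qed.

(** The bound of an integral by maximum times length. It holds at every level k, so it survives any
    passage to the limit; the 2 is the factor omitted in [edge]. *)
Lemma psum_le F g k u v (M B : R) : u <= v ->
  (forall t, u <= t <= v -> cabs (F (g t)) <= M) ->
  (forall s t, u <= s <= v -> u <= t <= v -> cabs (g s - g t) <= B * `|s - t|) ->
  cabs (psum F g k u v) <= 2 * M * B * (v - u).
Proof.
elim: k u v => [|k ih] u v uv hM hB /=.
  have uu : u <= u <= v by rewrite lexx.
  have vv : u <= v <= v by rewrite lexx andbT.
  rewrite /edge cabsM.
  have h1 : cabs (F (g u) + F (g v)) <= 2 * M.
    by have := cabsD (F (g u)) (F (g v)); have := hM u uu; have := hM v vv; lra.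
  have := hB v u vv uu; rewrite ger0_norm ?subr_ge0 // => h2.
  have := ler_pM (cabs_ge0 _) (cabs_ge0 _) h1 h2; lra.
have um : u <= (u + v) / 2 by lra.
have mv : (u + v) / 2 <= v by lra.
have h1 : cabs (psum F g k u ((u + v) / 2)) <= 2 * M * B * ((u + v) / 2 - u).
  by apply: ih => // [t /andP[? ?]|s t /andP[? ?] /andP[? ?]]; [apply: hM|apply: hB]; apply/andP; split; lra.
have h2 : cabs (psum F g k ((u + v) / 2) v) <= 2 * M * B * (v - (u + v) / 2).
  by apply: ih => // [t /andP[? ?]|s t /andP[? ?] /andP[? ?]]; [apply: hM|apply: hB]; apply/andP; split; lra.
have := cabsD (psum F g k u ((u + v) / 2)) (psum F g k ((u + v) / 2) v); lra.
Qed.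

(** Boundary of the square with corner (s, t) and side sg, counterclockwise: bottom and right edges,
    minus top and left edges. *)
Definition tsum F Phi k s t (sg : R) : C :=
  psum F (Phi^~ t) k s (s + sg) + psum F (Phi (s + sg)) k t (t + sg)
  - psum F (Phi^~ (t + sg)) k s (s + sg) - psum F (Phi s) k t (t + sg).

Lemma tsumB F G Phi k s t sg : tsum (fun z => F z - G z) Phi k s t sg =
  tsum F Phi k s t sg - tsum G Phi k s t sg.
Proof. by rewrite /tsum !psumB; ring. Qed.

Lemma tsum_affine (a b : C) Phi k s t sg : tsum (fun z => a + b * z) Phi k s t sg = 0.
Proof. by rewrite /tsum !psum_affine; ring. Qed.

(** Each inner edge of the four quarters is run through twice in opposite directions. Halving the
    side uses up one level of subdivision, so the identity is exact. *)
Lemma tsum_split F Phi k s t sg : tsum F Phi k.+1 s t sg =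
  tsum F Phi k s t (sg / 2) + tsum F Phi k (s + sg / 2) t (sg / 2)
  + tsum F Phi k s (t + sg / 2) (sg / 2) + tsum F Phi k (s + sg / 2) (t + sg / 2) (sg / 2).
Proof.
rewrite /tsum /=.
have E x : (x + (x + sg)) / 2 = x + sg / 2 by lra.
have E' x : x + sg / 2 + sg / 2 = x + sg by lra.
rewrite !E !E'; ring.
Qed.

Definition insq (s t sg x y : R) := (s <= x <= s + sg) && (t <= y <= t + sg).

Lemma insq_half s t sg s' t' x y : 0 <= sg -> s' = s \/ s' = s + sg / 2 ->
  t' = t \/ t' = t + sg / 2 -> insq s' t' (sg / 2) x y -> insq s t sg x y.
Proof.
by rewrite /insq => ? [->|->] [->|->] /andP[/andP[? ?] /andP[? ?]];
  apply/andP; split; apply/andP; split; lra.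
Qed.

(* The boundary sums of a square vanish in the limit. A square where they do
   not has a quarter where they do not, which drives the nested squares. *)
Definition tnull F Phi s t sg := forall e, 0 < e ->
  exists k0, forall k, (k0 <= k)%N -> cabs (tsum F Phi k s t sg) <= e.

Let bad F Phi s t sg e := forall k0, exists2 k, (k0 <= k)%N & e < cabs (tsum F Phi k s t sg).

Let not_bad F Phi s t sg e : ~ bad F Phi s t sg e ->
  exists k0, forall k, (k0 <= k)%N -> cabs (tsum F Phi k s t sg) <= e.
Proof.
move=> /existsNP[k0 h]; exists k0 => k kk; rewrite leNgt; apply/negP => l.
by apply: h; exists k.
Qed.

Let bad_split F Phi s t sg e : bad F Phi s t sg e -> exists s' t',
  [/\ s' = s \/ s' = s + sg / 2, t' = t \/ t' = t + sg / 2 &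
      bad F Phi s' t' (sg / 2) (e / 4)].
Proof.
move=> hb; apply: contrapT => hn.
have H s' t' : s' = s \/ s' = s + sg / 2 -> t' = t \/ t' = t + sg / 2 ->
    ~ bad F Phi s' t' (sg / 2) (e / 4).
  by move=> h1 h2 h3; apply: hn; exists s', t'.
have [k1 h1] := not_bad (H _ _ (or_introl erefl) (or_introl erefl)).
have [k2 h2] := not_bad (H _ _ (or_intror erefl) (or_introl erefl)).
have [k3 h3] := not_bad (H _ _ (or_introl erefl) (or_intror erefl)).
have [k4 h4] := not_bad (H _ _ (or_intror erefl) (or_intror erefl)).
(* The successor pays for the level that [tsum_split] consumes. *)
have [k] := hb (maxn (maxn k1 k2) (maxn k3 k4)).+1.
case: k => // k; rewrite ltnS !geq_max => /andP[/andP[l1 l2] /andP[l3 l4]].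
rewrite tsum_split => h; move: (h1 _ l1) (h2 _ l2) (h3 _ l3) (h4 _ l4).
set A := tsum _ _ _ _ _ _ in h *; set B := tsum _ _ _ _ _ _ in h *.
set D := tsum _ _ _ _ _ _ in h *; set E := tsum _ _ _ _ _ _ in h *.
have := cabsD (A + B + D) E; have := cabsD (A + B) D; have := cabsD A B; lra.
Qed.

Lemma nested_interval (s sg : nat -> R) : (forall k, 0 <= sg k) ->
  (forall k, s k <= s k.+1) -> (forall k, s k.+1 + sg k.+1 <= s k + sg k) ->
  exists x, forall k, s k <= x <= s k + sg k.
Proof.
move=> sg0 h1 h2.
have m1 i j : (i <= j)%N -> s i <= s j.
  by move=> /subnK <-; elim: (j - i)%N => // k ih; rewrite addSn (le_trans ih).
have m2 i j : (i <= j)%N -> s j + sg j <= s i + sg i.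
  by move=> /subnK <-; elim: (j - i)%N => // k ih; rewrite addSn (le_trans (h2 _)).
have cross i j : s i <= s j + sg j.
  have [ij|/ltnW ji] := leqP i j.
    by rewrite (le_trans (m1 _ _ ij)) // lerDl.
  by rewrite (le_trans _ (m2 _ _ ji)) // lerDl.
have hs : has_sup (range s).
  by split; [exists (s 0%N); exists 0%N|exists (s 0%N + sg 0%N) => _ [k _ <-]].
exists (sup (range s)) => k; apply/andP; split.
  by apply: ub_le_sup; [exact: (proj2 hs)|exists k].
by apply: ge_sup; [exact: (proj1 hs)|move=> _ [j _ <-]].
Qed.

Lemma pow2_small (a b : R) : 0 < b -> exists k, a / 2 ^+ k < b.
Proof.
move=> b0; have [k hk] : exists k, `|a| / b < 2 ^+ k.
  exists (Num.bound (`|a| / b)); apply: lt_le_trans (_ : (Num.bound (`|a| / b))%:R <= _).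
    by rewrite archi_boundP // divr_ge0 // ltW.
  by rewrite -natrX ler_nat ltnW // ltn_expl.
exists k; rewrite ltr_pdivrMr ?exprn_gt0 //; rewrite ltr_pdivrMr // in hk.
by rewrite mulrC (le_lt_trans (ler_norm a)).
Qed.

(** Bad squares are nested and shrink to a point. There a single radius r is used: F is replaced by
    an approximant G whose boundary sums vanish, and the error is at most e * r times the perimeter
    of a square whose side is comparable to r. This is of the order of the area, as in the classical
    argument, where G is the affine part of F and r is arbitrary. *)
Lemma goursat F Phi (B s0 t0 sg0 : R) : 0 < B -> 0 < sg0 ->
  (forall x y x' y', insq s0 t0 sg0 x y -> insq s0 t0 sg0 x' y' ->
     cabs (Phi x y - Phi x' y') <= B * (`|x - x'| + `|y - y'|)) ->
  (forall x y, insq s0 t0 sg0 x y -> forall e r0, 0 < e -> 0 < r0 ->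
     exists r G, [/\ 0 < r, r <= r0,
       forall z, cabs (z - Phi x y) < r -> cabs (F z - G z) <= e * r &
       forall s t sg, 0 < sg ->
         (forall x' y', insq s t sg x' y' -> insq s0 t0 sg0 x' y' /\ cabs (Phi x' y' - Phi x y) < r) ->
         tnull G Phi s t sg]) ->
  tnull F Phi s0 t0 sg0.
Proof.
move=> B0 sg00 lip loc; apply: contrapT => hnull.
have {hnull} [e e0 hbad] : exists2 e, 0 < e & bad F Phi s0 t0 sg0 e.
  apply: contrapT => hn; apply: hnull => e e0; apply: not_bad => hb.
  by apply: hn; exists e.
pose st := (R * R * R * R)%type.
pose Bd (p : st) := bad F Phi p.1.1.1 p.1.1.2 p.1.2 p.2.
have /choice[nx hnx] : forall p : st, exists q : st, Bd p ->
    [/\ Bd q, q.1.1.1 = p.1.1.1 \/ q.1.1.1 = p.1.1.1 + p.1.2 / 2,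
        q.1.1.2 = p.1.1.2 \/ q.1.1.2 = p.1.1.2 + p.1.2 / 2,
        q.1.2 = p.1.2 / 2 & q.2 = p.2 / 4].
  move=> p; have [hp|hp] := pselect (Bd p); last by exists p.
  have [s' [t' [h1 h2 h3]]] := bad_split hp.
  by exists (s', t', p.1.2 / 2, p.2 / 4).
pose P k := iter k nx (s0, t0, sg0, e).
have PB k : Bd (P k) by elim: k => // k ih; case: (hnx _ ih).
have Psg k : (P k).1.2 = sg0 / 2 ^+ k.
  elim: k => [|k ih]; first by rewrite expr0 divr1.
  have [_ _ _ -> _] := hnx _ (PB k); rewrite ih exprS; field.
  by rewrite expf_neq0.
have Pe k : (P k).2 = e / 4 ^+ k.
  elim: k => [|k ih]; first by rewrite expr0 divr1.
  have [_ _ _ _ ->] := hnx _ (PB k); rewrite ih exprS; field.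
  by rewrite expf_neq0.
have sgk k : 0 < sg0 / 2 ^+ k by rewrite divr_gt0 // exprn_gt0.
have sgS k : sg0 / 2 ^+ k.+1 = sg0 / 2 ^+ k / 2.
  by rewrite exprS; field; rewrite expf_neq0.
have [xs hxs] : exists x, forall k, (P k).1.1.1 <= x <= (P k).1.1.1 + sg0 / 2 ^+ k.
  apply: nested_interval => k; first exact: ltW.
    by have [_ [->|->] _ _ _] := hnx _ (PB k); rewrite // Psg lerDl divr_ge0 // ltW.
  by have [_ [->|->] _ _ _] := hnx _ (PB k); rewrite sgS ?Psg; have := sgk k; lra.
have [ys hys] : exists x, forall k, (P k).1.1.2 <= x <= (P k).1.1.2 + sg0 / 2 ^+ k.
  apply: nested_interval => k; first exact: ltW.
    by have [_ _ [->|->] _ _] := hnx _ (PB k); rewrite // Psg lerDl divr_ge0 // ltW.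
  by have [_ _ [->|->] _ _] := hnx _ (PB k); rewrite sgS ?Psg; have := sgk k; lra.
have Pin k x y : insq (P k).1.1.1 (P k).1.1.2 (sg0 / 2 ^+ k) x y -> insq s0 t0 sg0 x y.
  elim: k => [|k ih]; first by rewrite expr0 divr1.
  move=> h; apply: ih; move: h; rewrite sgS.
  have [_ h1 h2 _ _] := hnx _ (PB k); move: h1 h2; rewrite Psg /= => h1 h2.
  exact: insq_half (ltW (sgk k)) h1 h2.
have zin : insq s0 t0 sg0 xs ys by apply: (Pin 0%N); rewrite /insq hxs hys.
(* With r <= 4 * B * sg, the error 4 * (2 * (e' * r) * B * sg) is at most 32 * e' * B^2 * sg^2. For
   sg = sg0 / 2^k this is half of the defect e / 4^k. *)
pose e' := e / (64 * B ^+ 2 * sg0 ^+ 2).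
have e'0 : 0 < e' by rewrite divr_gt0 // !mulr_gt0 // exprn_gt0.
have r00 : 0 < 4 * B * sg0 by rewrite !mulr_gt0.
have [r [G [r0 rr hG hT]]] := loc _ _ zin _ _ e'0 r00.
have ex_k : exists k, 2 * B * sg0 / 2 ^+ k < r by exact: pow2_small.
(* The first square whose image fits in the ball of radius r; minimality of k gives the reverse
   comparison. For k = 0 the latter is the cap 4 * B * sg0 imposed on r. *)
have [k hk1 hk2] : exists2 k, 2 * B * (sg0 / 2 ^+ k) < r & r <= 4 * B * (sg0 / 2 ^+ k).
  case: (ex_minnP ex_k) => -[|k] hk hmin.
    by exists 0%N; [rewrite mulrA|rewrite expr0 divr1].
  exists k.+1; first by rewrite mulrA.
  rewrite leNgt; apply/negP => h.
  have /hmin : 2 * B * sg0 / 2 ^+ k < r.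
    apply: le_lt_trans h; rewrite sgS -(mulrA (2 * B) sg0).
    by move: (sg0 / 2 ^+ k) => x; lra.
  by rewrite ltnn.
have near x y : insq (P k).1.1.1 (P k).1.1.2 (sg0 / 2 ^+ k) x y -> cabs (Phi x y - Phi xs ys) < r.
  move=> h; apply: le_lt_trans hk1; apply: le_trans (lip _ _ _ _ (Pin _ _ _ h) zin) _.
  move: h (hxs k) (hys k) => /andP[/andP[a1 a2] /andP[a3 a4]] /andP[a5 a6] /andP[a7 a8].
  rewrite -mulrA [X in _ <= X]mulrCA ler_pM2l //.
  have : `|x - xs| <= sg0 / 2 ^+ k.
    by rewrite ler_norml; move: a1 a2 a5 a6; drop_order => *; apply/andP; split; lra.
  have : `|y - ys| <= sg0 / 2 ^+ k.
    by rewrite ler_norml; move: a3 a4 a7 a8; drop_order => *; apply/andP; split; lra.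
  drop_order; lra.
have ek : 0 < e / 4 ^+ k / 2 by rewrite !divr_gt0 // exprn_gt0.
have [k0 hk0] : exists k0, forall j, (k0 <= j)%N ->
    cabs (tsum G Phi j (P k).1.1.1 (P k).1.1.2 (sg0 / 2 ^+ k)) <= e / 4 ^+ k / 2.
  apply: (hT _ _ _ (sgk k)) => // x y h; split; [exact: Pin h|exact: near h].
have [j kj] := PB k k0; rewrite Psg Pe; move: (hk0 j kj).
set s1 := (P k).1.1.1 in near *; set t1 := (P k).1.1.2 in near *.
set sg := sg0 / 2 ^+ k in near hk1 hk2 *.
have sg1 : 0 < sg by exact: sgk.
have TE : tsum F Phi j s1 t1 sg = tsum (fun z => F z - G z) Phi j s1 t1 sg + tsum G Phi j s1 t1 sg.
  by rewrite tsumB; ring.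
have Pin' x y : insq s1 t1 sg x y -> insq s0 t0 sg0 x y by exact: Pin.
have bound : cabs (tsum (fun z => F z - G z) Phi j s1 t1 sg) <= 4 * (2 * (e' * r) * B * sg).
  have ss : s1 <= s1 + sg by rewrite lerDl ltW.
  have tt : t1 <= t1 + sg by rewrite lerDl ltW.
  have pt (g : R -> C) u : u <= u + sg ->
     (forall x, u <= x <= u + sg -> exists2 p : R * R, g x = Phi p.1 p.2 & insq s1 t1 sg p.1 p.2) ->
     (forall x y, u <= x <= u + sg -> u <= y <= u + sg -> cabs (g x - g y) <= B * `|x - y|) ->
     cabs (psum (fun z => F z - G z) g j u (u + sg)) <= 2 * (e' * r) * B * sg.
    move=> h1 h2 h3; rewrite -{2}[sg](addrK u) (addrC sg).
    apply: psum_le => // x hx; have [p -> hp] := h2 x hx.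
    by apply: hG; exact: near.
  have b1 : cabs (psum (fun z => F z - G z) (Phi^~ t1) j s1 (s1 + sg)) <= 2 * (e' * r) * B * sg.
    apply: pt => // [x hx|x y hx hy].
      by exists (x, t1) => //=; rewrite /insq hx lexx.
    by rewrite (le_trans (lip _ _ _ _ _ _)) ?Pin' ?/insq ?hx ?hy ?lexx //= subrr normr0 addr0.
  have b2 : cabs (psum (fun z => F z - G z) (Phi (s1 + sg)) j t1 (t1 + sg)) <= 2 * (e' * r) * B * sg.
    apply: pt => // [x hx|x y hx hy].
      by exists (s1 + sg, x) => //=; rewrite /insq hx lexx ss.
    by rewrite (le_trans (lip _ _ _ _ _ _)) ?Pin' ?/insq ?hx ?hy ?lexx ?ss //= subrr normr0 add0r.
  have b3 : cabs (psum (fun z => F z - G z) (Phi^~ (t1 + sg)) j s1 (s1 + sg)) <= 2 * (e' * r) * B * sg.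
    apply: pt => // [x hx|x y hx hy].
      by exists (x, t1 + sg) => //=; rewrite /insq hx lexx tt.
    by rewrite (le_trans (lip _ _ _ _ _ _)) ?Pin' ?/insq ?hx ?hy ?lexx ?tt //= subrr normr0 addr0.
  have b4 : cabs (psum (fun z => F z - G z) (Phi s1) j t1 (t1 + sg)) <= 2 * (e' * r) * B * sg.
    apply: pt => // [x hx|x y hx hy].
      by exists (s1, x) => //=; rewrite /insq hx lexx ss.
    by rewrite (le_trans (lip _ _ _ _ _ _)) ?Pin' ?/insq ?hx ?hy ?lexx ?ss //= subrr normr0 add0r.
  move: b1 b2 b3 b4; rewrite /tsum; set X1 := psum _ _ _ _ _; set X2 := psum _ _ _ _ _.
  set X3 := psum _ _ _ _ _; set X4 := psum _ _ _ _ _.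
  have := cabsB (X1 + X2 - X3) X4; have := cabsB (X1 + X2) X3; have := cabsD X1 X2; drop_order; lra.
have bound2 : 4 * (2 * (e' * r) * B * sg) <= e / 4 ^+ k / 2.
  have -> : e / 4 ^+ k / 2 = 4 * (2 * (e' * (4 * B * sg)) * B * sg).
    rewrite /e' /sg.
    have -> : (4 : R) ^+ k = 2 ^+ k * 2 ^+ k by rewrite -exprMn -natrM.
    by field; rewrite (gt_eqF B0) (gt_eqF sg00) expf_neq0.
  by rewrite ler_pM2l // ler_pM2r // ler_pM2r // ler_pM2l // ler_pM2l.
move=> h1; rewrite TE; have := cabsD (tsum (fun z => F z - G z) Phi j s1 t1 sg) (tsum G Phi j s1 t1 sg).
move: bound bound2 h1; drop_order; lra.
Qed.

End Goursat.

(** * Circle means and Cauchy's formula *)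

Section Circle.
Variable R : realType.
Local Notation C := (Cplx R).
Implicit Types (F G : C -> C).

Definition cis (t : R) : C := Complex (cos t) (sin t).

Lemma cisD s t : cis (s + t) = cis s * cis t.
Proof. by apply: Cplx_eq; rewrite ?ReM ?ImM /= ?cosD ?sinD //; ring. Qed.

Lemma cis0 : cis 0 = 1.
Proof. by apply: Cplx_eq; rewrite /= ?cos0 ?sin0. Qed.

Lemma cabs_cis t : cabs (cis t) = 1.
Proof. by rewrite cabs_sqrt /= cos2Dsin2 sqrtr1. Qed.

Lemma cis_neq0 t : cis t != 0.
Proof. by rewrite -cabs_gt0 cabs_cis. Qed.

Lemma cisN t : cis (- t) = (cis t)^-1.
Proof.
apply: (mulfI (cis_neq0 t)); rewrite -cisD subrr cis0 divff //; exact: cis_neq0.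
Qed.

Lemma cisMn t k : cis (t *+ k) = cis t ^+ k.
Proof. by elim: k => [|k ih]; rewrite ?mulr0n ?cis0 ?expr0 // mulrS cisD ih exprS. Qed.

Lemma cis2pi : cis (pi *+ 2) = 1.
Proof. by apply: Cplx_eq; rewrite /= ?cos2pi ?sin2pi. Qed.

Lemma derive_lip (f df : R -> R) (M s t : R) :
  (forall x : R, is_derive x 1 f (df x)) -> (forall x, `|df x| <= M) ->
  `|f s - f t| <= M * `|s - t|.
Proof.
move=> hf hM; wlog st : s t / s <= t.
  move=> h; have [|/ltW] := leP s t; first exact: h.
  by move=> /h; rewrite distrC (distrC t).
have cf x : {for x, continuous f}.
  by apply: differentiable_continuous; apply/derivable1_diffP; case: (hf x).
have [c _ hc] := MVT_segment st (fun x _ => hf x) (continuous_subspaceT cf).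
by rewrite distrC hc normrM (distrC s) ler_wpM2r.
Qed.

Lemma cis_lip s t : cabs (cis s - cis t) <= 2 * `|s - t|.
Proof.
have h1 : `|cos s - cos t| <= 1 * `|s - t|.
  apply: (derive_lip _ _ (df := fun x => - sin x)) => x.
  by rewrite normrN sin_max.
have h2 : `|sin s - sin t| <= 1 * `|s - t|.
  by apply: (derive_lip _ _ (df := fun x => cos x)) => x; rewrite cos_max.
rewrite (le_trans (cabs_le_ReIm _)) // ReD ImD ReN ImN /=; lra.
Qed.

Definition rt (k : nat) : C := cis (pi *+ 2 / 2 ^+ k).

Lemma rt_cis (k j : nat) : rt k ^+ j = cis (pi *+ 2 * (j%:R / 2 ^+ k)).
Proof.
have E (p : R) : p *+ 2 / 2 ^+ k *+ j = p *+ 2 * (j%:R / 2 ^+ k).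
  by rewrite -mulr_natr -!mulrA [_^-1 * _]mulrC.
by rewrite -cisMn E.
Qed.

Lemma rtX k : rt k ^+ (2 ^ k) = 1.
Proof. by rewrite rt_cis natrX divff ?expf_neq0 // mulr1 cis2pi. Qed.

Lemma cabs_rtX k j : cabs (rt k ^+ j) = 1.
Proof. by rewrite cabsX cabs_cis expr1n. Qed.

Lemma rt_neq0 k : rt k != 0.
Proof. exact: cis_neq0. Qed.

(** By sin(2y) = 2 sin y cos y <= 2 sin y the left factor increases with k, and it equals 4 at the
    start. *)
Lemma sin_doubling k : 4 <= 2 ^+ k.+2 * sin (pi *+ 2 / 2 ^+ k.+2) :> R.
Proof.
elim: k => [|k ih].
  have -> : pi *+ 2 / 2 ^+ 2 = pi / 2 :> R by field.
  by rewrite sin_pihalf mulr1 expr2; lra.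
apply: le_trans ih _; set y := pi *+ 2 / 2 ^+ k.+3.
have -> : pi *+ 2 / 2 ^+ k.+2 = y + y.
  by rewrite /y (exprS _ k.+2); field; rewrite expf_neq0.
have y0 : 0 < y by rewrite divr_gt0 ?exprn_gt0 // pmulrn_lgt0 // pi_gt0.
have ypi : y <= pi.
  rewrite /y; move: (pi_gt0 R); move: pi => q q0.
  rewrite ler_pdivrMr ?exprn_gt0 // -[q *+ 2]mulr_natr ler_pM2l //.
  by rewrite -natrX ler_nat (@leq_pexp2l 2 1).
have s0 : 0 <= sin y by rewrite sin_ge0_pi // ltW.
rewrite sinD (exprS _ k.+2) [X in _ <= X]mulrAC [X in _ <= X]mulrC ler_pM2l ?exprn_gt0 //.
have c1 : cos y <= 1 by rewrite (le_trans (ler_norm _)) // cos_max.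
by have := ler_wpM2l s0 c1; lra.
Qed.

(** This is the factor between a trapezoidal sum along the circle and a circle mean ([psum_circle]).
    It tends to 4 pi i; staying away from 0 is enough to pass from small sums to small means. *)
Lemma rt_sub_inv k : 1 <= cabs ((rt k.+2 - (rt k.+2)^-1) * (2 ^ k.+2)%:R).
Proof.
rewrite cabsM cabs_nat; apply: le_trans (_ : `|complex.Im (rt k.+2 - (rt k.+2)^-1)| * (2 ^ k.+2)%:R <= _); last first.
  by rewrite ler_wpM2r // Im_le_cabs.
rewrite -cisN ImD ImN /= sinN opprK natrX.
have := sin_doubling k; set s := sin _ => hs.
have : 1 <= (s + s) * 2 ^+ k.+2 by lra.
by move=> /le_trans; apply; rewrite ler_wpM2r ?exprn_ge0 // ler_norm.
Qed.

Definition avg (r : R) F k : C := (2 ^ k)%:R^-1 * \sum_(j < 2 ^ k) F (r%:C * rt k ^+ j).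

(** The mean over the circle of radius r, in the role of the integral of F(z) dz / (2 pi i z). *)
Definition Lam (r : R) F : C := LIM (avg r F).

Definition cbdd (r : R) F := exists M, forall z, cabs z = r -> cabs (F z) <= M.

Lemma cabs_circ (r : R) k j : 0 <= r -> cabs (r%:C * rt k ^+ j) = r.
Proof. by move=> r0; rewrite cabsM cabs_rtX mulr1 cabs_real ger0_norm. Qed.

Lemma natr2X_neq0 k : (2 ^ k)%:R != 0 :> C.
Proof. by rewrite pnatr_eq0 expn_eq0. Qed.

Lemma avg_le r F k M : 0 <= r -> (forall z, cabs z = r -> cabs (F z) <= M) ->
  cabs (avg r F k) <= M.
Proof.
move=> r0 h; rewrite /avg cabsM cabsV cabs_nat.
have p0 : 0 < (2 ^ k)%:R :> R by rewrite ltr0n expn_gt0.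
rewrite mulrC ler_pdivrMr // (le_trans (cabs_sum _ _ _)) //.
rewrite mulr_natr.
have -> : M *+ 2 ^ k = \sum_(j < 2 ^ k) M by rewrite sumr_const card_ord.
by apply: ler_sum => j _; rewrite h // cabs_circ.
Qed.

Lemma avg_bdd r F : 0 <= r -> cbdd r F -> bdd (avg r F).
Proof. by move=> r0 [M h]; exists M => k; exact: avg_le. Qed.

Lemma eq_avg r F G k : 0 <= r -> (forall z, cabs z = r -> F z = G z) -> avg r F k = avg r G k.
Proof. by move=> r0 h; congr (_ * _); apply: eq_bigr => j _; rewrite h // cabs_circ. Qed.

Lemma avg_lin r c F G k : avg r (fun z => c * F z + G z) k = c * avg r F k + avg r G k.
Proof. rewrite /avg big_split /= -mulr_sumr; ring. Qed.

Lemma eq_Lam r F G : 0 <= r -> (forall z, cabs z = r -> F z = G z) -> Lam r F = Lam r G.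
Proof. by move=> r0 h; congr LIM; apply/funext => k; exact: eq_avg. Qed.

Lemma Lam_lin r c F G : 0 <= r -> cbdd r F -> cbdd r G ->
  Lam r (fun z => c * F z + G z) = c * Lam r F + Lam r G.
Proof.
move=> r0 bF bG; rewrite /Lam -LIM_lin; [|exact: avg_bdd..].
by congr LIM; apply/funext => k; rewrite avg_lin.
Qed.

Lemma Lam_le r F M : 0 <= r -> (forall z, cabs z = r -> cabs (F z) <= M) ->
  cabs (Lam r F) <= M.
Proof. by move=> r0 h; apply: LIM_le => k; exact: avg_le. Qed.

Lemma Lam_cst r c : 0 <= r -> Lam r (fun=> c) = c.
Proof.
move=> r0; apply: LIM_eq; first by exists (cabs c) => k; apply: avg_le.
move=> e e0; exists 0%N => k _.
rewrite /avg sumr_const card_ord -[c *+ _]mulr_natl mulrA mulVf ?natr2X_neq0 //.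
by rewrite mul1r subrr cabs0 ltW.
Qed.

Lemma cyc_sum (a : nat -> C) n : a n = a 0%N -> \sum_(j < n) a j.+1 = \sum_(j < n) a j.
Proof.
move=> an; apply/eqP; rewrite -subr_eq0 -sumrB -(big_mkord xpredT (fun j => a j.+1 - a j)).
by rewrite telescope_sumr // an subrr.
Qed.

Lemma rtX_neq1 k m : (0 < m)%N -> (m.*2 < 2 ^ k)%N -> rt k ^+ m != 1.
Proof.
move=> m0 mk; apply/eqP => h.
have : complex.Im (rt k ^+ m) = 0 by rewrite h.
rewrite rt_cis /= => s0.
have : 0 < sin (pi *+ 2 * (m%:R / 2 ^+ k)) :> R.
  have pi20 : 0 < pi *+ 2 :> R by move: (pi_gt0 R); move: pi => q; lra.
  apply: sin_gt0_pi; rewrite mulr_gt0 ?divr_gt0 ?exprn_gt0 ?ltr0n //=.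
  move: (pi_gt0 R); move: pi => q q0.
  rewrite -[q *+ 2]mulr_natr -mulrA gtr_pMr // mulrA ltr_pdivrMr ?exprn_gt0 // mul1r.
  by rewrite -natrM -natrX ltr_nat mul2n.
by rewrite s0 ltxx.
Qed.

(** Rotation by [rt k] permutes the sample points and multiplies the sum by rt^-m, which differs
    from 1 once k is large. The averages are then exactly 0. *)
Lemma Lam_negpow r m : 0 < r -> (0 < m)%N -> Lam r (fun z => z ^- m) = 0.
Proof.
move=> r0 m0; apply: LIM_eq.
  apply: avg_bdd; first exact: ltW.
  by exists (r ^- m) => z zr; rewrite cabsV cabsX zr.
move=> e e0; exists m.*2 => k mk; rewrite subr0.
suff -> : avg r (fun z : C => z ^- m) k = 0 by rewrite cabs0 ltW.
rewrite /avg; set S := \sum_(j < _) _.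
have : S = (rt k) ^- m * S.
  rewrite {1}/S -(cyc_sum (a := fun j => (r%:C * rt k ^+ j) ^- m)).
    rewrite /S mulr_sumr; apply: eq_bigr => j _.
    by rewrite exprS mulrCA exprMn invfM.
  by rewrite rtX expr0.
move/eqP; rewrite -subr_eq0 -{1}[S]mul1r -mulrBl mulf_eq0 => /orP[|/eqP ->]; last by rewrite mulr0.
rewrite subr_eq0 eq_sym invr_eq1 => h.
have := rtX_neq1 m0 (leq_ltn_trans mk (ltn_expl k (ltnSn 1))).
by rewrite h.
Qed.

Lemma cabs_sub_circ r (w z : C) : cabs w < r -> cabs z = r -> r - cabs w <= cabs (z - w).
Proof. by move=> wr zr; have := cabs_tri z w; rewrite zr. Qed.

Lemma sub_circ_neq0 r (w z : C) : cabs w < r -> cabs z = r -> z - w != 0.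
Proof. by move=> wr zr; rewrite -cabs_gt0 (lt_le_trans _ (cabs_sub_circ wr zr)) // subr_gt0. Qed.

Lemma circ_neq0 r (z : C) : 0 < r -> cabs z = r -> z != 0.
Proof. by move=> r0 zr; rewrite -cabs_gt0 zr. Qed.

Lemma pow_small (q : R) e : 0 <= q < 1 -> 0 < e -> exists k0, forall k, (k0 <= k)%N -> q ^+ k <= e.
Proof.
move=> /andP[q0 q1] e0.
have q1' : `|q| < 1 by rewrite ger0_norm.
have /cvgrPdist_le /(_ e e0) [k0 _ hk] := cvg_expr q1'.
by exists k0 => k kk; have := hk k kk; rewrite sub0r normrN ger0_norm ?exprn_ge0.
Qed.

Lemma geom_split r (w z : C) K : 0 < r -> cabs w < r -> cabs z = r ->
  z / (z - w) = \sum_(k < K) w ^+ k * z ^- k + (w / z) ^+ K * (z / (z - w)).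
Proof.
move=> r0 wr zr; have z0 := circ_neq0 r0 zr; have zw := sub_circ_neq0 wr zr.
elim: K => [|K ih]; first by rewrite big_ord0 expr0 mul1r add0r.
rewrite big_ord_recr /= -addrA {1}ih; congr (_ + _).
rewrite exprS expr_div_n; field; by rewrite zw z0 expf_neq0.
Qed.

Lemma Lam_sum r n (c : 'I_n -> C) (F : 'I_n -> C -> C) : 0 <= r -> (forall i, cbdd r (F i)) ->
  Lam r (fun z => \sum_(i < n) c i * F i z) = \sum_(i < n) c i * Lam r (F i) /\
  cbdd r (fun z => \sum_(i < n) c i * F i z).
Proof.
elim: n c F => [|n ih] c F r0 bF.
  split; last by exists 0 => z _; rewrite big_ord0 cabs0.
  by rewrite big_ord0 -{2}(Lam_cst 0 r0); apply: eq_Lam => // z _; rewrite big_ord0.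
have [i1 [M hM]] := ih (c \o lift ord0) (F \o lift ord0) r0 (fun i => bF _).
have [M' hM'] := bF ord0; split.
  rewrite big_ord_recl -i1 -Lam_lin //; last by exists M.
  by apply: eq_Lam => // z _; rewrite big_ord_recl.
exists (cabs (c ord0) * M' + M) => z zr; rewrite big_ord_recl (le_trans (cabsD _ _)) // cabsM.
by rewrite lerD ?hM // ler_wpM2l ?cabs_ge0 // hM'.
Qed.

Lemma kernel_le r (w z : C) : 0 < r -> cabs w < r -> cabs z = r ->
  cabs (z / (z - w)) <= r / (r - cabs w).
Proof.
move=> r0 wr zr; rewrite cabsM cabsV zr ler_pM2l // lef_pV2 ?cabs_sub_circ // posrE.
  by rewrite cabs_gt0 (sub_circ_neq0 wr zr).
by rewrite subr_gt0.
Qed.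

(** In the expansion of the kernel in powers of w / z only the constant term has a nonzero mean, and
    the remainder is uniformly small on the circle. *)
Lemma Lam_kernel r (w : C) : 0 < r -> cabs w < r -> Lam r (fun z => z / (z - w)) = 1.
Proof.
move=> r0 wr; have r0' := ltW r0.
apply/eqP; rewrite -subr_eq0 -cabs_eq0 eq_le cabs_ge0 andbT; apply: eps_le0 => e e0.
have rw : 0 < r - cabs w by rewrite subr_gt0.
pose q := cabs w / r; pose B := r / (r - cabs w).
have B0 : 0 < B by rewrite divr_gt0.
have q01 : 0 <= q < 1 by rewrite divr_ge0 ?cabs_ge0 //= ltr_pdivrMr // mul1r.
have eB : 0 < e / B by rewrite divr_gt0.
have [K hK] := pow_small q01 eB.
have bF (i : 'I_K.+1) : cbdd r (fun z : C => z ^- i).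
  by exists (r ^- i) => z zr; rewrite cabsV cabsX zr.
have [LS bS] := Lam_sum (fun i : 'I_K.+1 => w ^+ i) r0' bF.
have small z : cabs z = r -> cabs ((w / z) ^+ K.+1 * (z / (z - w))) <= e.
  move=> zr; rewrite cabsM cabsX cabsM cabsV zr -/q.
  have := ler_pM (exprn_ge0 K.+1 (proj1 (andP q01))) (cabs_ge0 _) (hK K.+1 (leqnSn K)) (kernel_le r0 wr zr).
  by rewrite -/B divfK // gt_eqF.
have -> : Lam r (fun z => z / (z - w)) =
   1 * Lam r (fun z => (w / z) ^+ K.+1 * (z / (z - w))) + \sum_(i < K.+1) w ^+ i * Lam r (fun z => z ^- i).
  rewrite -LS -Lam_lin //; last by exists e.
  by apply: eq_Lam => // z zr; rewrite [LHS](geom_split K.+1 r0 wr zr) mul1r addrC.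
rewrite big_ord_recl expr0 mul1r mul1r big1 ?addr0 => [|i _]; last by rewrite Lam_negpow ?mulr0.
have -> : Lam r (fun z : C => z ^- (ord0 : 'I_K.+1)) = 1.
  by rewrite -(Lam_cst 1 r0'); apply: eq_Lam => // z _; rewrite expr0 invr1.
by rewrite addrK; exact: Lam_le.
Qed.

Definition cdiff F z := exists d, cderiv F z d.

(* The pointwise approximation property from which holomorphy is recovered:
   on arbitrarily small balls, up to o(radius). *)
Definition AH1 F z := forall e r0 : R, 0 < e -> 0 < r0 -> exists r G,
  [/\ 0 < r, r <= r0 & forall y, cabs (y - z) < r -> cdiff G y /\ cabs (F y - G y) <= e * r].

Lemma cdiff_AH1 F z (r : R) : 0 < r -> (forall y, cabs (y - z) < r -> cdiff F y) -> AH1 F z.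
Proof.
move=> r0 h e r1 e0 r10; exists (Num.min r r1), F; split.
- by rewrite lt_min r0.
- by rewrite ge_min lexx orbT.
move=> y; rewrite lt_min => /andP[yr _]; split; first exact: h.
by rewrite subrr cabs0 mulr_ge0 ?ltW // lt_min r0.
Qed.

Lemma goursat_cdiff F Phi (B s0 t0 sg0 : R) : 0 < B -> 0 < sg0 ->
  (forall x y x' y', insq s0 t0 sg0 x y -> insq s0 t0 sg0 x' y' ->
     cabs (Phi x y - Phi x' y') <= B * (`|x - x'| + `|y - y'|)) ->
  (forall x y, insq s0 t0 sg0 x y -> cdiff F (Phi x y)) -> tnull F Phi s0 t0 sg0.
Proof.
move=> B0 sg00 lip hF; apply: goursat lip _ => // x y /hF[d hd] e r0 e0 r00.
have [r r1 hr] := hd e e0.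
exists (Num.min r r0), (fun z => (F (Phi x y) - d * Phi x y) + d * z); split.
- by rewrite lt_min r1.
- by rewrite ge_min lexx orbT.
- move=> z; rewrite lt_min => /andP[zr zr0].
  have := hr _ zr; rewrite (addrC (Phi x y)) subrK => h.
  have -> : F z - (F (Phi x y) - d * Phi x y + d * z) = F z - F (Phi x y) - d * (z - Phi x y) by ring.
  by apply: le_trans h _; rewrite ler_pM2l // ltW // lt_min zr.
- move=> s t sg _ _ e' e'0; exists 0%N => k _; rewrite tsum_affine cabs0; exact: ltW.
Qed.

(** Second use of [goursat]: the approximants are now differentiable functions, whose boundary sums
    vanish by [goursat_cdiff], where the approximants were affine. *)
Lemma goursat_AH F Phi (B s0 t0 sg0 : R) : 0 < B -> 0 < sg0 ->
  (forall x y x' y', insq s0 t0 sg0 x y -> insq s0 t0 sg0 x' y' ->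
     cabs (Phi x y - Phi x' y') <= B * (`|x - x'| + `|y - y'|)) ->
  (forall x y, insq s0 t0 sg0 x y -> AH1 F (Phi x y)) -> tnull F Phi s0 t0 sg0.
Proof.
move=> B0 sg00 lip hF; apply: goursat (lip) _ => // x y /hF ah e r0 e0 r00.
have [r [G [r1 rr h]]] := ah e r0 e0 r00; exists r, G; split => //.
  by move=> z /h[].
move=> s t sg sg1 sub; apply: goursat_cdiff B0 sg1 _ _ => [x1 y1 x2 y2 /sub[h1 _] /sub[h2 _]|x1 y1 /sub[_ /h[]//]].
exact: lip.
Qed.

Lemma cdiff_continuous G z : cdiff G z -> forall e : R, 0 < e ->
  exists2 r, 0 < r & forall y, cabs (y - z) < r -> cabs (G y - G z) <= e.
Proof.
move=> [d hd] e e0; have [r r0 hr] := hd 1 ltr01.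
pose K := cabs d + 1; have K0 : 0 < K by rewrite ltr_wpDl // cabs_ge0.
exists (Num.min r (e / K)); first by rewrite lt_min r0 divr_gt0.
move=> y; rewrite lt_min => /andP[/hr]; rewrite (addrC z) subrK mul1r ltr_pdivlMr // => h1 h2.
have := cabsD (G y - G z - d * (y - z)) (d * (y - z)).
rewrite subrK cabsM; move: h2; rewrite /K; lra.
Qed.

Lemma AH1_continuous F z : AH1 F z -> forall e : R, 0 < e ->
  exists2 r, 0 < r & forall y, cabs (y - z) < r -> cabs (F y - F z) <= e.
Proof.
move=> ah e e0; have e3 : 0 < e / 3 by rewrite divr_gt0.
have [r [G [r0 r1 h]]] := ah (e / 3) 1 e3 ltr01.
have [|cG hz] := h z; first by rewrite subrr cabs0.
have [r' r'0 hG] := cdiff_continuous cG e3.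
exists (Num.min r r'); first by rewrite lt_min r0.
move=> y; rewrite lt_min => /andP[/h[_ hy] /hG hyz].
have -> : F y - F z = (F y - G y) + (G y - G z) - (F z - G z) by ring.
have := cabsB ((F y - G y) + (G y - G z)) (F z - G z); have := cabsD (F y - G y) (G y - G z).
have := ler_wpM2l (ltW e3) r1; lra.
Qed.

Lemma cderivV (w z : C) : z != w -> cderiv (fun y => (y - w)^-1) z (- (z - w) ^- 2).
Proof.
move=> zw e e0; have a0 : 0 < cabs (z - w) by rewrite cabs_gt0 subr_eq0.
set a := cabs (z - w) in a0 *.
exists (Num.min (a / 2) (e * a ^+ 3 / 2)).
  by rewrite lt_min !divr_gt0 // mulr_gt0 // exprn_gt0.
move=> h; rewrite lt_min => /andP[h1 h2].
have n1 : z - w != 0 by rewrite subr_eq0.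
have b : a / 2 <= cabs (z + h - w).
  have := cabs_tri (z - w) (- h); rewrite cabsN opprK -/a addrAC; lra.
have n2 : z + h - w != 0 by rewrite -cabs_gt0 (lt_le_trans _ b) // divr_gt0.
have -> : (z + h - w)^-1 - (z - w)^-1 - - (z - w) ^- 2 * h = h * h * ((z - w) ^- 2 * (z + h - w)^-1).
  by field; rewrite n1 n2.
rewrite !cabsM !cabsV cabsX -/a mulrAC ler_wpM2r ?cabs_ge0 //.
have b0 : 0 < cabs (z + h - w) by rewrite cabs_gt0.
rewrite mulrA ler_pdivrMr // ler_pdivrMr ?exprn_gt0 //.
have : e * (a / 2) * a ^+ 2 <= e * cabs (z + h - w) * a ^+ 2.
  by rewrite ler_pM2r ?exprn_gt0 // ler_pM2l.
apply: le_trans; move: h2; rewrite (_ : a ^+ 3 = a * a ^+ 2) ?exprS //; lra.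
Qed.

Lemma cderivM F G z d d' : cderiv F z d -> cderiv G z d' ->
  cderiv (fun y => F y * G y) z (d * G z + F z * d').
Proof.
move=> hF hG e e0.
pose K := cabs (G z) + cabs (F z) + cabs d + cabs d' + 1.
have K1 : 1 <= K by rewrite lerDr !addr_ge0 ?cabs_ge0.
have K0 : 0 < K by rewrite (lt_le_trans ltr01).
pose e' := Num.min 1 (e / (4 * K)).
have e'0 : 0 < e' by rewrite lt_min ltr01 divr_gt0 // mulr_gt0.
have e'1 : e' <= 1 by rewrite ge_min lexx.
have e'e : e' * (4 * K) <= e by rewrite -ler_pdivlMr ?mulr_gt0 // ge_min lexx orbT.
have [r r0 hr] := hF e' e'0; have [s s0 hs] := hG e' e'0.
pose t := e' / (4 * K).
have t0 : 0 < t by rewrite divr_gt0 // mulr_gt0.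
exists (Num.min (Num.min r s) t); first by rewrite !lt_min r0 s0.
move=> h; rewrite !lt_min => /andP[/andP[/hr h1 /hs h2] ht].
set A := F (z + h) - F z - d * h in h1; set B := G (z + h) - G z - d' * h in h2.
have -> : F (z + h) * G (z + h) - F z * G z - (d * G z + F z * d') * h =
   A * G z + F z * B + (A + d * h) * (B + d' * h) by rewrite /A /B; ring.
have x0 := cabs_ge0 h; set x := cabs h in h1 h2 ht x0 *.
have i1 : cabs (A * G z) <= e' * x * K.
  rewrite cabsM ler_pM ?cabs_ge0 //.
  by rewrite /K; have := (cabs_ge0 (F z), cabs_ge0 d, cabs_ge0 d'); case=> [[? ?] ?]; lra.
have i2 : cabs (F z * B) <= K * (e' * x).
  rewrite cabsM ler_pM ?cabs_ge0 //.
  by rewrite /K; have := (cabs_ge0 (G z), cabs_ge0 d, cabs_ge0 d'); case=> [[? ?] ?]; lra.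
have b1 : cabs (A + d * h) <= K * x.
  have := cabsD A (d * h); rewrite cabsM -/x => /le_trans; apply.
  have : e' * x <= 1 * x by rewrite ler_wpM2r.
  have := (mulr_ge0 (cabs_ge0 (F z)) x0, mulr_ge0 (cabs_ge0 (G z)) x0, mulr_ge0 (cabs_ge0 d') x0).
  by case=> [[? ?] ?]; rewrite /K; lra.
have b2 : cabs (B + d' * h) <= K * x.
  have := cabsD B (d' * h); rewrite cabsM -/x => /le_trans; apply.
  have : e' * x <= 1 * x by rewrite ler_wpM2r.
  have := (mulr_ge0 (cabs_ge0 (F z)) x0, mulr_ge0 (cabs_ge0 (G z)) x0, mulr_ge0 (cabs_ge0 d) x0).
  by case=> [[? ?] ?]; rewrite /K; lra.
have i3 : cabs ((A + d * h) * (B + d' * h)) <= K * (e' * x).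
  rewrite cabsM (le_trans (ler_pM (cabs_ge0 _) (cabs_ge0 _) b1 b2)) //.
  rewrite -mulrA ler_pM2l // mulrA ler_wpM2r //.
  move: (ltW ht); rewrite /t ler_pdivlMr ?mulr_gt0 //.
  have : 0 <= K * x by rewrite mulr_ge0 // ltW.
  lra.
have := cabsD (A * G z + F z * B) ((A + d * h) * (B + d' * h)).
have := cabsD (A * G z) (F z * B).
have := ler_wpM2r x0 e'e.
have : 0 <= K * (e' * x) by rewrite !mulr_ge0 // ltW.
lra.
Qed.

Lemma cdiff_quot F (c w z : C) : z != w -> cdiff F z -> cdiff (fun y => (F y - c) / (y - w)) z.
Proof.
move=> zw [d hd]; exists (d * (z - w)^-1 + (F z - c) * (- (z - w) ^- 2)).
have hd' : cderiv (fun y => F y - c) z d.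
  move=> e e0; have [r r0 hr] := hd e e0; exists r => // h /hr.
  by rewrite (_ : F (z + h) - c - (F z - c) = F (z + h) - F z) //; ring.
exact: (cderivM hd' (cderivV zw)).
Qed.

Lemma AH1_quot F (c w z : C) : z != w -> AH1 F z -> AH1 (fun y => (F y - c) / (y - w)) z.
Proof.
move=> zw ah e r0 e0 r00; have a0 : 0 < cabs (z - w) by rewrite cabs_gt0 subr_eq0.
set a := cabs (z - w) in a0 *.
have ea : 0 < e * (a / 2) by rewrite mulr_gt0 // divr_gt0.
have ra : 0 < Num.min r0 (a / 2) by rewrite lt_min r00 divr_gt0.
have [r [G [r1 rr h]]] := ah _ _ ea ra; move: rr; rewrite le_min => /andP[rr ra2].
exists r, (fun y => (G y - c) / (y - w)); split => // y yz.
have [cG hy] := h y yz.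
have b : a / 2 <= cabs (y - w).
  have := cabs_tri (z - w) (z - y); rewrite (cabs_sub z y) -/a.
  have -> : z - w - (z - y) = y - w by ring.
  lra.
have b0 : 0 < cabs (y - w) by rewrite (lt_le_trans _ b) // divr_gt0.
split; first by apply: cdiff_quot => //; rewrite -subr_eq0 -cabs_gt0.
have -> : (F y - c) / (y - w) - (G y - c) / (y - w) = (F y - G y) / (y - w) by ring.
rewrite cabsM cabsV ler_pdivrMr // (le_trans hy) // [X in X <= _]mulrAC.
by rewrite ler_pM2l // mulr_gt0.
Qed.

Lemma sum_pow2_split (a : nat -> C) k : \sum_(j < 2 ^ k.+1) a j =
  \sum_(j < 2 ^ k) a j + \sum_(j < 2 ^ k) a (2 ^ k + j)%N.
Proof. by rewrite expnS mul2n -addnn big_split_ord. Qed.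

Lemma psumE F g k u v : psum F g k u v = \sum_(j < 2 ^ k)
  edge F (g (u + (v - u) * (j%:R / 2 ^+ k))) (g (u + (v - u) * (j.+1%:R / 2 ^+ k))).
Proof.
elim: k u v => [|k ih] u v /=.
  by rewrite expn0 big_ord_recl big_ord0 addr0 expr0 !divr1 mulr0 mulr1 addr0 (addrC u) subrK.
rewrite (sum_pow2_split (fun j => edge F (g (u + (v - u) * (j%:R / 2 ^+ k.+1))) (g (u + (v - u) * (j.+1%:R / 2 ^+ k.+1))))).
have p0 : 2 ^+ k != 0 :> R by rewrite expf_neq0.
have E1 (x : R) : u + ((u + v) / 2 - u) * (x / 2 ^+ k) = u + (v - u) * (x / 2 ^+ k.+1).
  by rewrite exprS; field.
have E2 (x : R) : (u + v) / 2 + (v - (u + v) / 2) * (x / 2 ^+ k) = u + (v - u) * ((2 ^+ k + x) / 2 ^+ k.+1).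
  by rewrite exprS; field.
rewrite !ih; congr (_ + _); apply: eq_bigr => j _; first by rewrite !E1.
by rewrite !E2 -!natrX -!natrD addnS.
Qed.

(** Shifting the index in one half of each trapezoid collects, at every sample point, F(z) times (rt
    - rt^-1) z. *)
Lemma psum_circle F r k : psum F (fun t => r%:C * cis (pi *+ 2 * t)) k 0 1 =
  (rt k - (rt k)^-1) * (2 ^ k)%:R * avg r (fun z => F z * z) k.
Proof.
pose z j := r%:C * rt k ^+ j.
have zE j : r%:C * cis (pi *+ 2 * (0 + (1 - 0) * (j%:R / 2 ^+ k))) = z j.
  by rewrite add0r subr0 mul1r /z rt_cis.
rewrite psumE (eq_bigr (fun j : 'I_(2 ^ k) => F (z j) * (z j.+1 - z j) + F (z j.+1) * (z j.+1 - z j))); last first.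
  by move=> j _; rewrite !zE /edge mulrDl.
rewrite big_split /=.
have zS j : z j.+1 = rt k * z j by rewrite /z exprS mulrCA.
have w0 := rt_neq0 k.
have -> : \sum_(j < 2 ^ k) F (z j.+1) * (z j.+1 - z j) = \sum_(j < 2 ^ k) F (z j) * (z j - (rt k)^-1 * z j).
  rewrite -(cyc_sum (a := fun j => F (z j) * (z j - (rt k)^-1 * z j))).
    by apply: eq_bigr => j _; rewrite zS (mulrA _^-1) mulVf // mul1r.
  by rewrite /z rtX expr0.
rewrite -big_split /avg mulrA -[_ * _ * _^-1]mulrA divff ?natr2X_neq0 // mulr1 mulr_sumr.
by apply: eq_bigr => j _; rewrite zS -/(z j) /=; ring.
Qed.

Lemma psum_const_le F g k (u v M B : R) : u <= v ->
  (forall t, u <= t <= v -> cabs (F (g t)) <= M) ->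
  (forall s t, cabs (g s - g t) <= B * `|s - t|) ->
  cabs (psum F g k u v) <= 2 * M * B * (v - u).
Proof. by move=> uv h1 h2; apply: psum_le. Qed.

Section Cauchy.
Variables (g : C -> C) (r : R) (w : C).
Hypotheses (r0 : 0 < r) (wr : cabs w < r) (hg : forall z, cabs z <= r -> AH1 g z).

Let d := r - cabs w.
Let d0 : 0 < d. Proof. by rewrite subr_gt0. Qed.
Let circ t : C := r%:C * cis (pi *+ 2 * t).
Let F (z : C) := (g z - g w) / (z - w).
(** The region between the circle (x = 1) and its image under the homothety of centre w and ratio l
    (x = 0), unrolled on the unit square with y as the angle. *)
Let Phi (l x y : R) : C := w + (l + (1 - l) * x)%:C * (circ y - w).

Let cabs_circle t : cabs (circ t) = r.
Proof. by rewrite cabsM cabs_cis mulr1 cabs_real gtr0_norm. Qed.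

Let circ_d t : d <= cabs (circ t - w).
Proof. exact: cabs_sub_circ (cabs_circle t). Qed.

Let circ_D t : cabs (circ t - w) <= 2 * r.
Proof. by have := cabsB (circ t) w; rewrite cabs_circle; have := wr; lra. Qed.

Let circ_lip s t : cabs (circ s - circ t) <= 16 * r * `|s - t|.
Proof.
rewrite /circ -mulrBr cabsM cabs_real gtr0_norm //.
have := cis_lip (pi *+ 2 * s) (pi *+ 2 * t); rewrite -mulrBr normrM => h.
have p4 : `|pi *+ 2| <= 8 :> R.
  have /andP[p0 p2] := proj1 (pihalf_02_cos_pihalf R).
  by move: p0 p2; move: pi => q ? ?; rewrite ger0_norm; lra.
have h2 : cabs (cis (pi *+ 2 * s) - cis (pi *+ 2 * t)) <= 16 * `|s - t|.
  by apply: le_trans h _; have := ler_wpM2r (normr_ge0 (s - t)) p4; lra.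
by have := ler_wpM2l (ltW r0) h2; lra.
Qed.

Let seg_le (l x y : R) : 0 <= l <= 1 -> 0 <= x <= 1 -> cabs (Phi l x y) <= r.
Proof.
move=> /andP[l0 l1] /andP[x0 x1]; set m := l + (1 - l) * x.
have m0 : 0 <= m by rewrite addr_ge0 // mulr_ge0 // subr_ge0.
have m1 : m <= 1 by have := ler_wpM2l (_ : 0 <= 1 - l) x1; rewrite /m subr_ge0 => /(_ l1); lra.
have -> : Phi l x y = (1 - m)%:C * w + m%:C * circ y.
  by rewrite /Phi -/m rmorphB rmorph1; ring.
apply: le_trans (cabsD _ _) _; rewrite (cabsM _ w) (cabsM _ (circ y)) !cabs_real cabs_circle !ger0_norm ?subr_ge0 //.
have := ler_wpM2l (_ : 0 <= 1 - m) (ltW wr); rewrite subr_ge0 => /(_ m1); lra.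
Qed.

(** The two radial sides of the unrolled region coincide and cancel, so the sum over the circle
    agrees, up to a null term, with the sum over the small inner curve. There the quotient F is at
    most e1 / (l * d) on a curve of length of order l * r: l cancels, and it only has to be small
    enough for the continuity of g at w. *)
Lemma cauchy_psum e : 0 < e -> exists k0, forall k, (k0 <= k)%N -> cabs (psum F circ k 0 1) <= e.
Proof.
move=> e0.
pose e1 := e / 2 * d / (32 * r + 1).
have q0 : 0 < 32 * r + 1 by have := r0; lra.
have e10 : 0 < e1 by rewrite divr_gt0 // mulr_gt0 // divr_gt0.
have [s s0 hs] := AH1_continuous (hg (ltW wr)) e10.
pose l := Num.min (1 / 2) (s / (4 * r)).
have r4 : 0 < 4 * r by rewrite mulr_gt0.
have l0 : 0 < l by rewrite lt_min !divr_gt0.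
have l1 : l <= 1 / 2 by rewrite ge_min lexx.
have ls : l * (4 * r) <= s by rewrite -ler_pdivlMr // ge_min lexx orbT.
have l01 : 0 <= l <= 1 by apply/andP; split; lra.
have bottom k : cabs (psum F (Phi l 0) k 0 1) <= e / 2.
  have b1 t : cabs (F (Phi l 0 t)) <= e1 / (l * d).
    have E : Phi l 0 t - w = l%:C * (circ t - w) by rewrite /Phi mulr0 addr0 addrC addKr.
    have hw : cabs (Phi l 0 t - w) < s.
      rewrite E cabsM cabs_real ger0_norm; last exact: ltW.
      by have := ler_wpM2l (ltW l0) (circ_D t); have := mulr_gt0 l0 r0; lra.
    rewrite /F cabsM cabsV ler_pM ?cabs_ge0 ?invr_ge0 ?cabs_ge0 ?hs //.
    have ld : 0 < l * d by rewrite mulr_gt0.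
    have h : l * d <= cabs (Phi l 0 t - w).
      by rewrite E cabsM cabs_real gtr0_norm // ler_pM2l // circ_d.
    by rewrite lef_pV2 // posrE // (lt_le_trans ld).
  apply: le_trans (psum_const_le (M := e1 / (l * d)) (B := l * (16 * r)) k ler01 (fun t _ => b1 t) _) _.
    move=> s' t'.
    have -> : Phi l 0 s' - Phi l 0 t' = l%:C * (circ s' - circ t') by rewrite /Phi mulr0 addr0; ring.
    by rewrite cabsM cabs_real gtr0_norm // -mulrA ler_pM2l // circ_lip.
  have -> : 2 * (e1 / (l * d)) * (l * (16 * r)) * (1 - 0) = e1 / d * (32 * r).
    by field; rewrite (gt_eqF d0) (gt_eqF l0).
  have -> : e1 / d * (32 * r) = e / 2 * (32 * r / (32 * r + 1)).
    by rewrite /e1; field; rewrite (gt_eqF d0) (gt_eqF q0).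
  rewrite ger_pMr ?divr_gt0 // ler_pdivrMr //; lra.
have tn : tnull F (Phi l) 0 0 1.
  apply: (goursat_AH (B := 20 * r)) => //; first by rewrite mulr_gt0.
    move=> x y x' y'; rewrite /insq !add0r => /andP[hx hy] /andP[hx' hy'].
    have -> : Phi l x y - Phi l x' y' = (l + (1 - l) * x)%:C * (circ y - circ y') + ((1 - l) * (x - x'))%:C * (circ y' - w).
      by rewrite /Phi !rmorphD !rmorphM !rmorphB rmorph1; ring.
    apply: le_trans (cabsD _ _) _; rewrite (cabsM _ (circ y - _)) (cabsM _ (circ y' - _)) !cabs_real.
    have m0 : 0 <= l + (1 - l) * x by move: hx => /andP[? ?]; rewrite addr_ge0 ?mulr_ge0 //; lra.
    have m1 : l + (1 - l) * x <= 1.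
      by move: hx => /andP[? x1]; have := ler_wpM2l (_ : 0 <= 1 - l) x1; rewrite subr_ge0; move=> /(_ _) h; have := h ltac:(lra); lra.
    rewrite ger0_norm // normrM (ger0_norm (_ : 0 <= 1 - l)); last by lra.
    have i1 : (l + (1 - l) * x) * cabs (circ y - circ y') <= 16 * r * `|y - y'|.
      by apply: le_trans (circ_lip _ _); rewrite ler_piMl ?cabs_ge0.
    have i2 : (1 - l) * `|x - x'| * cabs (circ y' - w) <= `|x - x'| * (2 * r).
      apply: ler_pM; rewrite ?cabs_ge0 ?mulr_ge0 ?circ_D //; first lra.
      by rewrite ler_piMl //; lra.
    by have := mulr_ge0 (ltW r0) (normr_ge0 (x - x')); have := mulr_ge0 (ltW r0) (normr_ge0 (y - y')); lra.
  move=> x y; rewrite /insq !add0r => /andP[/andP[x0 x1] _]; apply: AH1_quot; last first.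
    by apply: hg; apply: seg_le => //; rewrite x0.
  have m0 : 0 < l + (1 - l) * x by rewrite ltr_pwDl ?mulr_ge0 //; lra.
  rewrite -subr_eq0 /Phi addrC addKr mulf_neq0 //.
    by rewrite -cabs_gt0 cabs_real gtr0_norm.
  by rewrite -cabs_gt0 (lt_le_trans d0).
have e2 : 0 < e / 2 by rewrite divr_gt0.
have [k0 hk] := tn _ e2; exists k0 => k /hk.
rewrite /tsum !add0r.
have -> : Phi l 1 = circ.
  by apply/funext => y; rewrite /Phi mulr1 (addrC l) subrK rmorph1 mul1r (addrC w) subrK.
have -> : (Phi l)^~ 1 = (Phi l)^~ 0.
  by apply/funext => x; rewrite /Phi /circ mulr0 mulr1 cis2pi cis0.
set A := psum _ _ _ _ _; set B := psum _ _ _ _ _; set D := psum _ _ _ _ _ => h.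
have -> : B = (A + B - A - D) + D by ring.
by have := cabsD (A + B - A - D) D; have := bottom k; rewrite -/D; lra.
Qed.

(** Writing g(z) = g(w) + (z - w) F(z), the kernel has mean 1 and F(z) z has mean 0, since its
    averages are trapezoidal sums divided by a factor bounded away from 0. *)
Lemma cauchy_formula : cbdd r g -> Lam r (fun z => z / (z - w) * g z) = g w.
Proof.
move=> [M hM]; have r0' := ltW r0.
pose K (z : C) := z / (z - w).
have bK : cbdd r K by exists (r / (r - cabs w)) => z zr; exact: kernel_le.
have b1 : cbdd r (fun z => F z * z).
  exists ((M + cabs (g w)) / d * r) => z zr; rewrite cabsM zr ler_pM2r // cabsM cabsV.
  have dz : d <= cabs (z - w) by exact: cabs_sub_circ.
  rewrite ler_pM ?invr_ge0 ?cabs_ge0 //.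
    by rewrite (le_trans (cabsB _ _)) // lerD // hM.
  by rewrite lef_pV2 // posrE // (lt_le_trans d0).
have L0 : Lam r (fun z => F z * z) = 0.
  apply: LIM_eq; first exact: avg_bdd.
  (* The 2 in the maximum is there because [rt_sub_inv] starts at level 2. *)
  move=> e e0; have [k0 hk] := cauchy_psum e0; exists (maxn k0 2) => -[|[|k]]; rewrite ?geq_max ?andbF //.
  rewrite -!geq_max geq_max => /andP[kk _].
  have := hk _ kk; rewrite subr0 psum_circle cabsM => h.
  apply: le_trans h; rewrite ler_peMl ?cabs_ge0 //; exact: rt_sub_inv.
have E : Lam r (fun z => K z * g z) = g w * Lam r K + Lam r (fun z => F z * z).
  rewrite -Lam_lin //; apply: eq_Lam => // z zr; rewrite /K /F.
  by have := sub_circ_neq0 wr zr => n0; field.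
by rewrite E L0 addr0 Lam_kernel // mulr1.
Qed.

End Cauchy.

End Circle.

(** * Holomorphic functions of several variables *)

Section OneVariable.
Variable R : realType.
Local Notation C := (Cplx R).

(** By Cauchy's formula at w and at 0, the remainder of order one is the mean of (w/z)^2 * z/(z - w)
    * g(z). *)
Lemma cauchy_first_order (g : C -> C) (r M : R) : 0 < r ->
  (forall z, cabs z <= r -> AH1 g z) -> (forall z, cabs z = r -> cabs (g z) <= M) ->
  cabs (Lam r (fun z => z^-1 * g z)) <= M / r /\ forall w, cabs w <= r / 2 ->
    cabs (g w - g 0 - Lam r (fun z => z^-1 * g z) * w) <= 2 * M * (cabs w / r) ^+ 2.
Proof.
move=> r0 hg hM; have r0' := ltW r0; split.
  apply: Lam_le => // z zr; rewrite cabsM cabsV zr mulrC ler_wpM2r ?invr_ge0 //; exact: hM.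
move=> w wr; have wr' : cabs w < r by lra.
have bg : cbdd r g by exists M.
have bk : cbdd r (fun z => z / (z - w) * g z).
  exists (r / (r - cabs w) * M) => z zr.
  by rewrite cabsM ler_pM ?cabs_ge0 ?hM //; exact: kernel_le.
have bi : cbdd r (fun z => z^-1 * g z).
  by exists (r^-1 * M) => z zr; rewrite cabsM cabsV zr ler_wpM2l ?invr_ge0 ?hM.
have z0r : cabs (0 : C) < r by rewrite cabs0.
have <- := cauchy_formula r0 wr' hg bg.
have <- := cauchy_formula r0 z0r hg bg.
have -> : Lam r (fun z => z / (z - 0) * g z) = Lam r g.
  by apply: eq_Lam => // z zr; rewrite subr0 divff ?mul1r // (circ_neq0 r0 zr).
have -> : Lam r (fun z => z / (z - w) * g z) - Lam r g - Lam r (fun z => z^-1 * g z) * w =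
  Lam r (fun z => - w * (z^-1 * g z) + ((-1) * g z + z / (z - w) * g z)).
  have b2 : cbdd r (fun z => (-1) * g z + z / (z - w) * g z).
    have [M1 h1] := bk; exists (M + M1) => z zr.
    by rewrite (le_trans (cabsD _ _)) // lerD ?h1 // mulN1r cabsN hM.
  by rewrite Lam_lin // Lam_lin //; ring.
apply: Lam_le => // z zr.
have n1 := circ_neq0 r0 zr; have n2 := sub_circ_neq0 wr' zr.
have -> : - w * (z^-1 * g z) + (-1 * g z + z / (z - w) * g z) = (w / z) ^+ 2 * (z / (z - w)) * g z.
  by field; rewrite n1 n2.
have q0 : 0 <= (cabs w / r) ^+ 2 by rewrite exprn_ge0 // divr_ge0 ?cabs_ge0.
have k2 : cabs (z / (z - w)) <= 2.
  apply: le_trans (kernel_le r0 wr' zr) _; rewrite ler_pdivrMr ?subr_gt0 //; lra.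
rewrite (cabsM _ (g z)) (cabsM _ (z / _)) cabsX (cabsM w) cabsV zr.
rewrite -mulrA mulrC; apply: ler_wpM2r => //.
by apply: ler_pM; rewrite ?cabs_ge0 ?hM.
Qed.

End OneVariable.

Section Multi.
Variable R : realType.
Local Notation C := (Cplx R).
Variable n : nat.
Implicit Types (G H : 'rV[C]_n -> C) (p h : 'rV[C]_n).

Definition dotv (v h : 'rV[C]_n) : C := \sum_i v 0 i * h 0 i.

Lemma dotvD v h k : dotv v (h + k) = dotv v h + dotv v k.
Proof. by rewrite /dotv -big_split; apply: eq_bigr => i _; rewrite mxE mulrDr. Qed.

Lemma dotvZ v (t : C) h : dotv v (t *: h) = t * dotv v h.
Proof. by rewrite /dotv mulr_sumr; apply: eq_bigr => i _; rewrite mxE mulrCA. Qed.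

Lemma dotv_le (v h : 'rV[C]_n) (M : R) : (forall i, cabs (v 0 i) <= M) -> cabs (dotv v h) <= n%:R * M * vn h.
Proof.
move=> hM; apply: le_trans (cabs_sum _ _ _) _.
have -> : n%:R * M * vn h = \sum_(i < n) (M * vn h) by rewrite sumr_const card_ord -[RHS]mulr_natl mulrA.
by apply: ler_sum => i _; rewrite cabsM ler_pM ?cabs_ge0 ?hM ?cabs_le_vn.
Qed.

Lemma dotv_delta v i : dotv v (delta_mx 0 i) = v 0 i.
Proof.
rewrite /dotv (bigD1 i) //= mxE !eqxx mulr1 big1 ?addr0 // => j ji.
by rewrite mxE (negbTE ji) andbF mulr0.
Qed.

Lemma vn_delta (i : 'I_n) : vn (delta_mx 0 i : 'rV[C]_n) = 1.
Proof.
apply/eqP; rewrite eq_le; apply/andP; split.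
  apply: vn_le => // j; rewrite mxE eqxx /=; case: eqP => _; rewrite ?cabs1 ?cabs0 //.
by apply: le_trans (cabs_le_vn _ i); rewrite mxE !eqxx cabs1.
Qed.

Definition AHn G p := forall e r0 : R, 0 < e -> 0 < r0 -> exists r H,
  [/\ 0 < r, r <= r0 & forall y, vn (y - p) < r -> differentiable H y /\ cabs (G y - H y) <= e * r].

Lemma differentiable_AHn G p (r : R) : 0 < r ->
  (forall y, vn (y - p) < r -> differentiable G y) -> AHn G p.
Proof.
move=> r0 h e r1 e0 r10; exists (Num.min r r1), G; split.
- by rewrite lt_min r0.
- by rewrite ge_min lexx orbT.
move=> y; rewrite lt_min => /andP[yr _]; split; first exact: h.
by rewrite subrr cabs0 mulr_ge0 ?ltW // lt_min r0.
Qed.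

Lemma cdiff_line H p h (t : C) : differentiable H (p + t *: h) ->
  cdiff (fun s => H (p + s *: h)) t.
Proof.
move=> /differentiable_vderiv; set v := \row_i _ => hv; exists (dotv v h) => e e0.
have K0 : 0 < vn h + 1 by rewrite ltr_wpDl // vn_ge0.
have [r r0 hr] := hv _ (divr_gt0 e0 K0); exists (r / (vn h + 1)); first by rewrite divr_gt0.
move=> s; rewrite ltr_pdivlMr // => sr.
have sh : vn (s *: h) <= cabs s * (vn h + 1).
  by rewrite vnZ ler_wpM2l ?cabs_ge0 // lerDl.
have := hr _ (le_lt_trans sh sr).
rewrite -/(dotv v (s *: h)) dotvZ scalerDl addrA (mulrC s) => /le_trans; apply.
apply: le_trans (ler_wpM2l _ sh) _; first by rewrite divr_ge0 ?ltW.
by rewrite mulrCA divfK ?(gt_eqF K0) // mulrC.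
Qed.

Lemma AH1_line G p h (t : C) : 0 < vn h -> AHn G (p + t *: h) ->
  AH1 (fun s => G (p + s *: h)) t.
Proof.
move=> h0 ah e r0 e0 r00.
have [r [H [r1 rr hH]]] := ah (e / vn h) (r0 * vn h) (divr_gt0 e0 h0) (mulr_gt0 r00 h0).
exists (r / vn h), (fun s => H (p + s *: h)); split.
- by rewrite divr_gt0.
- by rewrite ler_pdivrMr.
move=> s; rewrite ltr_pdivlMr // => sr.
have [|dH b] := hH (p + s *: h).
  have -> : p + s *: h - (p + t *: h) = (s - t) *: h by rewrite scalerBl opprD addrACA subrr add0r.
  by rewrite vnZ.
split; first exact: cdiff_line.
by rewrite mulrA mulrAC.
Qed.

(** Cauchy's estimates on the complex line through p in the direction h, on the disc that reaches
    distance r / 2 from p. Nothing is said yet about how d depends on h. *)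
Lemma line_first_order G p h (r M : R) : 0 < r ->
  (forall y, vn (y - p) < r -> AHn G y /\ cabs (G y) <= M) ->
  exists d, cabs d <= 2 * M * vn h / r /\ forall t, cabs t * vn h <= r / 4 ->
    cabs (G (p + t *: h) - G p - d * t) <= 8 * M * (cabs t * vn h / r) ^+ 2.
Proof.
move=> r0 hG; have M0 : 0 <= M.
  by have [|_ /(le_trans (cabs_ge0 _))] := hG p; rewrite ?subrr ?vn0.
have [h0|h0] := eqVneq (vn h) 0.
  exists 0; split; first by rewrite cabs0 h0 mulr0 mul0r.
  move=> t _; have /eqP := h0; rewrite vn_eq0 => /eqP ->.
  rewrite scaler0 addr0 mul0r subr0 subrr cabs0.
  apply: mulr_ge0; first by rewrite mulr_ge0.
  by rewrite exprn_ge0 // divr_ge0 ?mulr_ge0 ?cabs_ge0 ?vn_ge0 // ltW.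
have {}h0 : 0 < vn h by rewrite lt_neqAle eq_sym h0 vn_ge0.
pose s := r / (2 * vn h); have s0 : 0 < s by rewrite divr_gt0 // mulr_gt0.
have sh : s * vn h = r / 2 by rewrite /s; field; rewrite (gt_eqF h0).
have inb t : cabs t <= s -> vn (p + t *: h - p) < r.
  move=> ts; rewrite addrC addKr vnZ; have := ler_wpM2r (ltW h0) ts; rewrite sh; lra.
have [||] := @cauchy_first_order R (fun t => G (p + t *: h)) s M s0; last set d := Lam _ _ => d1 d2.
- by move=> t /inb /hG[ah _]; exact: AH1_line.
- by move=> t ts; have [|] := hG (p + t *: h); rewrite ?inb ?ts.
exists d; split.
  by apply: le_trans d1 _; rewrite /s invf_div; lra.
move=> t th; have := d2 t; rewrite scale0r addr0 => h1; apply: le_trans (h1 _) _.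
  by rewrite -(ler_pM2r h0) mulrAC sh; lra.
have -> : cabs t / s = 2 * (cabs t * vn h / r) by rewrite /s; field; rewrite (gt_eqF h0) (gt_eqF r0).
by rewrite exprMn; lra.
Qed.

Lemma quad_zero (a K s : R) : 0 < s -> (forall t, 0 < t <= s -> t * a <= K * t ^+ 2) -> a <= 0.
Proof.
move=> s0 h; apply: eps_le0 => e e0.
have K0 : 0 < `|K| + 1 by rewrite ltr_wpDl.
pose t := Num.min s (e / (`|K| + 1)).
have t0 : 0 < t by rewrite lt_min s0 divr_gt0.
have ts : t <= s by rewrite ge_min lexx.
have te : t * (`|K| + 1) <= e by rewrite -ler_pdivlMr // ge_min lexx orbT.
have := h t; rewrite t0 ts => /(_ isT); rewrite expr2 mulrA (mulrC K) -!mulrA ler_pM2l // => h1.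
have h2 : K <= `|K| + 1 by have := ler_norm K; lra.
have := ler_wpM2l (ltW t0) h2; lra.
Qed.

Lemma AHn_sub G H p (r : R) : 0 < r -> AHn G p ->
  (forall y, vn (y - p) < r -> differentiable H y) -> AHn (fun y => G y - H y) p.
Proof.
move=> r0 ah dH e r1 e0 r10.
have [|s [K [s0 sr hK]]] := ah e (Num.min r r1) e0; first by rewrite lt_min r0.
move: sr; rewrite le_min => /andP[sr sr1].
exists s, (fun y => K y - H y); split; [exact: s0|exact: sr1|] => y ys; have [dK b] := hK y ys; split.
  by apply: differentiableB; [exact: dK|apply: dH; exact: lt_le_trans ys sr].
by rewrite opprB addrA subrK.
Qed.

(** Each complex line carries a directional derivative d h; the issue is its linearity in h. If H is
    differentiable and within (e / 2) * s of G on a ball of radius s, Cauchy's estimate for G - H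
    puts d within e of the differential of H at p. So d is a limit of linear forms, hence linear. *)
Lemma AHn_first_order G p (r M : R) : 0 < r ->
  (forall y, vn (y - p) < r -> AHn G y /\ cabs (G y) <= M) ->
  exists v, [/\ vderiv G p v, forall h, cabs (dotv v h) <= 2 * M * vn h / r &
    forall h, vn h <= r / 4 -> cabs (G (p + h) - G p - dotv v h) <= 8 * M * (vn h / r) ^+ 2].
Proof.
move=> r0 hG; have /choice[d hd] := fun h => line_first_order h r0 hG.
pose v : 'rV[C]_n := \row_i d (delta_mx 0 i).
have approx e : 0 < e -> exists u : 'rV[C]_n, forall h, cabs (d h - dotv u h) <= e * vn h.
  move=> e0; have e2 : 0 < e / 2 by rewrite divr_gt0.
  have [|ahp _] := hG p; first by rewrite subrr vn0.
  have [s [H [s0 sr hH]]] := ahp _ _ e2 r0.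
  have dHp : differentiable H p by have [|] := hH p; rewrite ?subrr ?vn0.
  have := differentiable_vderiv dHp; set u := \row_i _ => hu; exists u => h.
  have bGH y : vn (y - p) < s -> AHn (fun y => G y - H y) y /\ cabs (G y - H y) <= e / 2 * s.
    move=> ys; have [dH b] := hH y ys; split => //.
    have sy : 0 < s - vn (y - p) by rewrite subr_gt0.
    apply: (AHn_sub sy).
      by have [|] := hG y; rewrite ?(lt_le_trans ys).
    move=> z zy; have [|//] := hH z.
    by apply: le_lt_trans (vn_tri _ y _) _; move: zy; lra.
  have [d' [d'1 d'2]] := line_first_order h s0 bGH.
  (* Here an approximation to order o(radius) suffices: the error is proportional to s, and Cauchy's
     estimate divides it by s. *)
  have -> : e * vn h = 2 * (e / 2 * s) * vn h / s by field; rewrite (gt_eqF s0).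
  suff -> : d h - dotv u h = d' by [].
  apply/eqP; rewrite -subr_eq0 -cabs_eq0 eq_le cabs_ge0 andbT; apply: eps_le0 => e' e'0.
  pose q := vn h + 1; have q0 : 0 < q by rewrite ltr_wpDl // vn_ge0.
  have [s1 s10 hs1] := hu _ (divr_gt0 e'0 q0).
  pose K := 8 * M * (q / r) ^+ 2 + 8 * (e / 2 * s) * (q / s) ^+ 2.
  have M0 : 0 <= M.
    by have [|_ /(le_trans (cabs_ge0 _))] := hG p; rewrite ?subrr ?vn0.
  rewrite -subr_le0; pose m := Num.min (Num.min (r / 4) (s / 4)) (s1 / 2) / q.
  have m0 : 0 < m by rewrite divr_gt0 // !lt_min !divr_gt0.
  apply: (@quad_zero _ K m) => // t /andP[t0 tm].
  have : t * q <= Num.min (Num.min (r / 4) (s / 4)) (s1 / 2) by rewrite -ler_pdivlMr.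
  rewrite !le_min => /andP[/andP[t1 t2] t3].
  have ct : cabs t%:C = t by rewrite cabs_real gtr0_norm.
  have tq : t * vn h <= t * q by rewrite ler_pM2l // lerDl.
  have i1 := proj2 (hd h) t%:C; rewrite ct in i1; have {}i1 := i1 (le_trans tq t1).
  have i2 := d'2 t%:C; rewrite ct in i2; have {}i2 := i2 (le_trans tq t2).
  have i3 := hs1 (t%:C *: h); rewrite vnZ ct -/(dotv u _) dotvZ in i3.
  have {}i3 : cabs (H (p + t%:C *: h) - H p - t%:C * dotv u h) <= e' / q * (t * vn h).
    by apply: i3; move: s10 tq t3; drop_order; lra.
  have b3 : e' / q * (t * vn h) <= t * e'.
    apply: le_trans (ler_wpM2l _ tq) _; first by rewrite divr_ge0 // ltW.
    by rewrite mulrCA divfK ?(gt_eqF q0).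
  have sq (x : R) : 0 < x -> (t * vn h / x) ^+ 2 <= (q / x) ^+ 2 * t ^+ 2.
    move=> x0; rewrite -exprMn lerXn2r ?nnegrE ?mulr_ge0 ?invr_ge0 ?vn_ge0 ?(ltW t0) ?(ltW x0) ?(ltW q0) //.
    rewrite (_ : q / x * t = t * q / x); last by ring.
    by rewrite ler_pM2r ?invr_gt0 // ler_pM2l // lerDl.
  have j1 := ler_wpM2l (_ : 0 <= 8 * M) (sq r r0); have {}j1 := j1 (mulr_ge0 (ler0n _ _) M0).
  have j2 := ler_wpM2l (_ : 0 <= 8 * (e / 2 * s)) (sq s s0).
  have {}j2 : 8 * (e / 2 * s) * (t * vn h / s) ^+ 2 <= 8 * (e / 2 * s) * ((q / s) ^+ 2 * t ^+ 2).
    by apply: j2; rewrite !mulr_ge0 // ltW.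
  set X := G (p + _) - G p - _ in i1; set Y := _ - d' * _ in i2; set Z := H _ - _ - _ in i3.
  have E : t%:C * (d h - dotv u h - d') = Y - X + Z by rewrite /X /Y /Z; ring.
  have : t * cabs (d h - dotv u h - d') = cabs (Y - X + Z) by rewrite -E cabsM ct.
  have := cabsD (Y - X) Z; have := cabsB Y X.
  rewrite mulrBr /K mulrDl => k1 k2 ->; move: k1 k2 i1 i2 i3 b3 j1 j2; drop_order; lra.
have lin h : d h = dotv v h.
  apply/eqP; rewrite -subr_eq0 -cabs_eq0 eq_le cabs_ge0 andbT; apply: eps_le0 => e e0.
  pose K := vn h + n%:R * vn h + 1.
  have K0 : 0 < K by rewrite ltr_wpDl // addr_ge0 ?mulr_ge0 ?vn_ge0.
  have [u hu] := approx _ (divr_gt0 e0 K0).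
  have h1 : cabs (dotv u h - dotv v h) <= n%:R * (e / K) * vn h.
    have -> : dotv u h - dotv v h = dotv (u - v) h.
      by rewrite /dotv -sumrB; apply: eq_bigr => i _; rewrite !mxE mulrBl.
    apply: dotv_le => i; rewrite !mxE cabs_sub.
    by have := hu (delta_mx 0 i); rewrite dotv_delta vn_delta mulr1.
  have -> : d h - dotv v h = (d h - dotv u h) + (dotv u h - dotv v h) by ring.
  apply: le_trans (cabsD _ _) _; apply: le_trans (lerD (hu h) h1) _.
  have -> : e / K * vn h + n%:R * (e / K) * vn h = e / K * (K - 1) by rewrite /K; ring.
  rewrite mulrBr divfK ?(gt_eqF K0) // mulr1 gerBl; rewrite divr_ge0 //; exact: ltW.
exists v; split.
- move=> e e0; have M0 : 0 <= M.
    by have [|_ /(le_trans (cabs_ge0 _))] := hG p; rewrite ?subrr ?vn0.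
  pose K := 8 * M / r ^+ 2 + 1; have K0 : 0 < K by rewrite ltr_wpDl // divr_ge0 ?mulr_ge0 ?exprn_ge0 // ltW.
  exists (Num.min (r / 4) (e / K)); first by rewrite lt_min !divr_gt0.
  move=> h; rewrite lt_min => /andP[h1 h2]; rewrite -/(dotv v h) -lin.
  have := proj2 (hd h) 1; rewrite cabs1 mul1r scale1r mulr1 => /(_ (ltW h1)) /le_trans; apply.
  have -> : 8 * M * (vn h / r) ^+ 2 = 8 * M / r ^+ 2 * vn h * vn h by field; rewrite (gt_eqF r0).
  rewrite ler_wpM2r ?vn_ge0 //; move: h2; rewrite ltr_pdivlMr // => /ltW; apply: le_trans.
  by rewrite mulrC ler_wpM2l ?vn_ge0 // lerDl.
- by move=> h; rewrite -lin; exact: (proj1 (hd h)).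
- move=> h hr; have := proj2 (hd h) 1; rewrite cabs1 mul1r scale1r mulr1 -lin; exact.
Qed.

End Multi.

(** * Cauchy estimates for bounded holomorphic functions *)

Section HoloBounds.
Variable R : realType.
Local Notation C := (Cplx R).
Variable n : nat.
Implicit Types (G H : 'rV[C]_n -> C) (p h q : 'rV[C]_n).

Lemma vn_addK p h : vn (p + h - p) = vn h.
Proof. by rewrite (addrC p) addrK. Qed.

Lemma vn_shift p q h : vn (p + h - q) <= vn (p - q) + vn h.
Proof. by rewrite addrAC vnD. Qed.

Definition holb G p (r M : R) := forall y, vn (y - p) < r -> differentiable G y /\ cabs (G y) <= M.

Definition grad G p : 'rV[C]_n := \row_i 'D_(delta_mx 0 i) G p.

Lemma AHn_differentiable G p (r M : R) : 0 < r ->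
  (forall y, vn (y - p) < r -> AHn G y /\ cabs (G y) <= M) -> differentiable G p.
Proof. by move=> r0 /(AHn_first_order r0)[v [/vderiv_differentiable]]. Qed.

Lemma holb_sub G p q (r s M : R) : holb G p r M -> vn (q - p) + s <= r -> holb G q s M.
Proof.
move=> hG qs y ys; apply: hG; apply: le_lt_trans (vn_tri _ q _) _; move: qs ys; lra.
Qed.

Lemma holb_ge0 G p (r M : R) : 0 < r -> holb G p r M -> 0 <= M.
Proof.
by move=> r0 hG; have [|_ /(le_trans (cabs_ge0 _))] := hG p; rewrite ?subrr ?vn0.
Qed.

Lemma holb_first_order G p (r M : R) : 0 < r -> holb G p r M ->
  (forall h, cabs (dotv (grad G p) h) <= 2 * M * vn h / r) /\
  forall h, vn h <= r / 4 -> cabs (G (p + h) - G p - dotv (grad G p) h) <= 8 * M * (vn h / r) ^+ 2.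
Proof.
move=> r0 hG; have [|v [vd v1 v2]] := @AHn_first_order R n G p r M r0.
  move=> y yr; have [dG bG] := hG y yr; split => //.
  have yr' : 0 < r - vn (y - p) by rewrite subr_gt0.
  apply: (differentiable_AHn yr') => z zy.
  have [|//] := hG z; apply: le_lt_trans (vn_tri _ y _) _; move: zy; lra.
have -> : grad G p = v by apply/rowP => i; rewrite mxE (vderiv_partial i vd).
by [].
Qed.

Lemma holb_grad_le G p (r M : R) i : 0 < r -> holb G p r M ->
  cabs ('D_(delta_mx 0 i) G p) <= 2 * M / r.
Proof.
move=> r0 hG; have [h1 _] := holb_first_order r0 hG.
by have := h1 (delta_mx 0 i); rewrite dotv_delta vn_delta mulr1 mxE.
Qed.

Lemma holb_lip_center G p (r M : R) h : 0 < r -> holb G p r M -> vn h < r ->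
  cabs (G (p + h) - G p) <= 8 * M / r * vn h.
Proof.
move=> r0 hG hr; have M0 := holb_ge0 r0 hG; have [h1 h2] := holb_first_order r0 hG.
have [hs|hl] := leP (vn h) (r / 4).
  have := cabsD (G (p + h) - G p - dotv (grad G p) h) (dotv (grad G p) h).
  rewrite subrK => /le_trans; apply; apply: le_trans (lerD (h2 h hs) (h1 h)) _.
  have q1 : vn h / r <= 1 / 4 by rewrite ler_pdivrMr //; lra.
  have q0 : 0 <= vn h / r by rewrite divr_ge0 ?vn_ge0 // ltW.
  have := ler_wpM2l q0 q1; have := ler_wpM2l M0 (ler_wpM2l q0 q1).
  have := mulr_ge0 M0 q0; rewrite -expr2 => k1 k2 k3.
  have -> : 2 * M * vn h / r = 2 * (M * (vn h / r)) by ring.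
  have -> : 8 * M / r * vn h = 8 * (M * (vn h / r)) by ring.
  lra.
have -> : 8 * M / r * vn h = 2 * M * (4 * (vn h / r)) by ring.
have i1 : 1 <= 4 * (vn h / r) by rewrite mulrA ler_pdivlMr //; lra.
have [|_ b1] := hG (p + h); first by rewrite vn_addK.
have [|_ b2] := hG p; first by rewrite subrr vn0.
have := cabsB (G (p + h)) (G p); have := ler_wpM2l (_ : 0 <= 2 * M) i1.
by rewrite mulr_ge0 // => /(_ isT); lra.
Qed.

Lemma holb_lip G p (r M : R) x y : 0 < r -> holb G p r M ->
  vn (x - p) < r / 2 -> vn (y - p) < r / 2 -> cabs (G x - G y) <= 32 * M / r * vn (x - y).
Proof.
move=> r0 hG xr yr; have r2 : 0 < r / 2 by rewrite divr_gt0.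
have M0 := holb_ge0 r0 hG.
have hGy : holb G y (r / 2) M by apply: holb_sub hG _; lra.
have hGx : holb G x (r / 2) M by apply: holb_sub hG _; lra.
have [c|c] := ltP (vn (x - y)) (r / 2).
  have := holb_lip_center r2 hGy c; rewrite (addrC y) subrK => /le_trans; apply.
  rewrite ler_wpM2r ?vn_ge0 // invf_div; have := divr_ge0 M0 (ltW r0); lra.
have [|_ bx] := hG x; first by move: r0 xr; lra.
have [|_ yb] := hG y; first by move: r0 yr; lra.
have := cabsB (G x) (G y).
have -> : 32 * M / r * vn (x - y) = 16 * (M * (vn (x - y) / (r / 2))).
  by field; rewrite gt_eqF.
have : 1 <= vn (x - y) / (r / 2) by rewrite ler_pdivlMr // mul1r.
by move=> /(ler_wpM2l M0); lra.
Qed.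

Lemma quad_unique (X : R -> C) (a b : C) (K K' s : R) : 0 < s ->
  (forall t, 0 < t <= s -> cabs (X t - a * t%:C) <= K * t ^+ 2) ->
  (forall t, 0 < t <= s -> cabs (X t - b * t%:C) <= K' * t ^+ 2) -> a = b.
Proof.
move=> s0 ha hb; apply/eqP; rewrite -subr_eq0 -cabs_eq0 eq_le cabs_ge0 andbT.
apply: (@quad_zero _ _ (K + K') s) => // t ts; have := ha t ts; have := hb t ts.
have t0 : 0 < t by case/andP: ts.
have -> : t * cabs (a - b) = cabs ((X t - b * t%:C) - (X t - a * t%:C)).
  have -> : (X t - b * t%:C) - (X t - a * t%:C) = t%:C * (a - b) by ring.
  by rewrite cabsM cabs_real gtr0_norm.
have := cabsB (X t - b * t%:C) (X t - a * t%:C); rewrite mulrDl; lra.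
Qed.

Lemma AH1_line_holb G p h (r M : R) (t : C) : holb G p r M -> 0 < vn h ->
  cabs t * vn h < r -> AH1 (fun s => G (p + s *: h)) t.
Proof.
move=> hG h0 tr.
have r' : 0 < (r - cabs t * vn h) / vn h by rewrite divr_gt0 // subr_gt0.
apply: (cdiff_AH1 r') => s; rewrite ltr_pdivlMr // => sr.
apply: cdiff_line; have [|//] := hG (p + s *: h).
rewrite vn_addK vnZ; have := ler_wpM2r (ltW h0) (_ : cabs s <= cabs t + cabs (s - t)).
by rewrite -{1}(subrK t s) addrC => /(_ (cabsD _ _)); lra.
Qed.

Lemma partial_Lam G p (r M : R) i : 0 < r -> holb G p r M -> forall s, 0 < s < r ->
  'D_(delta_mx 0 i) G p = Lam s (fun z => z^-1 * G (p + z *: delta_mx 0 i)).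
Proof.
move=> r0 hG s /andP[s0 sr]; pose u : 'rV[C]_n := delta_mx 0 i.
have u1 : vn u = 1 by exact: vn_delta.
have [_ h2] := holb_first_order r0 hG.
have [||_ d2] := @cauchy_first_order R (fun t => G (p + t *: u)) s M s0.
- by move=> t ts; apply: (AH1_line_holb hG); rewrite u1 ?ltr01 // mulr1; lra.
- by move=> t ts; have [|] := hG (p + t *: u); rewrite ?vn_addK ?vnZ ?u1 ?mulr1 ?ts.
have m0 : 0 < Num.min (r / 4) (s / 2) by rewrite lt_min !divr_gt0.
apply: (@quad_unique (fun t : R => G (p + t%:C *: u) - G p) _ _ (8 * M / r ^+ 2) (2 * M / s ^+ 2) _ m0) => t /andP[t0];
  rewrite le_min => /andP[t1 t2].
  have := h2 (t%:C *: u); rewrite vnZ u1 mulr1 cabs_real gtr0_norm // dotvZ dotv_delta mxE (mulrC t%:C).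
  by move=> /(_ t1) /le_trans; apply; rewrite expr_div_n; lra.
have := d2 t%:C; rewrite cabs_real gtr0_norm // scale0r addr0.
by move=> /(_ t2) /le_trans; apply; rewrite expr_div_n; lra.
Qed.

Lemma Lam_dotv (r : R) (V : C -> 'rV[C]_n) h : 0 <= r -> (forall j, cbdd r (fun z => V z 0 j)) ->
  Lam r (fun z => dotv (V z) h) = dotv (\row_j Lam r (fun z => V z 0 j)) h.
Proof.
move=> r0 bV; rewrite /dotv.
have [L _] := Lam_sum (fun j : 'I_n => h 0 j) r0 bV.
transitivity (Lam r (fun z => \sum_(i < n) h 0 i * V z 0 i)).
  by apply: eq_Lam => // z _; apply: eq_bigr => j _; rewrite mulrC.
by rewrite L; apply: eq_bigr => j _; rewrite mxE mulrC.
Qed.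

Lemma dotv_scale (c : C) v h : dotv (c *: v) h = c * dotv v h.
Proof. by rewrite /dotv mulr_sumr; apply: eq_bigr => i _; rewrite mxE mulrA. Qed.

Lemma cbdd_dotv (r : R) (V : C -> 'rV[C]_n) h : (forall j, cbdd r (fun z => V z 0 j)) ->
  cbdd r (fun z => dotv (V z) h).
Proof.
move=> /choice[M hM]; exists (\sum_j M j * cabs (h 0 j)) => z zr.
apply: le_trans (cabs_sum _ _ _) _; apply: ler_sum => j _.
by rewrite cabsM ler_wpM2r ?cabs_ge0 ?hM.
Qed.

(** By [partial_Lam] the partial derivative is a mean over a circle whose radius does not depend on
    y. Differentiating under the mean is legitimate because the quadratic remainder of G is uniform
    on the circle. *)
Lemma holb_partial G p (r M : R) i : 0 < r -> holb G p r M ->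
  holb (fun y => 'D_(delta_mx 0 i) G y) p (r / 2) (4 * M / r).
Proof.
move=> r0 hG y yr; have M0 := holb_ge0 r0 hG.
have r2 : 0 < r / 2 by rewrite divr_gt0.
have hGy : holb G y (r / 2) M by apply: holb_sub hG _; lra.
split; last first.
  by have := holb_grad_le i r2 hGy; rewrite invf_div; lra.
pose u : 'rV[C]_n := delta_mx 0 i; have u1 : vn u = 1 by exact: vn_delta.
pose s := r / 4; have s0 : 0 < s by rewrite divr_gt0.
have s0' := ltW s0.
pose V (z : C) := z^-1 *: grad G (y + z *: u).
have hGz z : cabs z = s -> holb G (y + z *: u) s M.
  move=> zs; apply: holb_sub hG _.
  have := vn_shift y p (z *: u); rewrite vnZ u1 zs /s; lra.
have bV j : cbdd s (fun z => V z 0 j).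
  exists (s^-1 * (2 * M / s)) => z zs; rewrite !mxE cabsM cabsV zs ler_wpM2l ?invr_ge0 //.
  by apply: holb_grad_le => //; exact: hGz.
apply: (@vderiv_differentiable _ _ _ _ (\row_j Lam s (fun z => V z 0 j))) => e e0.
pose K := 8 * M / s ^+ 3 + 1.
have K0 : 0 < K by rewrite ltr_wpDl // mulr_ge0 ?mulr_ge0 // invr_ge0 exprn_ge0.
exists (Num.min (Num.min (s / 4) (e / K)) (r / 2 - vn (y - p))).
  by rewrite !lt_min !divr_gt0 //= subr_gt0.
move=> h; rewrite !lt_min => /andP[/andP[h1 h2] h3].
rewrite -/(dotv _ h) -Lam_dotv //.
have hyh : vn (y + h - p) < r / 2.
  have := vn_shift y p h; lra.
have hGyh : holb G (y + h) (r / 2) M by apply: holb_sub hG _; lra.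
have sr : 0 < s < r / 2 by rewrite s0 /s; lra.
rewrite (partial_Lam i r2 hGy sr) (partial_Lam i r2 hGyh sr).
have b1 (q : 'rV[C]_n) : vn (q - p) < r / 2 -> cbdd s (fun z => z^-1 * G (q + z *: u)).
  move=> qr; exists (s^-1 * M) => z zs; rewrite cabsM cabsV zs ler_wpM2l ?invr_ge0 //.
  have [|//] := hG (q + z *: u).
  have := vn_shift q p (z *: u); rewrite vnZ u1 zs /s; lra.
have b2 : cbdd s (fun z => dotv (V z) h) by exact: cbdd_dotv.
have b3 : cbdd s (fun z => (-1) * (z^-1 * G (y + z *: u)) + z^-1 * G (y + h + z *: u)).
  have [M1 m1] := b1 _ yr; have [M2 m2] := b1 _ hyh; exists (M1 + M2) => z zs.
  by rewrite (le_trans (cabsD _ _)) // lerD ?m2 // mulN1r cabsN m1.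
have -> : Lam s (fun z => z^-1 * G (y + h + z *: u)) - Lam s (fun z => z^-1 * G (y + z *: u)) -
   Lam s (fun z => dotv (V z) h) = Lam s (fun z => (-1) * dotv (V z) h +
     ((-1) * (z^-1 * G (y + z *: u)) + z^-1 * G (y + h + z *: u))).
  by rewrite Lam_lin // Lam_lin //; [ring|exact: b1|exact: b1].
apply: (@le_trans _ _ (s^-1 * (8 * M * (vn h / s) ^+ 2))).
  apply: Lam_le => // z zs; rewrite dotv_scale.
  have -> : -1 * (z^-1 * dotv (grad G (y + z *: u)) h) + (-1 * (z^-1 * G (y + z *: u)) + z^-1 * G (y + h + z *: u))
    = z^-1 * (G (y + z *: u + h) - G (y + z *: u) - dotv (grad G (y + z *: u)) h).
    by rewrite (addrAC y h); ring.
  rewrite cabsM cabsV zs ler_wpM2l ?invr_ge0 //.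
  by have [_ ->] := holb_first_order s0 (hGz z zs); rewrite // ltW.
have -> : s^-1 * (8 * M * (vn h / s) ^+ 2) = 8 * M / s ^+ 3 * vn h * vn h by field; rewrite gt_eqF.
rewrite ler_wpM2r ?vn_ge0 //; move: h2; rewrite ltr_pdivlMr // => /ltW; apply: le_trans.
by rewrite mulrC ler_wpM2l ?vn_ge0 // lerDl.
Qed.

(** With N equal steps the quadratic errors add up to K / N. *)
Lemma mean_value_le (phi : R -> C) (B K s : R) : 0 < s ->
  (forall t x, 0 <= t <= 1 -> 0 <= x <= s -> t + x <= 1 -> cabs (phi (t + x) - phi t) <= B * x + K * x ^+ 2) ->
  cabs (phi 1 - phi 0) <= B.
Proof.
move=> s0 h; rewrite -subr_le0; apply: eps_le0 => e e0.
have m0 : 0 < Num.min s (e / (`|K| + 1)) by rewrite lt_min s0 divr_gt0 // ltr_wpDl.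
pose N := (Num.bound (Num.min s (e / (`|K| + 1)))^-1).+1.
have N0 : 0 < N%:R :> R by rewrite ltr0n.
have xN : N%:R^-1 <= Num.min s (e / (`|K| + 1)).
  rewrite -[leRHS]invrK lef_pV2 ?posrE ?invr_gt0 // ltW // (@lt_trans _ _ (Num.bound (Num.min s (e / (`|K| + 1)))^-1)%:R) ?ltr_nat //.
  by rewrite archi_boundP // invr_ge0 ltW.
have step j : (j <= N)%N -> cabs (phi (j%:R / N%:R) - phi 0) <= j%:R * (B / N%:R + K / N%:R ^+ 2).
  elim: j => [|j ih] jN; first by rewrite !mul0r subrr cabs0.
  have i1 := ih (ltnW jN).
  have E : j.+1%:R / N%:R = j%:R / N%:R + N%:R^-1 :> R by rewrite -addn1 natrD mulrDl mul1r.
  have i2 : cabs (phi (j.+1%:R / N%:R) - phi (j%:R / N%:R)) <= B * N%:R^-1 + K * N%:R^-1 ^+ 2.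
    rewrite E; apply: h.
    - by rewrite divr_ge0 //= ler_pdivrMr // mul1r ler_nat ltnW.
    - by rewrite invr_ge0 ler0n (le_trans xN) // ge_min lexx.
    - by rewrite -E ler_pdivrMr // mul1r ler_nat.
  have -> : phi (j.+1%:R / N%:R) - phi 0 = (phi (j.+1%:R / N%:R) - phi (j%:R / N%:R)) + (phi (j%:R / N%:R) - phi 0) by ring.
  apply: le_trans (cabsD _ _) _; apply: le_trans (lerD i2 i1) _.
  by rewrite -[j.+1]addn1 natrD mulrDl mul1r addrC exprVn.
have := step N (leqnn N); rewrite divff ?gt_eqF // => h1.
have : cabs (phi 1 - phi 0) <= B + K / N%:R.
  by apply: le_trans h1 _; rewrite le_eqVlt; apply/orP; left; apply/eqP; field; rewrite gt_eqF.
have k1 : K / N%:R <= e.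
  have K1 : 0 < `|K| + 1 by rewrite ltr_wpDl.
  have := le_trans xN (_ : _ <= e / (`|K| + 1)); rewrite ge_min lexx orbT => /(_ isT).
  rewrite ler_pdivlMr // mulrC; apply: le_trans; rewrite ler_wpM2r ?invr_ge0 ?ler0n //.
  by rewrite (le_trans (ler_norm K)) // lerDl.
lra.
Qed.

Lemma holb_mean_value G p (r M B : R) h : 0 < r -> holb G p r M -> vn h <= r / 2 ->
  (forall t : R, 0 <= t <= 1 -> cabs (dotv (grad G (p + t%:C *: h)) h) <= B) ->
  cabs (G (p + h) - G p) <= B.
Proof.
move=> r0 hG hr hB; have r2 : 0 < r / 2 by rewrite divr_gt0.
pose phi (t : R) := G (p + t%:C *: h).
have -> : G (p + h) = phi 1 by rewrite /phi rmorph1 scale1r.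
have -> : G p = phi 0 by rewrite /phi rmorph0 scale0r addr0.
have s0 : 0 < 1 / 4 :> R by lra.
have M0 := holb_ge0 r0 hG.
apply: (@mean_value_le _ _ (8 * M * (vn h / (r / 2)) ^+ 2) (1 / 4) s0) => t x /andP[t0 t1] /andP[x0 x1] _.
have hGt : holb G (p + t%:C *: h) (r / 2) M.
  apply: holb_sub hG _; rewrite vn_addK vnZ cabs_real ger0_norm //.
  by have := ler_wpM2r (vn_ge0 h) t1; lra.
have [_ h2] := holb_first_order r2 hGt.
have E : p + (t + x)%:C *: h = p + t%:C *: h + x%:C *: h by rewrite rmorphD scalerDl addrA.
have := h2 (x%:C *: h); rewrite /phi E vnZ cabs_real (ger0_norm x0) dotvZ => h3.
have {}h3 := h3 _; have := cabsD (G (p + t%:C *: h + x%:C *: h) - G (p + t%:C *: h) - x%:C * dotv (grad G (p + t%:C *: h)) h) (x%:C * dotv (grad G (p + t%:C *: h)) h).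
rewrite subrK => /le_trans; apply; rewrite addrC; apply: lerD.
  rewrite cabsM cabs_real (ger0_norm x0) mulrC; apply: ler_wpM2r; first exact: x0.
  by apply: hB; rewrite t0; exact: t1.
have -> : 8 * M * (vn h / (r / 2)) ^+ 2 * x ^+ 2 = 8 * M * (x * vn h / (r / 2)) ^+ 2 by ring.
apply: h3; have := ler_wpM2r (vn_ge0 h) x1; lra.
Qed.

Lemma partial_rcons (s : seq 'I_n) i G : partial (rcons s i) G = partial s (fun y => 'D_(delta_mx 0 i) G y).
Proof. by elim: s => [|j s /= ->]; first exact: erefl. Qed.

(** Induction on a: the partial derivatives of G vanish to order a - 1, and the mean value
    inequality integrates their bound. Each differentiation costs half of the radius, hence the 2^a.
    The constant K is chosen before G, so it serves for all points and charts at once. *)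
Lemma vanishing_bound (a : nat) : exists2 K : R, 0 <= K & forall G p r M, 0 < r -> holb G p r M ->
  (forall s : seq 'I_n, (size s < a)%N -> partial s G p = 0) ->
  forall h, vn h < r / 2 ^+ a -> cabs (G (p + h)) <= K * M * (vn h / r) ^+ a.
Proof.
elim: a => [|a [K K0 ih]].
  exists 1 => // G p r M r0 hG _ h; rewrite expr0 divr1 mul1r mulr1 => hr.
  by have [|//] := hG (p + h); rewrite vn_addK.
exists (n%:R * (K * 4 * 2 ^+ a)); first by rewrite !mulr_ge0 ?exprn_ge0.
move=> G p r M r0 hG hv h hr; have M0 := holb_ge0 r0 hG.
have Gp : G p = 0 by apply: (hv [::]).
have r2 : 0 < r / 2 by rewrite divr_gt0.
have hr2 : vn h < r / 2 / 2 ^+ a by rewrite -mulrA -invfM -exprS.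
have p1 : 1 <= 2 ^+ a :> R by rewrite exprn_ege1 // ler1n.
have hr3 : vn h <= r / 2.
  by apply: le_trans (ltW hr2) _; rewrite ler_pdivrMr ?ler_peMr ?(ltW r2) // exprn_gt0.
rewrite -[G (p + h)]subr0 -Gp.
apply: (holb_mean_value r0 hG hr3) => t /andP[t0 t1].
have tv : vn (t%:C *: h) <= vn h by rewrite vnZ cabs_real ger0_norm // ler_piMl ?vn_ge0.
apply: (@le_trans _ _ (n%:R * (K * (4 * M / r) * (vn h / (r / 2)) ^+ a) * vn h)).
  apply: dotv_le => i; rewrite mxE.
  have := ih _ p (r / 2) (4 * M / r) r2 (holb_partial i r0 hG) _ (t%:C *: h) (le_lt_trans tv hr2).
  move=> /(_ _)/le_trans; apply => [s sa|]; first by rewrite -partial_rcons hv // size_rcons ltnS.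
  rewrite ler_wpM2l ?mulr_ge0 ?invr_ge0 ?(ltW r0) //.
  have iv : 0 <= (r / 2)^-1 by rewrite invr_ge0 ltW.
  apply: lerXn2r; rewrite ?nnegrE; [exact: mulr_ge0 (vn_ge0 _) iv|exact: mulr_ge0 (vn_ge0 _) iv|].
  exact: ler_wpM2r.
rewrite le_eqVlt; apply/orP; left; apply/eqP.
have -> : vn h / (r / 2) = 2 * (vn h / r) by field; rewrite gt_eqF.
rewrite exprMn exprS; ring.
Qed.

Lemma holb_near G p : (\forall y \near p, differentiable G y) -> exists r M, 0 < r /\ holb G p r M.
Proof.
move=> /nbhs_vn[r r0 hr].
have dp : differentiable G p by apply: hr; rewrite subrr vn0.
have /continuous_cabs /(_ 1 ltr01) /nbhs_vn[s s0 hs] := differentiable_continuous dp.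
exists (Num.min r s), (cabs (G p) + 1); split; first by rewrite lt_min r0.
move=> y; rewrite lt_min => /andP[/hr dy /hs ys]; split => //.
by have := cabsD (G y - G p) (G p); rewrite subrK; move: ys; lra.
Qed.

End HoloBounds.

(** * Power series expansion *)

Section Polydisc.
Variable R : realType.
Local Notation C := (Cplx R).
Variables (m : nat) (rho : R).
Hypothesis rho0 : 0 < rho.
Let rho0' : 0 <= rho := ltW rho0.
Local Notation T := ('I_m -> C).
Implicit Types (z : T) (X Y : T -> C) (s : seq 'I_m).

Definition upd z i c : T := fun j => if j == i then c else z j.

Definition onT z := forall i, cabs (z i) = rho.

(** Iterated circle means over the coordinates listed in s: the Cauchy integral over a torus. *)
Fixpoint torL s X : T -> C :=
  if s is i :: s' then fun z => Lam rho (fun c => torL s' X (upd z i c)) else X.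

Definition bddT X (M : R) := forall z, onT z -> cabs (X z) <= M.

Lemma onT_upd z i c : onT z -> cabs c = rho -> onT (upd z i c).
Proof. by move=> hz hc j; rewrite /upd; case: eqP. Qed.

Lemma torL_le s X M : bddT X M -> bddT (torL s X) M.
Proof.
move=> hX; elim: s => [|i s ih] //= z hz; apply: Lam_le => // c cr.
by apply: ih; exact: onT_upd.
Qed.

Lemma eq_torL s X Y : (forall z, onT z -> X z = Y z) -> forall z, onT z -> torL s X z = torL s Y z.
Proof.
move=> h; elim: s => [|i s ih] z hz /=; first exact: h.
by apply: eq_Lam => // c cr; apply: ih; exact: onT_upd.
Qed.

Lemma torL_lin s a X Y M M' z : bddT X M -> bddT Y M' -> onT z ->
  torL s (fun z => a * X z + Y z) z = a * torL s X z + torL s Y z.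
Proof.
move=> hX hY; elim: s z => [|i s ih] z hz //=.
rewrite -Lam_lin //.
- by apply: eq_Lam => // c cr; rewrite ih //; exact: onT_upd.
- by exists M => c cr; apply: torL_le hX _ _; exact: onT_upd.
- by exists M' => c cr; apply: torL_le hY _ _; exact: onT_upd.
Qed.

Lemma torL_scale s X Y M z : bddT Y M -> onT z ->
  (forall z' i c, i \in s -> X (upd z' i c) = X z') ->
  torL s (fun z => X z * Y z) z = X z * torL s Y z.
Proof.
move=> hY; elim: s z => [|i s ih] z hz hX //=.
transitivity (Lam rho (fun c => X z * torL s Y (upd z i c) + 0)).
  apply: eq_Lam => // c cr; rewrite ih; last 2 first.
  - exact: onT_upd.
  - by move=> z' j c' js; apply: hX; rewrite inE js orbT.
  by rewrite hX ?mem_head // addr0.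
rewrite Lam_lin //; last by exists 0 => c _; rewrite cabs0.
- by rewrite Lam_cst // addr0.
- by exists M => c cr; apply: torL_le hY _ _; exact: onT_upd.
Qed.

Lemma torL_sum (I : finType) s (a : I -> C) (X : I -> T -> C) (M : I -> R) z :
  (forall i, bddT (X i) (M i)) -> onT z ->
  torL s (fun z => \sum_i a i * X i z) z = \sum_i a i * torL s (X i) z.
Proof.
move=> hX hz.
suff : torL s (fun z => \sum_(i <- index_enum I) a i * X i z) z = \sum_(i <- index_enum I) a i * torL s (X i) z /\
   exists B, bddT (fun z => \sum_(i <- index_enum I) a i * X i z) B by case.
elim: (index_enum I) => [|i r [ih [B hB]]].
  split; last by exists 0 => z' _; rewrite big_nil cabs0.
  rewrite big_nil.
  transitivity (torL s (fun=> (-1) * 0 + 0) z); first by apply: eq_torL => // z' _; rewrite big_nil mulr0 addr0.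
  rewrite (@torL_lin s (-1) (fun=> 0) (fun=> 0) 0 0) //.
  - by rewrite mulN1r addNr.
  - by move=> z' _; rewrite cabs0.
  - by move=> z' _; rewrite cabs0.
split.
  rewrite big_cons -ih -(torL_lin _ _ (hX i) hB hz).
  by apply: eq_torL => // z' _; rewrite big_cons.
exists (cabs (a i) * M i + B) => z' hz'; rewrite big_cons.
rewrite (le_trans (cabsD _ _)) // cabsM lerD ?hB //.
by rewrite ler_wpM2l ?cabs_ge0 ?hX.
Qed.

Variable g : T -> C.
Variable M : R.
Definition inD z := forall i, cabs (z i) <= rho.
Hypothesis gM : forall z, inD z -> cabs (g z) <= M.
Hypothesis gH : forall z i c, inD z -> cabs c <= rho -> AH1 (fun c => g (upd z i c)) c.

Lemma inD_upd z i c : inD z -> cabs c <= rho -> inD (upd z i c).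
Proof. by move=> hz hc j; rewrite /upd; case: eqP. Qed.

Lemma onT_inD z : onT z -> inD z.
Proof. by move=> h i; rewrite h. Qed.

Definition updS z s (h : T) : T := fun j => if j \in s then h j else z j.

Lemma prod_kernel_le (h : T) s z : (forall i, cabs (h i) <= rho / 2) -> onT z ->
  cabs (\prod_(i <- s) (z i / (z i - h i))) <= 2 ^+ size s.
Proof.
move=> hh hz; elim: s => [|i s ih]; first by rewrite big_nil cabs1.
rewrite big_cons cabsM exprS ler_pM ?cabs_ge0 //.
have hi : cabs (h i) < rho by have := hh i; have := rho0; lra.
apply: le_trans (kernel_le rho0 hi (hz i)) _.
by rewrite ler_pdivrMr ?subr_gt0 //; have := hh i; lra.
Qed.

(** The one-variable formula in each coordinate in turn. As s has no repetition, the kernel of the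
    first coordinate is constant for the remaining means and comes out of them. *)
Lemma torL_cauchy (h : T) s z : (forall i, cabs (h i) <= rho / 2) -> uniq s -> onT z ->
  torL s (fun z => \prod_(i <- s) (z i / (z i - h i)) * g z) z = g (updS z s h).
Proof.
move=> hh; elim: s z => [|i s ih] z us hz.
  by rewrite /= big_nil mul1r; congr g; apply/funext => j.
move: us => /= /andP[nis us].
have hi : cabs (h i) < rho by have := hh i; have := rho0; lra.
have hi' := ltW hi.
have E c : cabs c = rho -> torL s (fun z => \prod_(j <- i :: s) (z j / (z j - h j)) * g z) (upd z i c) =
    c / (c - h i) * g (upd (updS z s h) i c).
  move=> cr.
  have hz' : onT (upd z i c) by exact: onT_upd.
  transitivity (torL s (fun z => (z i / (z i - h i)) * (\prod_(j <- s) (z j / (z j - h j)) * g z)) (upd z i c)).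
    by apply: eq_torL => // z' _; rewrite big_cons mulrA.
  rewrite (@torL_scale s (fun z => z i / (z i - h i)) _ (2 ^+ size s * M)) //; last 2 first.
  - move=> z' hz''; rewrite cabsM ler_pM ?cabs_ge0 //; last by apply: gM; exact: onT_inD.
    exact: prod_kernel_le.
  - move=> z' j c' js; rewrite /upd; case: eqP => // ij; by rewrite ij js in nis.
  rewrite ih // /upd eqxx; congr (_ * g _); apply/funext => j; rewrite /updS.
  by case: (j =P i) => [->|//]; rewrite (negbTE nis).
transitivity (Lam rho (fun c => c / (c - h i) * g (upd (updS z s h) i c))).
  by apply: eq_Lam => // c cr; exact: E.
have inz : inD (updS z s h).
  move=> j; rewrite /updS; case: ifP => _; last by rewrite hz.
  by have := hh j; have := rho0; lra.
rewrite (cauchy_formula rho0 hi).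
- congr g; apply/funext => j; rewrite /upd /updS inE.
  by case: (j =P i) => [->|].
- by move=> c cr; exact: gH.
- by exists M => c cr; apply: gM; apply: inD_upd => //; rewrite cr.
Qed.

(** The Taylor coefficient as a Cauchy integral over the torus |z_i| = rho. The constant point is a
    default value, overwritten in every coordinate by the iterated mean. *)
Definition tcoef (alpha : 'I_m -> nat) : C :=
  torL (enum 'I_m) (fun z => \prod_i z i ^- alpha i * g z) (fun=> rho%:C).

Lemma onT_base : onT (fun=> rho%:C).
Proof. by move=> i; rewrite cabs_real ger0_norm. Qed.

Lemma mono_bdd (alpha : 'I_m -> nat) :
  bddT (fun z => \prod_i z i ^- alpha i * g z) (rho ^- (\sum_i alpha i) * M).
Proof.
move=> z hz; rewrite cabsM ler_pM ?cabs_ge0 //; last by apply: gM; exact: onT_inD.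
rewrite cabs_prod (eq_bigr (fun i => rho^-1 ^+ alpha i)); last first.
  by move=> i _; rewrite cabsV cabsX hz exprVn.
by rewrite prodrXr exprVn.
Qed.

Lemma tcoef_le (alpha : 'I_m -> nat) : cabs (tcoef alpha) <= rho ^- (\sum_i alpha i) * M.
Proof. exact: torL_le (mono_bdd alpha) _ onT_base. Qed.

(** Cauchy's estimate compares each term with M * 2^-|alpha|, and the sum of these factors into m
    geometric sums, each at most 2. *)
Lemma tcoef_sum_le K : \sum_(alpha : {ffun 'I_m -> 'I_K})
   cabs (tcoef (fun i => val (alpha i))) * (rho / 2) ^+ (\sum_i alpha i)%N <= M * 2 ^+ m.
Proof.
have M0 : 0 <= M by exact: le_trans (cabs_ge0 _) (gM (onT_inD onT_base)).
apply: (@le_trans _ _ (\sum_(alpha : {ffun 'I_m -> 'I_K}) M * \prod_i 2^-1 ^+ alpha i)).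
  apply: ler_sum => alpha _.
  apply: le_trans (ler_wpM2r _ (tcoef_le _)) _; first by rewrite exprn_ge0 // divr_ge0.
  have -> : \prod_i (2^-1 : R) ^+ alpha i = 2^-1 ^+ (\sum_i alpha i)%N by rewrite prodrXr.
  set N := (\sum_i alpha i)%N.
  have r1 : rho ^+ N != 0 by rewrite expf_neq0 // gt_eqF.
  rewrite exprMn mulrA [_ * M]mulrC -[M * _ * _]mulrA mulVf // mulr1.
  exact: lexx.
rewrite -mulr_sumr ler_wpM2l // -(bigA_distr_bigA (fun (i : 'I_m) (k : 'I_K) => (2^-1 : R) ^+ k)) /=.
rewrite -[X in _ <= _ ^+ X](card_ord m) -prodr_const; apply: ler_prod => i _; apply/andP; split.
  by apply: sumr_ge0 => k _; rewrite exprn_ge0 // invr_ge0.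
elim: K => [|K ih]; first by rewrite big_ord0.
(* The bound 2 does not carry an induction on K; the value of the partial sum does. *)
apply: (@le_trans _ _ (2 - 2 * 2^-1 ^+ K.+1)); last by rewrite gerBl mulr_ge0 // exprn_ge0 // invr_ge0.
elim: K {ih} => [|K ih]; first by rewrite big_ord_recl big_ord0 expr0 expr1; lra.
rewrite big_ord_recr /= (le_trans (lerD ih (lexx _))) // !exprS.
set x := _ ^+ K; lra.
Qed.

Lemma prod_diff (I : Type) (r : seq I) (a b : I -> C) (A d : R) : 1 <= A -> 0 <= d ->
  (forall i, cabs (a i) <= A) -> (forall i, cabs (b i) <= A) -> (forall i, cabs (a i - b i) <= d) ->
  cabs (\prod_(i <- r) a i - \prod_(i <- r) b i) <= (size r)%:R * A ^+ size r * d.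
Proof.
move=> A1 d0 ha hb hd; have A0 : 0 <= A by rewrite (le_trans ler01).
elim: r => [|i r ih]; first by rewrite !big_nil subrr cabs0 mul0r mul0r.
rewrite !big_cons.
have -> : a i * \prod_(j <- r) a j - b i * \prod_(j <- r) b j =
  a i * (\prod_(j <- r) a j - \prod_(j <- r) b j) + (a i - b i) * \prod_(j <- r) b j by ring.
have hpb : cabs (\prod_(j <- r) b j) <= A ^+ size r.
  elim: r {ih} => [|j r ih]; first by rewrite big_nil cabs1.
  by rewrite big_cons cabsM /= exprS ler_pM ?cabs_ge0.
apply: le_trans (cabsD _ _) _; rewrite !cabsM.
have i1 := ler_pM (cabs_ge0 _) (cabs_ge0 _) (ha i) ih.
have i2 := ler_pM (cabs_ge0 _) (cabs_ge0 _) (hd i) hpb.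
apply: le_trans (lerD i1 i2) _ => /=; rewrite -[(size r).+1]addn1 natrD exprD expr1.
have : d * A ^+ size r <= d * A ^+ size r * A by rewrite ler_peMr // mulr_ge0 // exprn_ge0.
lra.
Qed.

(** The truncated series is the torus mean of g times a product of truncated geometric sums, and
    g(h) is the mean of g times the product of the full kernels. Corresponding factors differ by at
    most 2 * 2^-K and are bounded by 4, so [prod_diff] compares the two products uniformly on the
    torus. *)
Lemma tcoef_cvg (h : T) : (forall i, cabs (h i) <= rho / 2) -> forall e : R, 0 < e ->
  exists K0, forall K, (K0 <= K)%N ->
  cabs (\sum_(alpha : {ffun 'I_m -> 'I_K}) tcoef (fun i => val (alpha i)) * \prod_i h i ^+ alpha i - g h) <= e.
Proof.
move=> hh e e0.
have M0 : 0 <= M by exact: le_trans (cabs_ge0 _) (gM (onT_inD onT_base)).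
pose D := m%:R * 4 ^+ m * 2 * M + 1.
have D0 : 0 < D by rewrite ltr_wpDl // !mulr_ge0 // exprn_ge0.
have h12 : 0 <= (2^-1 : R) < 1 by lra.
have [K0 hK0] := pow_small h12 (divr_gt0 e0 D0).
exists K0 => K KK; have {}hK0 := hK0 K KK.
have sE : size (enum 'I_m) = m by rewrite -cardE card_ord.
have gE : g h = torL (enum 'I_m) (fun z => \prod_(i <- enum 'I_m) (z i / (z i - h i)) * g z) (fun=> rho%:C).
  rewrite torL_cauchy ?enum_uniq //; last exact: onT_base.
  by congr g; apply/funext => j; rewrite /updS mem_enum.
pose bd (alpha : {ffun 'I_m -> 'I_K}) := rho ^- (\sum_i alpha i) * M.
have sumE : \sum_(alpha : {ffun 'I_m -> 'I_K}) tcoef (fun i => val (alpha i)) * \prod_i h i ^+ alpha i =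
  torL (enum 'I_m) (fun z => \prod_(i <- enum 'I_m) (\sum_(k < K) (h i / z i) ^+ k) * g z) (fun=> rho%:C).
  transitivity (\sum_(alpha : {ffun 'I_m -> 'I_K}) (\prod_i h i ^+ alpha i) * tcoef (fun i => val (alpha i))).
    by apply: eq_bigr => alpha _; rewrite mulrC.
  rewrite -(@torL_sum _ (enum 'I_m) _ _ bd) //; last 2 first.
  - by move=> alpha; exact: mono_bdd.
  - exact: onT_base.
  apply: eq_torL; last exact: onT_base.
  move=> z hz; rewrite big_enum /= (bigA_distr_bigA (fun (i : 'I_m) (k : 'I_K) => (h i / z i) ^+ k)) mulr_suml.
  apply: eq_bigr => alpha _; rewrite mulrA -big_split /=; congr (_ * _).
  by apply: eq_bigr => i _; rewrite expr_div_n.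
have hb z i : onT z -> cabs (h i / z i) <= 2^-1.
  move=> hz; rewrite cabsM cabsV hz ler_pdivrMr // mulrC; exact: hh.
have gq z i : onT z -> \sum_(k < K) (h i / z i) ^+ k = z i / (z i - h i) * (1 - (h i / z i) ^+ K).
  move=> hz; have hi : cabs (h i) < rho by have := hh i; have := rho0; lra.
  have := geom_split K rho0 hi (hz i); set S := \sum_(k < K) _ => E.
  have -> : \sum_(k < K) (h i / z i) ^+ k = S by apply: eq_bigr => k _; rewrite expr_div_n.
  rewrite mulrBr mulr1 {1}E; ring.
have hk z i : onT z -> cabs (z i / (z i - h i)) <= 2.
  move=> hz; have hi : cabs (h i) < rho by have := hh i; have := rho0; lra.
  apply: le_trans (kernel_le rho0 hi (hz i)) _.
  by rewrite ler_pdivrMr ?subr_gt0 //; have := hh i; lra.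
have p1 z i : onT z -> cabs (1 - (h i / z i) ^+ K) <= 2.
  move=> hz; apply: le_trans (cabsB _ _) _; rewrite cabs1 cabsX.
  have : cabs (h i / z i) ^+ K <= 1 by rewrite exprn_ile1 ?cabs_ge0 // (le_trans (hb z i hz)) //; lra.
  lra.
pose X1 z := \prod_(i <- enum 'I_m) (\sum_(k < K) (h i / z i) ^+ k) * g z.
pose X2 z := \prod_(i <- enum 'I_m) (z i / (z i - h i)) * g z.
have X2b : bddT X2 (2 ^+ m * M).
  move=> z hz; rewrite cabsM ler_pM ?cabs_ge0 //; last by apply: gM; exact: onT_inD.
  by rewrite -[X in _ ^+ X]sE; exact: prod_kernel_le.
have X12 : bddT (fun z => (-1) * X2 z + X1 z) e.
  move=> z hz; have -> : -1 * X2 z + X1 z = (\prod_(i <- enum 'I_m) (\sum_(k < K) (h i / z i) ^+ k) -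
     \prod_(i <- enum 'I_m) (z i / (z i - h i))) * g z by rewrite /X1 /X2; ring.
  rewrite cabsM.
  have := @prod_diff _ (enum 'I_m) (fun i => \sum_(k < K) (h i / z i) ^+ k) (fun i => z i / (z i - h i)) 4 (2 * 2^-1 ^+ K).
  rewrite sE => /(_ _ _ _ _ _)hpd.
  have {}hpd : cabs (\prod_(i <- enum 'I_m) (\sum_(k < K) (h i / z i) ^+ k) -
     \prod_(i <- enum 'I_m) (z i / (z i - h i))) <= m%:R * 4 ^+ m * (2 * 2^-1 ^+ K).
    apply: hpd; rewrite ?mulr_ge0 ?exprn_ge0 ?invr_ge0 ?ler1n //.
    - move=> i; rewrite gq // cabsM.
      by have := ler_pM (cabs_ge0 _) (cabs_ge0 _) (hk z i hz) (p1 z i hz); lra.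
    - by move=> i; rewrite (le_trans (hk z i hz)) //; lra.
    - move=> i; rewrite gq // mulrBr mulr1 addrAC subrr add0r cabsN cabsM.
      rewrite ler_pM ?cabs_ge0 ?hk // cabsX lerXn2r ?nnegrE ?cabs_ge0 ?invr_ge0 //; exact: hb.
  apply: le_trans (ler_pM (cabs_ge0 _) (cabs_ge0 _) hpd (gM (onT_inD hz))) _.
  have c0 : 0 <= m%:R * 4 ^+ m * 2 * M by rewrite !mulr_ge0 // exprn_ge0.
  have := ler_wpM2l c0 hK0.
  have : m%:R * 4 ^+ m * 2 * M * (e / D) <= D * (e / D).
    by rewrite ler_wpM2r ?divr_ge0 ?(ltW e0) ?(ltW D0) // lerDl.
  by rewrite (mulrC D) divfK ?gt_eqF //; lra.
have X1b : bddT X1 (e + 2 ^+ m * M).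
  move=> z hz; have := X12 z hz; have := X2b z hz.
  have := cabsD (-1 * X2 z + X1 z) (X2 z).
  have -> : -1 * X2 z + X1 z + X2 z = X1 z by ring.
  lra.
rewrite sumE gE -/X1 -/X2.
have -> : torL (enum 'I_m) X1 (fun=> rho%:C) - torL (enum 'I_m) X2 (fun=> rho%:C) =
   torL (enum 'I_m) (fun z => (-1) * X2 z + X1 z) (fun=> rho%:C).
  by rewrite (torL_lin _ _ X2b X1b) ?mulN1r 1?addrC //; exact: onT_base.
exact: torL_le X12 _ onT_base.
Qed.

End Polydisc.

(** * Real analyticity of real and imaginary parts *)

Section RealAnalyticity.
Variable R : realType.
Local Notation C := (Cplx R).
Variable n : nat.

(** The map (x, y) -> x + i y with x and y allowed to be complex: the extension of [complexify] to
    C^(2n). *)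
Definition cplxfun (z : 'I_(n + n) -> C) : 'rV[C]_n :=
  \row_j (z (lshift n j) + 'i * z (rshift n j)).

Lemma cabs_i : cabs ('i : C) = 1.
Proof. by rewrite cabs_sqrt /= expr0n add0r expr1n sqrtr1. Qed.

Lemma cplxfun_le (z : 'I_(n + n) -> C) (r : R) : 0 <= r -> (forall i, cabs (z i) <= r) -> vn (cplxfun z) <= 2 * r.
Proof.
move=> r0 h; apply: vn_le => [|j]; first by rewrite mulr_ge0.
rewrite mxE (le_trans (cabsD _ _)) // cabsM cabs_i mul1r.
by have := h (lshift n j); have := h (rshift n j); lra.
Qed.

Lemma cplxfun_upd (z : 'I_(n + n) -> C) i c :
  cplxfun (upd z i c) = cplxfun (upd z i 0) + c *: cplxfun (fun k => (k == i)%:R).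
Proof.
apply/rowP => j; rewrite !mxE /upd.
by case: (lshift n j =P i) => _; case: (rshift n j =P i) => _; rewrite /= ?mulr1n ?mulr0n; ring.
Qed.

Lemma complexify_realify (p : 'rV[C]_n) (x : 'rV[R]_(n + n)) :
  complexify (realify p + x) = p + cplxfun (fun i => (x 0 i)%:C).
Proof.
apply/rowP => j; rewrite !mxE; apply: Cplx_eq; rewrite /= !(ReD, ImD, ReM, ImM) /=.
  by rewrite (unsplitK (inl j)) !mxE; ring.
by rewrite (unsplitK (inr j)) !mxE; ring.
Qed.

(** Composed with [cplxfun], H is holomorphic in 2n complex variables; its Taylor series at real
    increments, under pr (the real or the imaginary part), is the required power series. The radius
    r0 / 8 leaves room for [cplxfun], which doubles norms, and for moving one coordinate by another
    rho. *)
Lemma holo_real_analytic (H : 'rV[C]_n -> C) p (pr : C -> R) :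
  (forall z w, pr (z - w) = pr z - pr w) -> (forall z (x : R), pr (z * x%:C) = pr z * x) ->
  (forall z, `|pr z| <= cabs z) ->
  (\forall y \near p, differentiable H y) ->
  real_analytic_fun_at (fun x => pr (H (complexify x))) (realify p).
Proof.
move=> prB prZ prle /holb_near[r0 [M [r00 hH]]].
pose rho := r0 / 8; have rho0 : 0 < rho by rewrite divr_gt0.
have rho0' := ltW rho0.
pose g (z : 'I_(n + n) -> C) := H (p + cplxfun z).
have gM z : inD rho z -> cabs (g z) <= M.
  move=> hz; have [|//] := hH (p + cplxfun z).
  by rewrite vn_addK (le_lt_trans (cplxfun_le rho0' hz)) // /rho; lra.
have gH z i c : inD rho z -> cabs c <= rho -> AH1 (fun c => g (upd z i c)) c.
  move=> hz hc; apply: (cdiff_AH1 rho0) => c' cc'.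
  have -> : (fun c => g (upd z i c)) = (fun s => H (p + cplxfun (upd z i 0) + s *: cplxfun (fun k => (k == i)%:R))).
    by apply/funext => s; rewrite /g cplxfun_upd addrA.
  apply: cdiff_line; have [|//] := hH (p + cplxfun (upd z i 0) + c' *: cplxfun (fun k => (k == i)%:R)).
  rewrite -(addrA p) -cplxfun_upd vn_addK; apply: (@le_lt_trans _ _ (2 * (2 * rho))); last by rewrite /rho; lra.
  apply: cplxfun_le => [|j]; first by rewrite mulr_ge0.
  rewrite /upd; case: eqP => _; last by have := hz j; lra.
  by have := cabsD (c' - c) c; rewrite subrK; lra.
pose tc := tcoef rho g.
exists (fun alpha => pr (tc alpha)), (rho / 2); split; first by rewrite divr_gt0.
  exists (M * 2 ^+ (n + n)) => K; have hK := tcoef_sum_le rho0 gM K; apply: le_trans hK.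
  apply: ler_sum => alpha _; rewrite ler_wpM2r ?exprn_ge0 ?(divr_ge0 rho0') //.
  have -> : tc [ffun i => val (alpha i)] = tcoef rho g (fun i => val (alpha i)).
    by congr tcoef; apply/funext => i; rewrite ffunE.
  exact: prle.
move=> h hr; apply/cvgrPdist_le => e e0.
have hh i : cabs ((h 0 i)%:C : C) <= rho / 2 by rewrite cabs_real ltW.
have [K0 hK] := tcoef_cvg rho0 gM gH hh e0.
exists K0 => // K /= KK; rewrite distrC; apply: le_trans (hK K KK).
have pr0 : pr 0 = 0 by have := prB 0 0; rewrite !subrr.
have prD z w : pr (z + w) = pr z + pr w.
  by have := prB (z + w) w; rewrite addrK => ->; rewrite subrK.
have -> : \sum_(alpha : {ffun 'I_(n + n) -> 'I_K}) pr (tc [ffun i => val (alpha i)]) * \prod_i h 0 i ^+ alpha i =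
  pr (\sum_(alpha : {ffun 'I_(n + n) -> 'I_K}) tcoef rho g (fun i => val (alpha i)) * \prod_i (h 0 i)%:C ^+ alpha i).
  rewrite (big_morph pr prD pr0); apply: eq_bigr => alpha _.
  have -> : tc [ffun i => val (alpha i)] = tcoef rho g (fun i => val (alpha i)).
    by congr tcoef; apply/funext => i; rewrite ffunE.
  have -> : \prod_i (h 0 i)%:C ^+ alpha i = (\prod_i h 0 i ^+ alpha i)%:C :> C.
    by rewrite rmorph_prod; apply: eq_bigr => i _; rewrite rmorphXn.
  by rewrite prZ.
by rewrite complexify_realify -prB; exact: prle.
Qed.

End RealAnalyticity.

(** * Changing one coordinate *)

Section InverseFunction.
Variable R : realType.
Local Notation C := (Cplx R).
Variables (n : nat) (i : 'I_n).
Implicit Types (G K : 'rV[C]_n -> C) (p x y h : 'rV[C]_n).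

Definition setc x (c : C) : 'rV[C]_n := \row_j (if j == i then c else x 0 j).

Lemma setc_id x : setc x (x 0 i) = x.
Proof. by apply/rowP => j; rewrite mxE; case: eqP => [->|]. Qed.

Lemma setc_set x c d : setc (setc x c) d = setc x d.
Proof. by apply/rowP => j; rewrite !mxE; case: eqP. Qed.

Lemma setc_i x c : setc x c 0 i = c.
Proof. by rewrite mxE eqxx. Qed.

Lemma setc_delta x c t : setc x (c + t) = setc x c + t *: delta_mx 0 i.
Proof.
by apply/rowP => j; rewrite !mxE eqxx /=; case: eqP => _; rewrite ?mulr1 ?mulr0 ?addr0.
Qed.

Lemma setc_sub x y c d : setc x c - setc y d = setc (x - y) (c - d).
Proof. by apply/rowP => j; rewrite !mxE; case: eqP. Qed.

Lemma setc_add x y c d : setc x c + setc y d = setc (x + y) (c + d).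
Proof. by apply/rowP => j; rewrite !mxE; case: eqP. Qed.

Lemma vn_setc x c (r : R) : 0 <= r -> vn x <= r -> cabs c <= r -> vn (setc x c) <= r.
Proof.
move=> r0 xr cr; apply: vn_le => // j; rewrite mxE; case: eqP => // _.
exact: le_trans (cabs_le_vn _ _) xr.
Qed.

Lemma dotv_setc v h c : dotv v (setc h c) = dotv v h + v 0 i * (c - h 0 i).
Proof.
have -> : setc h c = h + (c - h 0 i) *: delta_mx 0 i.
  by rewrite -{2}(setc_id h) -setc_delta addrC subrK.
by rewrite dotvD dotvZ dotv_delta mulrC.
Qed.

(** Consecutive iterates differ by at most (r / 2) / 2^k; their limit along the ultrafilter is the
    fixed point, and stays within r / 2^k of the k-th iterate. *)
Lemma contraction_fixpoint (N : C -> C) (r : R) : 0 < r ->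
  (forall s t, cabs s <= r -> cabs t <= r -> cabs (N s - N t) <= cabs (s - t) / 2) ->
  cabs (N 0) <= r / 2 -> exists2 t, cabs t <= r & N t = t.
Proof.
move=> r0 hN N0; have r0' := ltW r0.
have stab t : cabs t <= r -> cabs (N t) <= r.
  move=> tr; have := hN t 0 tr; rewrite cabs0 subr0 => /(_ r0').
  by have := cabsD (N t - N 0) (N 0); rewrite subrK; lra.
pose u k := iter k N 0.
have ur k : cabs (u k) <= r by elim: k => [|k ih]; [rewrite cabs0|exact: stab].
have du k : cabs (u k.+1 - u k) <= r / 2 / 2 ^+ k.
  elim: k => [|k ih]; first by rewrite expr0 divr1 subr0.
  have h : cabs (u k.+2 - u k.+1) <= cabs (u k.+1 - u k) / 2 := hN _ _ (ur k.+1) (ur k).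
  by apply: le_trans h _; rewrite exprS invfM (mulrC 2^-1) mulrA ler_pM2r.
have dk k j : cabs (u (k + j)%N - u k) <= r / 2 ^+ k - r / 2 ^+ (k + j).
  elim: j => [|j ih]; first by rewrite addn0 subrr cabs0 subrr.
  have := cabsD (u (k + j).+1 - u (k + j)%N) (u (k + j)%N - u k).
  rewrite addrA subrK addnS; have := du (k + j)%N; rewrite exprS invfM.
  have -> : r * (2^-1 / 2 ^+ (k + j)) = r / 2 ^+ (k + j) / 2 by rewrite mulrCA mulrC.
  have -> : r / 2 / 2 ^+ (k + j) = r / 2 ^+ (k + j) / 2 by rewrite mulrAC.
  lra.
have bu : bdd u by exists r.
have tr : cabs (LIM u) <= r by exact: LIM_le.
have tk k : cabs (LIM u - u k) <= r / 2 ^+ k.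
  apply: LIM_near => //; exists k => j /subnKC <-; apply: le_trans (dk _ _) _.
  by rewrite gerBl divr_ge0 ?exprn_ge0.
exists (LIM u) => //; apply/eqP; rewrite -subr_eq0 -cabs_eq0 eq_le cabs_ge0 andbT.
apply: eps_le0 => e e0; have e2 : 0 < e / 2 by rewrite divr_gt0.
have [k hk] := pow2_small r e2.
have := hN (LIM u) (u k) tr (ur k); have := tk k; have := tk k.+1.
have := cabsB (N (LIM u) - N (u k)) (LIM u - u k.+1).
have -> : N (LIM u) - N (u k) - (LIM u - u k.+1) = N (LIM u) - LIM u by rewrite /u /=; ring.
rewrite exprS invfM mulrCA.
by move: hk; move: (r / 2 ^+ k) => a; lra.
Qed.

(** L collects a Lipschitz constant of the partial derivative and the constant of the quadratic
    remainder. For r <= |A| / (4 * L) the two together deviate from A * t by at most |A| / 2 *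
    |t|. *)
Lemma almost_linear G p : (\forall y \near p, differentiable G y) ->
  'D_(delta_mx 0 i) G p != 0 -> exists r M : R, [/\ 0 < r, holb G p (4 * r) M &
  forall x t, vn (x - p) <= r -> cabs t <= 2 * r ->
    cabs (G (x + t *: delta_mx 0 i) - G x - 'D_(delta_mx 0 i) G p * t) <=
      cabs ('D_(delta_mx 0 i) G p) / 2 * cabs t /\
    cabs ('D_(delta_mx 0 i) G p) / 2 <= cabs ('D_(delta_mx 0 i) G x)].
Proof.
move=> /holb_near[r0 [M [r00 hG]]]; set A := 'D_(delta_mx 0 i) G p => A0.
have a0 : 0 < cabs A by rewrite cabs_gt0.
have M0 := holb_ge0 r00 hG.
have r02 : 0 < r0 / 2 by rewrite divr_gt0.
pose L := 32 * (4 * M / r0) / (r0 / 2) + 8 * M / (r0 / 2) ^+ 2 * 4 + 1.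
have L0 : 0 < L.
  by rewrite ltr_wpDl // addr_ge0 // !mulr_ge0 ?invr_ge0 ?exprn_ge0 ?mulr_ge0 ?invr_ge0 ?(ltW r00).
pose r := Num.min (r0 / 16) (cabs A / (4 * L)).
have r1 : 0 < r by rewrite lt_min !divr_gt0 // mulr_gt0.
have rr0 : r <= r0 / 16 by rewrite ge_min lexx.
have rL : r * (4 * L) <= cabs A by rewrite -ler_pdivlMr ?mulr_gt0 // ge_min lexx orbT.
exists r, M; split; [exact: r1| |].
  by apply: holb_sub hG _; rewrite subrr vn0; lra.
move=> x t xr tr.
have hGx : holb G x (r0 / 2) M by apply: holb_sub hG _; lra.
have [_ h2] := holb_first_order r02 hGx.
have u1 : vn (delta_mx 0 i : 'rV[C]_n) = 1 by exact: vn_delta.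
have DA : cabs ('D_(delta_mx 0 i) G x - A) <= 32 * (4 * M / r0) / (r0 / 2) * r.
  apply: le_trans (holb_lip r02 (holb_partial i r00 hG) _ _) _ => //.
  - by apply: le_lt_trans xr _; lra.
  - by rewrite subrr vn0; lra.
  - rewrite ler_wpM2l // !mulr_ge0 ?invr_ge0 ?(ltW r00) //; exact: ltW.
have b1 : 32 * (4 * M / r0) / (r0 / 2) * r <= cabs A / 4.
  have : 32 * (4 * M / r0) / (r0 / 2) * r <= L * r.
    rewrite ler_wpM2r ?(ltW r1) // /L -addrA lerDl addr_ge0 // !mulr_ge0 ?invr_ge0 ?exprn_ge0 //; exact: ltW.
  move: rL; drop_order; lra.
split; last first.
  move: DA; move: ('D_(delta_mx 0 i) G x) => D DA.
  have := cabs_tri A (A - D); have -> : A - (A - D) = D by ring.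
  by rewrite (cabs_sub A D); move: DA b1 a0; drop_order; lra.
have := h2 (t *: delta_mx 0 i); rewrite vnZ u1 mulr1 dotvZ dotv_delta mxE.
set X := G _ - G x; have E : X - A * t = (X - t * 'D_(delta_mx 0 i) G x) + ('D_(delta_mx 0 i) G x - A) * t by ring.
move=> h3; have {}h3 := h3 _; rewrite E; apply: le_trans (cabsD _ _) _.
rewrite cabsM; have i2 := ler_wpM2r (cabs_ge0 t) (le_trans DA b1).
have i1 : cabs (X - t * 'D_(delta_mx 0 i) G x) <= cabs A / 4 * cabs t.
  apply: le_trans (h3 _) _; first by move: tr rr0; drop_order; lra.
  have -> : 8 * M * (cabs t / (r0 / 2)) ^+ 2 = 8 * M / (r0 / 2) ^+ 2 * cabs t * cabs t.
    by field; rewrite gt_eqF.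
  rewrite ler_wpM2r ?cabs_ge0 //.
  have c0 : 0 <= 8 * M / (r0 / 2) ^+ 2 by rewrite !mulr_ge0 // invr_ge0 exprn_ge0 // ltW.
  have := ler_wpM2l c0 tr.
  have : 8 * M / (r0 / 2) ^+ 2 * 4 * r <= L * r.
    rewrite ler_wpM2r ?(ltW r1) // /L -addrA addrCA lerDl addr_ge0 // !mulr_ge0 ?invr_ge0 ?mulr_ge0 ?invr_ge0 ?(ltW r00) //; exact: ltW.
  lra.
move: i1 i2; drop_order; lra.
Qed.

(* The inverse of the map replacing the i-th coordinate by G, by contraction in
   that coordinate only. *)
Lemma inverse_coordinate G p : (\forall y \near p, differentiable G y) ->
  'D_(delta_mx 0 i) G p != 0 ->
  exists (r s : R) (K : 'rV[C]_n -> C), [/\ 0 < r, 0 < s,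
    forall y, vn (y - setc p (G p)) < s ->
      vn (setc y (K y) - p) <= r /\ G (setc y (K y)) = y 0 i,
    forall x, vn (x - p) <= r -> vn (setc x (G x) - setc p (G p)) < s -> K (setc x (G x)) = x 0 i
    & forall y, vn (y - setc p (G p)) < s -> differentiable K y].
Proof.
move=> dG A0; have [r [M [r0 hG al]]] := almost_linear dG A0.
set A := 'D_(delta_mx 0 i) G p in A0 al; have a0 : 0 < cabs A by rewrite cabs_gt0.
have r40 : 0 < 4 * r by rewrite mulr_gt0.
have M0 := holb_ge0 r40 hG.
pose L := 32 * M / (4 * r).
have L0 : 0 <= L by rewrite !mulr_ge0 // invr_ge0 mulr_ge0 // ltW.
have lip x y : vn (x - p) <= r -> vn (y - p) <= r -> cabs (G x - G y) <= L * vn (x - y).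
  by move=> xr yr; apply: (holb_lip r40 hG); lra.
have r2 : 0 < r / 2 by rewrite divr_gt0.
pose s := Num.min r (cabs A * (r / 2) / (1 + L)).
have L1 : 0 < 1 + L by rewrite ltr_pwDl.
have s0 : 0 < s by rewrite lt_min r0 divr_gt0 // mulr_gt0.
have sr : s <= r by rewrite ge_min lexx.
have sA : s * (1 + L) <= cabs A * (r / 2) by rewrite -ler_pdivlMr // ge_min lexx orbT.
pose q := setc p (G p).
have qc y c : vn (y - q) < s -> cabs (c - p 0 i) <= r -> vn (setc y c - p) <= r.
  move=> ys cr; rewrite -{1}(setc_id p) setc_sub; apply: vn_le => [|j]; first exact: ltW.
  rewrite !mxE; case: eqP => // /eqP ji.
  have := cabs_le_vn (y - q) j; rewrite !mxE (negbTE ji); lra.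
have inj x t : vn (x - p) <= r -> vn (x + t *: delta_mx 0 i - p) <= r ->
    cabs A / 2 * cabs t <= cabs (G (x + t *: delta_mx 0 i) - G x).
  move=> xr xtr; have u1 : vn (delta_mx 0 i : 'rV[C]_n) = 1 by exact: vn_delta.
  have tr : cabs t <= 2 * r.
    have := vnD (x + t *: delta_mx 0 i - p) (p - x).
    have -> : x + t *: delta_mx 0 i - p + (p - x) = t *: delta_mx 0 i by rewrite addrA subrK addrC addKr.
    by rewrite vnZ u1 mulr1 (vn_sub p); lra.
  have [h1 _] := al x t xr tr.
  have := cabs_tri (A * t) (A * t - (G (x + t *: delta_mx 0 i) - G x)).
  have -> : A * t - (A * t - (G (x + t *: delta_mx 0 i) - G x)) = G (x + t *: delta_mx 0 i) - G x by ring.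
  rewrite (cabs_sub (A * t)) cabsM; move: h1; drop_order; lra.
have ex y : vn (y - q) < s -> exists c, vn (setc y c - p) <= r /\ G (setc y c) = y 0 i.
  move=> ys.
  have y0 : vn (setc y (p 0 i) - p) <= r by apply: qc => //; rewrite subrr cabs0 ltW.
  (* Newton's iteration with the derivative frozen at its value A in p; [almost_linear] makes it a
     contraction with factor 1/2. *)
  pose N t := t - (G (setc y (p 0 i + t)) - y 0 i) / A.
  have [||t tr Nt] := @contraction_fixpoint N r r0.
  - move=> t t' tr t'r.
    have x'r : vn (setc y (p 0 i + t') - p) <= r by apply: qc => //; rewrite addrAC subrr add0r.
    have := al (setc y (p 0 i + t')) (t - t') x'r; rewrite -setc_delta.
    have -> : p 0 i + t' + (t - t') = p 0 i + t by ring.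
    have tt : cabs (t - t') <= 2 * r by have := cabsB t t'; lra.
    move=> /(_ tt)[h1 _].
    have -> : N t - N t' = - ((G (setc y (p 0 i + t)) - G (setc y (p 0 i + t')) - A * (t - t')) / A).
      by rewrite /N; field.
    by rewrite cabsN cabsM cabsV ler_pdivrMr //; move: h1; drop_order; lra.
  - rewrite /N addr0 sub0r cabsN cabsM cabsV ler_pdivrMr //.
    have -> : G (setc y (p 0 i)) - y 0 i = (G (setc y (p 0 i)) - G p) - (y 0 i - G p) by ring.
    have i2 : cabs (y 0 i - G p) <= s.
      by have := cabs_le_vn (y - q) i; rewrite !mxE eqxx; move: ys; drop_order; lra.
    have i1 : cabs (G (setc y (p 0 i)) - G p) <= L * s.
      apply: le_trans (lip _ _ y0 _) _; first by rewrite subrr vn0 ltW.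
      have -> : setc y (p 0 i) - p = setc (y - p) 0.
        by rewrite -[X in _ - X](setc_id p) setc_sub subrr.
      rewrite ler_wpM2l //; apply: vn_le => [|j]; first exact: ltW.
      rewrite !mxE; case: eqP => [_|/eqP ji]; first by rewrite cabs0 ltW.
      by have := cabs_le_vn (y - q) j; rewrite !mxE (negbTE ji); move: ys; drop_order; lra.
    have := cabsB (G (setc y (p 0 i)) - G p) (y 0 i - G p); lra.
  exists (p 0 i + t); split; first by apply: qc => //; rewrite addrAC subrr add0r.
  have /eqP : (G (setc y (p 0 i + t)) - y 0 i) / A = 0.
    have -> : (G (setc y (p 0 i + t)) - y 0 i) / A = t - N t by rewrite /N; ring.
    by rewrite Nt subrr.
  by rewrite mulf_eq0 invr_eq0 (negbTE A0) orbF subr_eq0 => /eqP.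
have /choice[K hK] : forall y, exists c, vn (y - q) < s -> vn (setc y c - p) <= r /\ G (setc y c) = y 0 i.
  by move=> y; have [/ex[c hc]|h] := pselect (vn (y - q) < s); [exists c|exists 0].
have uniq y c d : vn (setc y c - p) <= r -> vn (setc y d - p) <= r -> cabs A / 2 * cabs (d - c) <= cabs (G (setc y d) - G (setc y c)).
  move=> cr dr; have E : setc y d = setc y c + (d - c) *: delta_mx 0 i.
    by rewrite -setc_delta addrC subrK.
  by rewrite E; apply: inj; rewrite // -E.
exists r, s, K; split; [exact: r0|exact: s0|exact: hK| |].
  move=> x xr xs; have [h1 h2] := hK _ xs; rewrite setc_set in h1 h2.
  have := uniq x (x 0 i) (K (setc x (G x))); rewrite setc_id => /(_ xr h1).
  rewrite h2 setc_i subrr cabs0 pmulr_rle0 ?divr_gt0 // => h3.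
  by apply/eqP; rewrite -subr_eq0 -cabs_eq0 eq_le h3 cabs_ge0.
pose B := (1 + L) / (cabs A / 2).
have B0 : 0 <= B by rewrite divr_ge0 // ltW // divr_gt0.
have Klip y y' : vn (y - q) < s -> vn (y' - q) < s -> cabs (K y - K y') <= B * vn (y - y').
  move=> ys ys'; have [k1 k2] := hK y ys; have [k1' k2'] := hK y' ys'.
  have cr : cabs (K y' - p 0 i) <= r.
    by have := cabs_le_vn (setc y' (K y') - p) i; rewrite !mxE eqxx; move: k1'; drop_order; lra.
  have x''r := qc y (K y') ys cr.
  rewrite /B mulrAC ler_pdivlMr ?divr_gt0 // mulrC.
  apply: le_trans (uniq _ _ _ x''r k1) _; rewrite k2.
  have -> : y 0 i - G (setc y (K y')) = (y 0 i - y' 0 i) + (G (setc y' (K y')) - G (setc y (K y'))) by rewrite k2'; ring.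
  apply: le_trans (cabsD _ _) _; rewrite mulrDl mul1r lerD //.
    by have := cabs_le_vn (y - y') i; rewrite !mxE.
  apply: le_trans (lip _ _ k1' x''r) _; rewrite ler_wpM2l // setc_sub subrr vn_sub.
  by apply: vn_setc; rewrite ?cabs0 ?vn_ge0.
move=> y ys; have [x1 x2] := hK y ys; set x := setc y (K y) in x1 x2.
have [D DE D0] : exists2 D : C, 'D_(delta_mx 0 i) G x = D & 0 < cabs D.
  exists ('D_(delta_mx 0 i) G x); first exact: erefl.
  have c2r : cabs (0 : C) <= 2 * r by rewrite cabs0 mulr_ge0 // ltW.
  have [_ ] := al x 0 x1 c2r.
  by apply: lt_le_trans; rewrite divr_gt0.
have hGx : holb G x r M.
  by apply: holb_sub hG _; apply: le_trans (lerD x1 (lexx r)) _; clear -r0; lra.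
have [_ T2] := holb_first_order r0 hGx.
(* The candidate gradient comes from differentiating G(setc y (K y)) = y_i: entry i is 1 / D, and
   entry j is minus the j-th partial derivative of G over D. *)
apply: (@vderiv_differentiable _ _ _ _ (setc ((- D^-1) *: grad G x) D^-1)) => e e0.
pose B1 := 1 + B; have B1_0 : 0 < B1 by rewrite ltr_pwDl.
pose Q := 8 * M / r ^+ 2 * B1 ^+ 2 / cabs D + 1.
have Q0 : 0 < Q by rewrite ltr_wpDl // !mulr_ge0 ?invr_ge0 ?exprn_ge0 ?(ltW r0) ?(ltW B1_0) ?cabs_ge0.
exists (Num.min (Num.min (s - vn (y - q)) (r / 4 / B1)) (e / Q)).
  by rewrite !lt_min subr_gt0 ys !divr_gt0.
move=> h; rewrite !lt_min => /andP[/andP[h1 h2] h3].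
have yhs : vn (y + h - q) < s by apply: le_lt_trans (vn_shift y q h) _; rewrite -ltrBrDl.
have [x'1 x'2] := hK _ yhs.
set k := K (y + h) - K y.
have kB : cabs k <= B * vn h by have := Klip _ _ yhs ys; rewrite vn_addK.
have vk : vn (setc h k) <= B1 * vn h.
  apply: vn_setc; rewrite ?mulr_ge0 ?vn_ge0 ?(ltW B1_0) //.
    by rewrite ler_peMl ?vn_ge0 // lerDl.
  by apply: le_trans kB _; rewrite ler_wpM2r ?vn_ge0 // lerDr.
have E1 : setc (y + h) (K (y + h)) = x + setc h k.
  by rewrite setc_add /k (addrC (K y)) subrK.
have := T2 (setc h k); rewrite -E1 x'2 x2 !mxE (addrC (y 0 i)) addrK => T2k.
rewrite -/(dotv _ h).
have E2 : k - dotv (setc ((- D^-1) *: grad G x) D^-1) h =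
    - (h 0 i - dotv (grad G x) (setc h k)) / D.
  rewrite dotv_setc [grad G x 0 i]mxE DE.
  have -> : dotv (setc ((- D^-1) *: grad G x) D^-1) h = - D^-1 * dotv (grad G x) h + (D^-1 + D^-1 * D) * h 0 i.
    rewrite -dotv_scale {1}/dotv (bigD1 i) //= setc_i /dotv [in RHS](bigD1 i) //= !mxE DE.
    have -> : \sum_(j < n | j != i) setc (- D^-1 *: grad G x) D^-1 0 j * h 0 j =
       \sum_(j < n | j != i) (- D^-1 *: grad G x) 0 j * h 0 j.
      by apply: eq_bigr => j ji; rewrite [setc _ _ _ _]mxE (negbTE ji).
    ring.
  by field; rewrite -cabs_gt0.
rewrite E2 mulNr cabsN cabsM cabsV ler_pdivrMr //.
apply: le_trans (T2k _) _.
  apply: le_trans vk _; rewrite mulrC -ler_pdivlMr //; exact: ltW.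
have b1 : (vn (setc h k) / r) ^+ 2 <= (B1 * vn h / r) ^+ 2.
  apply: lerXn2r; rewrite ?nnegrE.
  - by rewrite divr_ge0 ?vn_ge0 // ltW.
  - by rewrite divr_ge0 ?mulr_ge0 ?vn_ge0 ?(ltW B1_0) // ltW.
  - by rewrite ler_pM2r ?invr_gt0.
have c0 : 0 <= 8 * M by rewrite mulr_ge0.
apply: le_trans (ler_wpM2l c0 b1) _.
have -> : 8 * M * (B1 * vn h / r) ^+ 2 = (8 * M / r ^+ 2 * B1 ^+ 2 / cabs D) * vn h * vn h * cabs D.
  by field; rewrite !gt_eqF.
rewrite ler_pM2r // ler_wpM2r ?vn_ge0 //.
move: h3; rewrite ltr_pdivlMr // => /ltW; apply: le_trans.
by rewrite mulrC ler_wpM2l ?vn_ge0 // lerDl.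
Qed.

End InverseFunction.

(** * The logarithm near 1 *)

Section Logarithm.
Variable R : realType.
Local Notation C := (Cplx R).

Lemma cderiv_differentiable (g : C -> C) z d : cderiv g z d -> differentiable g z.
Proof.
move=> h; pose L := d *: (id : C -> C).
have dL : differentiable L z by apply: differentiableZ.
have -> : g = (g - L) + L by rewrite subrK.
apply: differentiableD; last exact: dL.
apply: (@flat_differentiable _ C C) => e e0.
have [r r0 hr] := h e e0; apply/nbhs_cabs; exists r => // y; rewrite subr0 => /hr.
rewrite !cabsE -rmorphM lecR => k; apply: le_trans k.
have LE x : L x = d * x by [].
rewrite !fctE !LE (addrC y) le_eqVlt; apply/orP; left; apply/eqP; congr (cabs _); ring.
Qed.

Definition expc (s : C) : C := (expR (complex.Re s))%:C * cis (complex.Im s).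

(** The principal branch on the half plane Re z > 0, where the argument is recovered by [asin]. *)
Definition Log (z : C) : C := Complex (ln (cabs z)) (asin (complex.Im z / cabs z)).

Lemma Re_Log z : complex.Re (Log z) = ln (cabs z).
Proof. by []. Qed.

Lemma expcD s t : expc (s + t) = expc s * expc t.
Proof. by rewrite /expc ReD ImD expRD cisD rmorphM mulrACA. Qed.

Lemma expcMn s k : expc (s *+ k) = expc s ^+ k.
Proof.
elim: k => [|k ih]; last by rewrite mulrS expcD ih exprS.
by rewrite mulr0n expr0 /expc /= expR0 cis0 mulr1 rmorph1.
Qed.

Lemma cabs_expc s : cabs (expc s) = expR (complex.Re s).
Proof. by rewrite cabsM cabs_cis mulr1 cabs_real ger0_norm // expR_ge0. Qed.

Lemma cabs_sqr (z : C) : cabs z ^+ 2 = complex.Re z ^+ 2 + complex.Im z ^+ 2.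
Proof. by rewrite cabs_sqrt sqr_sqrtr // addr_ge0 // sqr_ge0. Qed.

Lemma expc_Log z : 0 < complex.Re z -> expc (Log z) = z.
Proof.
move=> x0; have v0 : 0 < cabs z by apply: lt_le_trans (le_trans (ler_norm _) (Re_le_cabs z)).
set w := complex.Im z / cabs z.
have w1 : -1 <= w <= 1.
  by rewrite -ler_norml normrM normfV [X in _ / X]ger0_norm ?(ltW v0) // ler_pdivrMr // mul1r Im_le_cabs.
have wC : w \in `[-1, 1]%R by rewrite in_itv.
rewrite /expc /= lnK; last by rewrite posrE.
have c : cos (asin w) = complex.Re z / cabs z.
  rewrite cos_asin //.
  have -> : 1 - w ^+ 2 = (complex.Re z / cabs z) ^+ 2.
    rewrite /w !expr_div_n cabs_sqr; field.
    by rewrite gt_eqF // ltr_pwDl ?sqr_ge0 // exprn_gt0.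
  by rewrite sqrtr_sqr ger0_norm // divr_ge0 // ltW.
apply: Cplx_eq; rewrite ?ReM ?ImM /= -/w asinK // c.
  by rewrite mul0r subr0 mulrC divfK // gt_eqF.
by rewrite mul0r addr0 /w mulrC divfK // gt_eqF.
Qed.

Lemma Log_expc s : `|complex.Im s| <= 1 -> Log (expc s) = s.
Proof.
move=> s1; apply: Cplx_eq; rewrite /= cabs_expc ?expRK //.
rewrite mul0r addr0 mulrC mulKf ?gt_eqF ?expR_gt0 // sinK //.
rewrite in_itv /= -ler_norml (le_trans s1) //.
exact: pihalf_ge1.
Qed.

Lemma sqrt_inv_bound (t : R) : `|t| <= 1 / 3 -> `|(Num.sqrt (1 - t ^+ 2))^-1 - 1| <= 2 * t ^+ 2.
Proof.
move=> ht; have t2 : t ^+ 2 <= 1 / 9.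
  rewrite -real_normK ?num_real //; have -> : 1 / 9 = (1 / 3) ^+ 2 :> R by field.
  by rewrite lerXn2r ?nnegrE //; lra.
have t0 := sqr_ge0 t; set q := t ^+ 2 in t2 t0 *.
have s0 : 0 < Num.sqrt (1 - q) by rewrite sqrtr_gt0; lra.
have s1 : Num.sqrt (1 - q) <= 1 by rewrite -[X in _ <= X]sqrtr1 ler_wsqrtr //; lra.
have sq : Num.sqrt (1 - q) * Num.sqrt (1 - q) = 1 - q by rewrite -expr2 sqr_sqrtr //; lra.
set s := Num.sqrt (1 - q) in s0 s1 sq *.
have ss : 1 - q <= s by rewrite -sq ler_piMl // ltW.
rewrite ger0_norm; last by rewrite subr_ge0 -[X in X <= _]invr1 lef_pV2 ?posrE.
have : s^-1 <= (1 - q)^-1 by rewrite lef_pV2 // posrE; lra.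
have : (1 - q)^-1 <= 1 + 2 * q.
  rewrite -[X in X <= _]mul1r ler_pdivrMr; last by lra.
  have : 0 <= q * (1 - 2 * q) by rewrite mulr_ge0 //; lra.
  lra.
lra.
Qed.

Lemma asin_bound (w : R) : `|w| <= 1 / 3 -> `|asin w - w| <= 2 * w ^+ 2.
Proof.
move=> hw; have asin0 : asin 0 = 0 :> R.
  by rewrite -{1}(sin0 R) sinK // in_itv /=; have := pihalf_ge1 R; lra.
pose F (t : R) := asin t - t.
have dF (t : R) : `|t| <= 1 / 3 -> is_derive t 1 F ((Num.sqrt (1 - t ^+ 2))^-1 - 1).
  move=> ht; apply: is_deriveB; apply: is_derive1_asin.
  by rewrite -ltr_norml (le_lt_trans ht) //; lra.
have cF (t : R) : `|t| <= 1 / 3 -> {for t, continuous F}.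
  by move=> /dF[h _]; apply: differentiable_continuous; apply/derivable1_diffP.
have F0 : F 0 = 0 by rewrite /F asin0 subr0.
have key (a b : R) : a <= b -> `|a| <= 1 / 3 -> `|b| <= 1 / 3 ->
    (forall t, a <= t <= b -> `|t| <= `|w|) -> `|F b - F a| <= 2 * w ^+ 2 * (b - a).
  move=> ab ha hb hab.
  have in3 t : t \in `[a, b]%R -> `|t| <= 1 / 3.
    rewrite in_itv /= => /andP[ta tb]; move: ha hb; rewrite !ler_norml => /andP[? ?] /andP[? ?].
    by apply/andP; split; lra.
  have d1 t : t \in `]a, b[%R -> is_derive t 1 F ((Num.sqrt (1 - t ^+ 2))^-1 - 1).
    move=> tab; apply: dF; apply: in3; move: tab; rewrite !in_itv /= => /andP[? ?].
    by rewrite !ltW.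
  have c1 : {within `[a, b], continuous F}.
    by apply: continuous_in_subspaceT => t /[1!inE] tab; apply: cF; exact: in3.
  have [t tab ->] := MVT_segment ab d1 c1.
  rewrite normrM (ger0_norm (_ : 0 <= b - a)) ?subr_ge0 // ler_wpM2r ?subr_ge0 //.
  apply: le_trans (sqrt_inv_bound (in3 _ tab)) _; rewrite ler_pM2l //.
  rewrite -[t ^+ 2]real_normK ?num_real // -[w ^+ 2]real_normK ?num_real //.
  by rewrite lerXn2r ?nnegrE // hab.
have w2 : 0 <= 2 * w ^+ 2 by rewrite mulr_ge0 // sqr_ge0.
have z3 : `|0 : R| <= 1 / 3 by rewrite normr0.
have [w0|/ltW w0] := leP 0 w.
  have := key 0 w w0 z3 hw; rewrite F0 !subr0 => h; apply: le_trans (h _) _.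
    by move=> t /andP[t0 tw]; rewrite !ger0_norm.
  by rewrite ler_piMr //; rewrite ger0_norm // in hw; lra.
have := key w 0 w0 hw z3; rewrite F0 !sub0r normrN => h; apply: le_trans (h _) _.
  by move=> t /andP[t0 tw]; rewrite !ler0_norm // lerN2.
by rewrite ler_piMr //; rewrite ler0_norm // in hw; lra.
Qed.

(** With v = |1 + u|, the real part follows from 1 - 1/v^2 <= ln(v^2) <= v^2 - 1 and the imaginary
    part from [asin_bound]; each contributes 10 * |u|^2. *)
Lemma Log_bound (u : C) : cabs u <= 1 / 4 -> cabs (Log (1 + u) - u) <= 20 * cabs u ^+ 2.
Proof.
move=> hu; set x := complex.Re u; set y := complex.Im u; set v := cabs (1 + u).
have hx : `|x| <= cabs u by exact: Re_le_cabs.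
have hy : `|y| <= cabs u by exact: Im_le_cabs.
have q0 := cabs_ge0 u; set q := cabs u in hu hx hy q0 *.
have v1 : v <= 1 + q by rewrite (le_trans (cabsD _ _)) // cabs1.
have v2 : 1 - q <= v by have := cabs_tri 1 (- u); rewrite opprK cabs1 cabsN.
have v34 : 3 / 4 <= v by lra.
have v0 : 0 < v by lra.
have vE : v ^+ 2 = 1 + 2 * x + q ^+ 2.
  by rewrite /v cabs_sqr ReD ImD /= add0r /q cabs_sqr -/x -/y; ring.
have ReL : `|ln v - x| <= 10 * q ^+ 2.
  have l2 : ln (v ^+ 2) = 2 * ln v by rewrite lnXn // mulr_natl.
  have V0 : 0 < v ^+ 2 by rewrite exprn_gt0.
  have up : ln (v ^+ 2) <= v ^+ 2 - 1.
    by have := @le_ln1Dx R (v ^+ 2 - 1); rewrite (addrC 1) subrK; apply; lra.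
  have lo : 1 - (v ^+ 2)^-1 <= ln (v ^+ 2).
    have := @le_ln1Dx R ((v ^+ 2)^-1 - 1); rewrite (addrC 1) subrK lnV ?posrE //.
    have : 0 < (v ^+ 2)^-1 by rewrite invr_gt0.
    by move=> ? h; have {}h := h ltac:(lra); move: h; drop_order; lra.
  have V9 : 9 / 16 <= v ^+ 2.
    have -> : 9 / 16 = (3 / 4) ^+ 2 :> R by field.
    by rewrite lerXn2r ?nnegrE ?(ltW v0) //; lra.
  have q2 := sqr_ge0 q.
  have Vi : x - 10 * q ^+ 2 <= (1 - (v ^+ 2)^-1) / 2.
    rewrite -(ler_pM2r V0).
    have -> : (1 - (v ^+ 2)^-1) / 2 * v ^+ 2 = (v ^+ 2 - 1) / 2 by field; rewrite gt_eqF.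
    have xq : x * (v ^+ 2 - 1) <= 3 * q ^+ 2.
      have h1 : `|v ^+ 2 - 1| <= 3 * q.
        rewrite vE; have qq : q * q <= q * 1 by rewrite ler_wpM2l //; lra.
        move: hx; rewrite !ler_norml => /andP[a1 a2]; move: a1 a2 qq q2; rewrite !expr2; drop_order => *; apply/andP; split; lra.
      have := ler_pM (normr_ge0 _) (normr_ge0 _) hx h1; rewrite -normrM expr2 => h2.
      by have := le_trans (ler_norm _) h2; drop_order; lra.
    by have := ler_wpM2l q2 V9; move: xq vE q2; drop_order; lra.
  by rewrite ler_norml; move: l2 up lo Vi vE q2; drop_order => *; apply/andP; split; lra.
have ImL : `|asin (y / v) - y| <= 10 * q ^+ 2.
  have w3 : `|y / v| <= 1 / 3.
    by rewrite normrM normfV (ger0_norm (ltW v0)) ler_pdivrMr //; lra.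
  have b1 := asin_bound w3.
  have b2 : `|y / v - y| <= 4 / 3 * q ^+ 2.
    have -> : y / v - y = y * (1 - v) / v by field; rewrite gt_eqF.
    rewrite !normrM normfV (ger0_norm (ltW v0)) ler_pdivrMr //.
    have h1 : `|1 - v| <= q by rewrite ler_norml; apply/andP; split; lra.
    have := ler_pM (normr_ge0 _) (normr_ge0 _) hy h1; rewrite -expr2.
    have := ler_wpM2l (sqr_ge0 q) v34; drop_order; lra.
  have b3 : (y / v) ^+ 2 <= 16 / 9 * q ^+ 2.
    rewrite expr_div_n ler_pdivrMr ?exprn_gt0 //.
    have h1 : y ^+ 2 <= q ^+ 2 by rewrite -real_normK ?num_real // lerXn2r ?nnegrE.
    have h2 : (3 / 4) ^+ 2 <= v ^+ 2 by rewrite lerXn2r ?nnegrE ?(ltW v0) //; lra.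
    have := ler_wpM2l (sqr_ge0 q) h2.
    have -> : (3 / 4) ^+ 2 = 9 / 16 :> R by field.
    lra.
  have := ler_normD (asin (y / v) - y / v) (y / v - y); rewrite addrA subrK.
  by have := sqr_ge0 q; move: b1 b2 b3; drop_order; lra.
apply: le_trans (cabs_le_ReIm _) _.
rewrite ReD ImD ReN ImN /= -/v -/x -/y ImD /= add0r -/y; move: ReL ImL; drop_order; lra.
Qed.

Lemma Log_le (u : C) : cabs u <= 1 / 4 -> cabs (Log (1 + u)) <= 6 * cabs u.
Proof.
move=> hu; have := cabsD (Log (1 + u) - u) u; rewrite subrK; have := Log_bound hu.
have := ler_wpM2l (cabs_ge0 u) hu; rewrite -expr2; lra.
Qed.

Lemma Log_le1 (z : C) : cabs (z - 1) <= 1 / 4 -> cabs (Log z) <= 6 * cabs (z - 1).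
Proof. by move=> h; have := Log_le h; rewrite addrC subrK. Qed.

Lemma Re_near1_gt0 (z : C) : cabs (z - 1) <= 1 / 4 -> 0 < complex.Re z.
Proof.
move=> h; have := Re_le_cabs (z - 1); rewrite ReD ReN /= ler_norml => /andP[? _]; lra.
Qed.

Lemma LogM (z w : C) : 0 < complex.Re z -> 0 < complex.Re w -> cabs (Log z) + cabs (Log w) <= 1 ->
  Log (z * w) = Log z + Log w.
Proof.
move=> z0 w0 h; rewrite -{1}(expc_Log z0) -{1}(expc_Log w0) -expcD Log_expc //.
rewrite ImD (le_trans (ler_normD _ _)) // (le_trans _ h) // lerD //; exact: Im_le_cabs.
Qed.

Lemma LogV (z : C) : 0 < complex.Re z -> cabs (Log z) <= 1 -> Log z^-1 = - Log z.
Proof.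
move=> z0 h; have zE := expc_Log z0.
have n0 : z != 0 by rewrite -zE -cabs_gt0 cabs_expc expR_gt0.
have -> : z^-1 = expc (- Log z).
  apply: (mulfI n0); rewrite (divff n0) -[X in _ = X * _]zE -expcD subrr.
  by rewrite /expc /= expR0 cis0 mulr1 rmorph1.
by rewrite Log_expc // ImN normrN (le_trans (Im_le_cabs _)).
Qed.

(** Near 1 the logarithm of a product is the sum of logarithms, so Log(z + h) - Log z = Log(1 +
    h/z), to which [Log_bound] applies. *)
Lemma differentiable_Log (z : C) : cabs (z - 1) <= 1 / 16 -> differentiable Log z.
Proof.
move=> hz; apply: (@cderiv_differentiable _ _ z^-1) => e e0.
have z4 : cabs (z - 1) <= 1 / 4 by lra.
have Lz := Log_le1 z4.
have z12 : 1 / 2 <= cabs z by have := cabs_tri 1 (1 - z); rewrite subKr cabs1 cabs_sub; lra.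
have z0 : z != 0 by rewrite -cabs_gt0; lra.
have c0 : 0 < cabs z by lra.
exists (Num.min (1 / 32) (e / 80)); first by rewrite lt_min !divr_gt0.
move=> h; rewrite lt_min => /andP[h1 h2]; set u := h / z.
have cu : cabs u <= 2 * cabs h.
  rewrite cabsM cabsV ler_pdivrMr // -mulrA mulrCA; have := ler_wpM2l (cabs_ge0 h) z12; lra.
have u4 : cabs u <= 1 / 4 by have := h1; lra.
have -> : Log (z + h) = Log z + Log (1 + u).
  have -> : z + h = z * (1 + u) by rewrite mulrDr mulr1 /u mulrCA divff // mulr1.
  apply: LogM.
  - exact: Re_near1_gt0.
  - by apply: Re_near1_gt0; rewrite addrAC subrr add0r.
  - have := Log_le u4; lra.
have -> : Log z + Log (1 + u) - Log z - z^-1 * h = Log (1 + u) - u by rewrite /u; ring.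
apply: le_trans (Log_bound u4) _.
have b : cabs u ^+ 2 <= 4 * (cabs h * cabs h).
  have := ler_pM (cabs_ge0 u) (cabs_ge0 u) cu cu; rewrite -expr2; lra.
have := ler_wpM2r (cabs_ge0 h) (ltW h2); lra.
Qed.

End Logarithm.

(** * Charts *)

Section ChartBasics.
Variables (R : realType) (n : nat) (N : complexManifold R n).
Local Notation C := (Cplx R).
Implicit Types (c : chart N 'rV[C]_n) (x y : N) (U : set N) (v P : 'rV[C]_n).

Lemma chart_near c x : dom c x -> \forall y \near x, dom c y.
Proof. by move=> cx; apply: open_nbhs_nbhs; split => //; exact: dom_open. Qed.

Lemma fwd_near c x e : dom c x -> 0 < e ->
  \forall y \near x, dom c y /\ vn (fwd c y - fwd c x) < e.
Proof.
move=> cx e0; have /continuous_vn /(_ e e0) h := fwd_cont cx.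
by apply: filterS2 (chart_near cx) h.
Qed.

Lemma bwd_near c x U : dom c x -> nbhs x U -> exists2 r : R, 0 < r &
  forall v, vn (v - fwd c x) < r -> [/\ dom c (bwd c v), fwd c (bwd c v) = v & U (bwd c v)].
Proof.
move=> cx xU; have : nbhs (fwd c x) (fwd c @` dom c).
  by apply: open_nbhs_nbhs; split; [exact: cod_open|exists x].
move=> h2; have h1 : nbhs (fwd c x) (bwd c @^-1` U).
  by apply: (bwd_cont cx); rewrite fwdK.
have [r r0 hr] := proj1 (@nbhs_vn R n _ _) (filterI h1 h2); exists r => // v /hr [Uv [z cz zv]].
have e : bwd c v = z by rewrite -zv; exact: fwdK.
by rewrite e; split => //; rewrite -e; exact: Uv.
Qed.

Lemma compact_vball P (rho : R) : 0 <= rho -> compact [set v : 'rV[C]_n | vn (v - P) <= rho].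
Proof.
move=> r0; have -> : [set v : 'rV[C]_n | vn (v - P) <= rho] =
   [set v : 'rV[C]_n | forall i, [set z : C | cabs (z - P 0 i) <= rho] (v ord0 i)].
  apply/seteqP; split => v /= h.
    by move=> i; apply: le_trans h; have := cabs_le_vn (v - P) i; rewrite !mxE.
  by apply: vn_le => // i; rewrite !mxE.
exact: (@rV_compact C n (fun i => [set z : C | cabs (z - P 0 i) <= rho]) (fun i => @compact_disc R _ _)).
Qed.

Definition cball c P (rho : R) : set N := [set x | dom c x /\ vn (fwd c x - P) < rho].

Lemma open_cball c P rho : open (cball c P rho).
Proof.
rewrite openE => x [cx xr]; have e0 : 0 < rho - vn (fwd c x - P) by rewrite subr_gt0.
apply: filterS (fwd_near cx e0) => y [cy yx]; split => //.
by apply: le_lt_trans (vn_tri _ (fwd c x) _) _; rewrite -ltrBrDr.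
Qed.

Lemma cball_sub c P (rho rho' : R) x : rho <= rho' -> cball c P rho x -> cball c P rho' x.
Proof. by move=> h [cx xr]; split => //; exact: lt_le_trans h. Qed.

(** The ball lies in the image of the chart; this is where [bwd] has a meaning. *)
Definition good_ball c P (r : R) := forall v, vn (v - P) < r -> dom c (bwd c v) /\ fwd c (bwd c v) = v.

Lemma bwd_continuous_at c v : dom c (bwd c v) -> fwd c (bwd c v) = v -> {for v, continuous (bwd c)}.
Proof. by move=> cv e; have := bwd_cont cv; rewrite e. Qed.

Lemma compact_cball c P (r rho : R) : good_ball c P r -> 0 <= rho < r ->
  compact [set x | dom c x /\ vn (fwd c x - P) <= rho].
Proof.
move=> gb /andP[r0 rr].
have -> : [set x | dom c x /\ vn (fwd c x - P) <= rho] = bwd c @` [set v | vn (v - P) <= rho].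
  apply/seteqP; split => [x [cx xr]|x [v vr <-]].
    by exists (fwd c x) => //; exact: fwdK.
  by have [cv e] := gb v (le_lt_trans vr rr); split => //; rewrite /= e.
apply: continuous_compact; last exact: compact_vball.
apply: continuous_in_subspaceT => v /[1!inE] vr.
by have [cv e] := gb v (le_lt_trans vr rr); exact: bwd_continuous_at.
Qed.

(** Turns local constants into one constant. The sets where Pr k holds in a neighbourhood are open
    and increase with the integer k, so by compactness one of them contains A. *)
Lemma near_compact (A : set N) (Pr : R -> N -> Prop) : compact A ->
  (forall k k' x, k <= k' -> Pr k x -> Pr k' x) ->
  (forall q, A q -> exists k, \forall x \near q, Pr k x) ->
  exists k, exists O : set N, [/\ open O, A `<=` O & forall x, O x -> Pr k x].
Proof.
move=> cA mono loc.
pose B (k : nat) : set N := [set x | \forall y \near x, Pr k%:R y].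
have oB k : open (B k) by rewrite openE => x; exact: nbhs_interior.
have mB k k' : (k <= k')%N -> B k `<=` B k'.
  by move=> kk x; apply: filterS => y; apply: mono; rewrite ler_nat.
have [|k _ hk] := proj1 (compact_near_coveringP A) cA nat \oo (fun k x => B k x) _.
  move=> q /loc[k hk]; pose k0 := Num.bound `|k|.
  have Bq : B k0 q.
    apply: filterS hk => x; apply: mono; rewrite ltW // (le_lt_trans (ler_norm _)) //.
    exact: archi_boundP.
  exists (B k0, [set j | (k0 <= j)%N]) => /=.
    by split; [apply: open_nbhs_nbhs; split|exists k0].
  by move=> [x j] [/= Bx kj]; exact: mB kj _ Bx.
exists k%:R, (B k); split => //; first by apply: hk => /=.
by move=> x; exact: nbhs_singleton.
Qed.

Lemma near_finite (T : eqType) (s : seq T) (q : N) (Pr : T -> R -> N -> Prop) :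
  (forall t k k' x, k <= k' -> Pr t k x -> Pr t k' x) ->
  (forall t, t \in s -> exists k, \forall x \near q, Pr t k x) ->
  exists k, \forall x \near q, forall t, t \in s -> Pr t k x.
Proof.
move=> mono; elim: s => [|t s ih] h; first by exists 0; apply: nearW.
have [k1 h1] := h t (mem_head _ _).
have [|k2 h2] := ih; first by move=> u us; apply: h; rewrite inE us orbT.
exists (Num.max k1 k2); apply: filterS2 h1 h2 => x x1 x2 u; rewrite inE => /orP[/eqP ->|us].
  by apply: mono x1; rewrite le_max lexx.
by apply: mono (x2 u us); rewrite le_max lexx orbT.
Qed.

Lemma chart_compat_diff c d x : atlas c -> atlas d -> dom c x -> dom d x ->
  differentiable (fwd d \o bwd c) (fwd c x).
Proof. by move=> ? ? ? ?; exact: atlas_compat. Qed.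

Lemma differentiable_entry (V : normedModType C) (g : V -> 'rV[C]_n) (w : V) (j : 'I_n) :
  differentiable g w -> differentiable (fun v : V => g v 0 j : C) w.
Proof.
move=> dg; apply: (@differentiable_comp _ V 'rV[C]_n C g (fun u : 'rV[C]_n => u 0 j)) => //.
exact: differentiable_coord.
Qed.

End ChartBasics.

(** * Charts along the line *)

Section Line.
Variables (R : realType) (n : nat) (N : complexManifold R n).
Local Notation C := (Cplx R).
Variable iota : P1 R -> N.
Hypothesis hiota : P1_embedding iota.
Local Notation L := (range iota).

(* The two affine charts of P^1: z for [true], 1/z for [false]. *)
Definition line_param (s : bool) : C -> N := if s then iota \o @aff0 R else iota \o @affoo R.

Lemma line_param_imm s : immersed_curve (line_param s).
Proof. by case: hiota => _ h0 h1; case: s. Qed.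

Lemma line_param_cont s : continuous (line_param s).
Proof. by case: (line_param_imm s). Qed.

Lemma line_param_inj s : injective (line_param s).
Proof.
case: hiota => inj _ _; case: s => z w /inj; first by case.
rewrite /affoo; case: (eqVneq z 0) => [->|z0]; case: (eqVneq w 0) => [->|w0] //.
by case=> /invr_inj.
Qed.

Lemma line_param_cross s z w : line_param s z = line_param (~~ s) w -> z * w = 1.
Proof.
case: hiota => inj _ _; case: s => /inj; rewrite /aff0 /affoo.
  by case: (eqVneq w 0) => // w0 [->]; rewrite mulVf.
by case: (eqVneq z 0) => // z0 [<-]; rewrite divff.
Qed.

Lemma line_param_switch s z : z != 0 -> line_param s z = line_param (~~ s) z^-1.
Proof.
move=> z0; case: s; rewrite /line_param /= /aff0 /affoo; last by rewrite (negbTE z0).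
by rewrite invr_eq0 (negbTE z0) invrK.
Qed.

Lemma line_param_L s z : L (line_param s z).
Proof. by case: s; [exists (aff0 z)|exists (affoo z)]. Qed.

Lemma L_cover q : L q -> exists s z, cabs z <= 1 /\ q = line_param s z.
Proof.
move=> [[z|] _ <-]; last first.
  by exists false, 0; rewrite cabs0; split => //; rewrite /line_param /= /affoo eqxx.
have [z1|z1] := leP (cabs z) 1; first by exists true, z.
have z0 : z != 0 by rewrite -cabs_gt0 (lt_trans ltr01).
exists false, z^-1; split; first by rewrite cabsV invf_le1 // ?ltW // (lt_trans ltr01).
by rewrite -[false]/(~~ true) -line_param_switch.
Qed.

Lemma compact_line_param s (K : set C) : compact K -> compact (line_param s @` K).
Proof. by move=> cK; apply: continuous_compact cK; apply: continuous_subspaceT; exact: line_param_cont. Qed.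

Lemma L_compact : compact L.
Proof.
pose D := [set z : C | cabs (z - 0) <= 1].
have -> : L = (line_param true @` D) `|` (line_param false @` D).
  apply/seteqP; split => [q /L_cover[s [z [z1 ->]]]|q [[z _ <-]|[z _ <-]]]; [|exact: line_param_L|exact: line_param_L].
  by case: s; [left|right]; exists z => //; rewrite /D /= subr0.
by apply: compactU; apply: compact_line_param; exact: compact_disc.
Qed.

(* A chart of N on a ball with a holomorphic function that extends the affine
   coordinate of L. *)
Definition ldata (s : bool) (c : chart N 'rV[C]_n) (P : 'rV[C]_n) (r : R) (Zc : 'rV[C]_n -> C) :=
  [/\ atlas c, 0 < r, good_ball c P r,
    forall v, vn (v - P) < r -> [/\ differentiable Zc v, cabs (Zc v) <= 2 & dom c (line_param s (Zc v))]
    & forall q, L q -> cball c P r q -> q = line_param s (Zc (fwd c q))].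

Lemma entry_cderiv (g : C -> 'rV[C]_n) z m : differentiable g z ->
  cderiv (fun w => g w 0 m) z ('D_1 g z 0 m).
Proof.
move=> dg e e0; have /nbhs_cabs[r r0 hr] := differentiable_eps dg e0.
exists r => // h; rewrite -{1}[h]subr0 => /hr.
rewrite normvE cabsE -rmorphM lecR => /(le_trans _); apply.
have -> : g (z + h) 0 m - g z 0 m - 'D_1 g z 0 m * h = (g (z + h) - g z - 'd g z h) 0 m.
  have -> : 'd g z h = h *: 'D_1 g z.
    by rewrite deriveE // -{1}[h]mulr1 -[h * 1]/(h *: (1 : C)) linearZ.
  by rewrite !mxE [h * _]mulrC.
exact: cabs_le_vn.
Qed.

(** The points of L with coordinate at distance at least e from z0 form a compact set A that avoids
    the given point: coordinates of modulus at most 2 come from [K1], the others from the disc [K2]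
    of the opposite chart. As N is Hausdorff, A is closed and its complement is the required
    neighbourhood. *)
Lemma L_separation s (z0 : C) (e : R) : cabs z0 <= 1 -> 0 < e ->
  \forall q \near line_param s z0, L q -> exists2 z, cabs (z - z0) < e & q = line_param s z.
Proof.
move=> z01 e0.
pose K1 := [set z : C | cabs (z - 0) <= 2] `&` [set z : C | e <= cabs (z - z0)].
pose K2 := [set z : C | cabs (z - 0) <= 1 / 2].
pose A := (line_param s @` K1) `|` (line_param (~~ s) @` K2).
have cK1 : compact K1.
  apply: compact_closedI; first exact: compact_disc.
  have -> : [set z : C | e <= cabs (z - z0)] = ~` [set z | cabs (z - z0) < e].
    by apply/seteqP; split => w /=; rewrite leNgt => /negP.
  apply: open_closedC; rewrite openE => w /= wr; apply/nbhs_cabs.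
  exists (e - cabs (w - z0)); first by rewrite subr_gt0.
  move=> y yw; have := cabsD (y - w) (w - z0); rewrite addrA subrK => h.
  change (cabs (y - z0) < e); lra.
have cA : closed A.
  apply: compact_closed; first exact: manifold_hausdorff.
  by apply: compactU; apply: compact_line_param => //; exact: compact_disc.
have nA : ~ A (line_param s z0).
  move=> [[z [_ ez] /line_param_inj zz]|[w w2 ww]].
    by move: ez => /=; rewrite zz subrr cabs0 leNgt e0.
  have := line_param_cross (esym ww); move/(congr1 (@cabs R)); rewrite cabsM cabs1.
  move: w2; rewrite /K2 /= subr0 => w2.
  by have := ler_pM (cabs_ge0 z0) (cabs_ge0 w) z01 w2; lra.
have : nbhs (line_param s z0) (~` A) by apply: open_nbhs_nbhs; split => //; exact: closed_openC.
apply: filterS => q nq /L_cover[s' [z [z1 qz]]].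
have far z' : q = line_param s z' -> cabs z' <= 2 -> exists2 z'', cabs (z'' - z0) < e & q = line_param s z''.
  move=> qz' z'2; exists z' => //; rewrite ltNge; apply/negP => ez; apply: nq; left.
  by exists z' => //; split => //=; rewrite subr0.
have [ss|ss] := eqVneq s' s.
  by rewrite ss in qz; apply: far qz _; lra.
have ss' : s' = ~~ s by move: ss {qz}; case: s'; case: (s).
rewrite ss' in qz; have [z2|z2] := leP (cabs z) (1 / 2).
  by exfalso; apply: nq; right; exists z => //; rewrite /K2 /= subr0.
have zn : z != 0 by rewrite -cabs_gt0; lra.
apply: (far z^-1); first by rewrite qz line_param_switch // negbK.
by rewrite cabsV -[X in _ <= X]invrK lef_pV2 ?posrE ?invr_gt0 //; lra.
Qed.

(** Some entry m of the embedded curve has nonzero derivative at z0. The coordinate function sends v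
    to the parameter of the point of the curve having the same m-th entry as v; it is holomorphic by
    [inverse_coordinate], applied to the one-variable map z -> g(z)_m seen as a function G on C^n.
    By [L_separation], points of L in a small ball have parameter near z0, where the inversion is
    valid. *)
Lemma ldata_ex s (z0 : C) : cabs z0 <= 1 -> exists c P r Zc,
  [/\ ldata s c P r Zc, dom c (line_param s z0) & fwd c (line_param s z0) = P].
Proof.
move=> z01; have [c ac cq] := @atlas_cover R n N (line_param s z0).
pose P := fwd c (line_param s z0); pose g z := fwd c (line_param s z).
have [hc hd] := line_param_imm s.
have [dg0 Dg0] := hd z0 c ac cq.
have [m Dm] : exists m, 'D_1 g z0 0 m != 0.
  apply: contrapT => hn; move/eqP: Dg0; apply; apply/rowP => m; rewrite [RHS]mxE.
  by apply/eqP; apply: contrapT => /negP h; apply: hn; exists m.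
pose G (y : 'rV[C]_n) := g (y 0 m) 0 m; pose p := setc m P z0.
have near_dom e : 0 < e -> \forall z \near z0, dom c (line_param s z) /\ vn (g z - P) < e.
  by move=> e0; exact: (hc z0 _ (fwd_near cq e0)).
have dG : \forall y \near p, differentiable G y.
  have /nbhs_cabs[r r0 hr] := near_dom 1 ltr01.
  apply/nbhs_vn; exists r => // y yr.
  have [cy _] : dom c (line_param s (y 0 m)) /\ vn (g (y 0 m) - P) < 1.
    by apply: hr; apply: le_lt_trans yr; have := cabs_le_vn (y - p) m; rewrite !mxE eqxx.
  have [dgy _] := hd _ c ac cy.
  apply: (@differentiable_comp _ 'rV[C]_n C C (fun y : 'rV[C]_n => y 0 m) (fun z => g z 0 m)).
    exact: differentiable_coord.
  exact: (@differentiable_entry _ _ C).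
have DGp : 'D_(delta_mx 0 m) G p = 'D_1 g z0 0 m.
  rewrite (@vderiv_partial _ _ G p ('D_1 g z0 0 m *: delta_mx 0 m) m).
    by rewrite !mxE !eqxx mulr1.
  move=> e e0; have [r r0 hr] := entry_cderiv m dg0 e0; exists r => // h hr'.
  have hm : cabs (h 0 m) < r by exact: le_lt_trans (cabs_le_vn _ _) hr'.
  have E : \sum_i ('D_1 g z0 0 m *: delta_mx 0 m : 'rV[C]_n) 0 i * h 0 i = 'D_1 g z0 0 m * h 0 m.
    have := @dotv_scale _ _ ('D_1 g z0 0 m) (delta_mx 0 m) h; rewrite /dotv => ->.
    congr (_ * _); rewrite (bigD1 m) //= mxE !eqxx mul1r big1 ?addr0 // => j jm.
    by rewrite mxE (negbTE jm) andbF mul0r.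
  have Ep : G (p + h) = g (z0 + h 0 m) 0 m by rewrite /G /p !mxE eqxx.
  have Ep0 : G p = g z0 0 m by rewrite /G /p !mxE eqxx.
  rewrite E Ep Ep0; apply: le_trans (hr _ hm) _.
  by rewrite ler_pM2l // cabs_le_vn.
have DGp0 : 'D_(delta_mx 0 m) G p != 0 by rewrite DGp.
have [r1 [s1 [K [r10 s10 K1 K2 K3]]]] := inverse_coordinate dG DGp0.
have qP : setc m p (G p) = P.
  have -> : G p = P 0 m by rewrite /G /p setc_i.
  by rewrite /p setc_set setc_id.
have KP : K P = z0.
  rewrite -{1}qP K2 ?subrr ?vn0 //; last exact: ltW.
  by rewrite /p setc_i.
have m0 : 0 < Num.min r1 s1 by rewrite lt_min r10.
have /nbhs_cabs[e1 e10 he1] := near_dom _ m0.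
pose e := Num.min e1 (Num.min r1 1).
have e0 : 0 < e by rewrite !lt_min e10 r10 ltr01.
have e_e1 : e <= e1 by rewrite ge_min lexx.
have e_r1 : e <= r1 by rewrite !ge_min lexx !orbT.
have e_1 : e <= 1 by rewrite !ge_min lexx !orbT.
have Kg z : cabs (z - z0) < e -> K (g z) = z.
  move=> ze; have [cz] := he1 z (lt_le_trans ze e_e1); rewrite lt_min => /andP[g1 g2].
  have E : setc m (setc m (g z) z) (G (setc m (g z) z)) = g z.
    by rewrite setc_set /G setc_i setc_id.
  have := K2 (setc m (g z) z); rewrite E qP setc_i; apply => //.
  rewrite /p setc_sub; apply: vn_setc; [exact: ltW|exact: ltW|].
  by rewrite ltW // (lt_le_trans ze).
have dKP : differentiable K P by apply: K3; rewrite qP subrr vn0.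
have /continuous_cabs /(_ e e0) /nbhs_vn[r2 r20 hr2] := differentiable_continuous dKP.
have [r3 r30 hr3] := bwd_near cq (L_separation s z01 e0).
pose r := Num.min s1 (Num.min r2 r3).
have r0 : 0 < r by rewrite !lt_min s10 r20.
exists c, P, r, K; split; [|exact: cq|exact: erefl].
split; [exact: ac|exact: r0| | |].
- by move=> v; rewrite !lt_min => /andP[_ /andP[_ /hr3[]]].
- move=> v; rewrite !lt_min => /andP[vs1 /andP[/hr2]]; rewrite KP => Kv _.
  split.
  + by apply: K3; rewrite qP.
  + have := cabsD (K v - z0) z0; rewrite subrK; move: Kv => /= Kv.
    have Kv' : cabs (K v - z0) < 1 by exact: lt_le_trans Kv e_1.
    move: Kv' z01; drop_order; lra.
  + by have [] := he1 (K v) (lt_le_trans Kv e_e1).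
- move=> q Lq [cq' qr]; have := qr; rewrite !lt_min => /andP[_ /andP[_ /hr3[_ _]]].
  rewrite fwdK // => /(_ Lq)[z ze qz].
  by rewrite {1}qz; congr (line_param s _); rewrite {1}qz -/(g z) Kg.
Qed.

End Line.

(** * The map in charts along the line *)

Section Arithmetic.
Variable R : realFieldType.
Implicit Types e rho r a b c d t : R.

(** Linear inequalities between the radii and constants of [compare], isolated from its large
    context. *)
Lemma quarter_lt e rho : 0 < e -> e * 8 <= rho -> e < rho / 4.
Proof. lra. Qed.

Lemma lt_of_quarter e rho r : 0 < rho -> e < rho / 4 -> rho <= r -> e < r /\ e < r / 2.
Proof. by move=> ? ? ?; split; lra. Qed.

Lemma ge_summands a b c d t : 0 <= a -> 0 <= b -> 0 <= c -> 0 <= d -> 0 < t ->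
  0 < a + b + c + d + t + 1 /\ [/\ a <= a + b + c + d + t + 1, b <= a + b + c + d + t + 1,
   c <= a + b + c + d + t + 1, d <= a + b + c + d + t + 1 & t <= a + b + c + d + t + 1].
Proof. by move=> ? ? ? ? ?; split; [|split]; lra. Qed.

Lemma lt_half_add e rho r b : b < e -> e < rho / 4 -> rho <= r -> 0 < rho -> b + rho / 2 <= r.
Proof. lra. Qed.

End Arithmetic.

Lemma bool_neq (s s' : bool) : s <> s' -> s' = ~~ s.
Proof. by case: s s' => [] []. Qed.

Section Compare.
Variables (R : realType) (n : nat) (N : complexManifold R n).
Local Notation C := (Cplx R).
Variable iota : P1 R -> N.
Hypothesis hiota : P1_embedding iota.
Local Notation L := (range iota).
Local Notation line_param := (line_param iota).
Local Notation chartN := (chart N 'rV[C]_n).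
Local Notation coord := ('rV[C]_n -> C).
Implicit Types (s : bool) (c : chartN) (P v u w : 'rV[C]_n) (r k : R) (Zc : coord) (x y q : N).

Definition zco (c : chartN) (Zc : coord) (x : N) : C := Zc (fwd c x).

(* Distance, in a chart, to the point of L with the same affine coordinate. *)
Definition delta (s : bool) (c : chartN) (Zc : coord) (x : N) : R := vn (fwd c x - fwd c (line_param s (zco c Zc x))).

(* Moving from a chart to another one along g, where g is z^d on L and has order
   of contact a with L; charts of different types see z' = 1/z^d. *)
Definition cmp (s : bool) (c : chartN) (P : 'rV[C]_n) (r : R) (Zc : coord)
    (s' : bool) (c' : chartN) (P' : 'rV[C]_n) (r' : R) (Zc' : coord) (g : N -> N) (d a : nat) (k : R) (x y : N) :=
  [/\ cball c' P' r' (g y), vn (fwd c' (g y) - fwd c' (g x)) <= k * vn (fwd c y - fwd c x),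
    cabs (if s == s' then zco c' Zc' (g y) - zco c Zc y ^+ d
          else zco c' Zc' (g y) * zco c Zc y ^+ d - 1) <= k * delta s c Zc y
    & delta s' c' Zc' (g y) <= k * delta s c Zc y ^+ a].

(** One number k is both the constant and the inverse of the radius, which makes the property
    monotone in k, as [near_compact] requires. *)
Definition cmp_near (s : bool) (c : chartN) (P : 'rV[C]_n) (r : R) (Zc : coord)
    (s' : bool) (c' : chartN) (P' : 'rV[C]_n) (r' : R) (Zc' : coord) (g : N -> N) (d a : nat) (k : R) (x : N) := 0 < k /\
  forall y, dom c y -> vn (fwd c y - fwd c x) < k^-1 -> cmp s c P r Zc s' c' P' r' Zc' g d a k x y.

Lemma delta_ge0 s c Zc x : 0 <= delta s c Zc x.
Proof. exact: vn_ge0. Qed.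

Lemma cmp_near_mono s c P r Zc s' c' P' r' Zc' g d a k k' x : k <= k' ->
  cmp_near s c P r Zc s' c' P' r' Zc' g d a k x -> cmp_near s c P r Zc s' c' P' r' Zc' g d a k' x.
Proof.
move=> kk [k0 h]; have k'0 : 0 < k' by exact: lt_le_trans kk.
split => // y cy yx; have [|h1 h2 h3 h4] := h y cy.
  by apply: lt_le_trans yx _; rewrite lef_pV2.
split; [exact: h1| | |].
- by apply: le_trans h2 _; rewrite ler_wpM2r ?vn_ge0.
- by apply: le_trans h3 _; rewrite ler_wpM2r ?delta_ge0.
- by apply: le_trans h4 _; rewrite ler_wpM2r ?exprn_ge0 ?delta_ge0.
Qed.

Lemma holb_family m (F : 'I_m -> 'rV[C]_n -> C) p :
  (forall j, \forall v \near p, differentiable (F j) v) ->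
  exists r M, 0 < r /\ forall j, holb (F j) p r M.
Proof.
elim: m F => [|m ih] F hF; first by exists 1, 0; split => // -[].
have [r1 [M1 [r10 h1]]] := holb_near (hF ord0).
have [r2 [M2 [r20 h2]]] := ih (F \o lift ord0) (fun j => hF _).
exists (Num.min r1 r2), (Num.max M1 M2); split; first by rewrite lt_min r10.
move=> j v; rewrite lt_min => /andP[v1 v2].
case: (unliftP ord0 j) => [j' ->|->].
  have [d b] := h2 j' v v2; split; first exact: d.
  by rewrite le_max b orbT.
have [d b] := h1 v v1; split; first exact: d.
by rewrite le_max b.
Qed.

Lemma zco_L s c P r Zc z : ldata iota s c P r Zc -> cball c P r (line_param s z) -> zco c Zc (line_param s z) = z.
Proof.
move=> [_ _ _ _ h] hc; have := h _ (line_param_L iota s z) hc.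
by move/(line_param_inj hiota).
Qed.

Lemma delta_L s c P r Zc q : ldata iota s c P r Zc -> L q -> cball c P r q -> delta s c Zc q = 0.
Proof.
by move=> [_ _ _ _ h] Lq hc; rewrite /delta /zco -(h _ Lq hc) subrr vn0.
Qed.

Variables (g : N -> N) (d a : nat).
Hypothesis gH : holomorphic g.
Hypothesis ghh : forall s z, g (line_param s z) = line_param s (z ^+ d).
Hypothesis gsa : transversally_superattracting g L a.

Lemma differentiable_local (c c' : chart N 'rV[C]_n) x : atlas c -> atlas c' -> dom c x -> dom c' (g x) ->
  differentiable (fwd c' \o g \o bwd c) (fwd c x).
Proof. by case: gH => _ h ac ac' cx cgx; exact: h. Qed.

Lemma differentiable_gamma s c P r Zc v : ldata iota s c P r Zc -> vn (v - P) < r ->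
  differentiable (fun u => fwd c (line_param s (Zc u))) v.
Proof.
move=> [ac _ gb hZ _] vr; have [dZ _ cZ] := hZ v vr.
have [_ hd] := line_param_imm hiota s; have [dg _] := hd _ c ac cZ.
exact: (@differentiable_comp _ 'rV[C]_n C 'rV[C]_n Zc (fwd c \o line_param s)).
Qed.

Lemma compare s c P r Zc s' c' P' r' Zc' q :
  ldata iota s c P r Zc -> ldata iota s' c' P' r' Zc' -> L q -> cball c P r q -> cball c' P' r' (g q) ->
  exists k, \forall x \near q, dom c x -> cmp_near s c P r Zc s' c' P' r' Zc' g d a k x.
Proof.
move=> hi hj Lq cq c'q.
have [ac r0 gb hZ hL] := hi; have [ac' r'0 gb' hZ' hL'] := hj.
pose v0 := fwd c q.
pose Phi := fwd c' \o g \o bwd c.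
pose chi j (x : N) : C := fwd c' x 0 j - fwd c' (line_param s' (zco c' Zc' x)) 0 j.
have gc : continuous g by case: gH.
have Lgq : L (g q) by rewrite (hL _ Lq cq) ghh; exact: line_param_L.
have dchi j u : vn (u - P') < r' -> differentiable (fun u : 'rV[C]_n => u 0 j - fwd c' (line_param s' (Zc' u)) 0 j) u.
  move=> ur; apply: differentiableB; first exact: differentiable_coord.
  exact: (differentiable_entry _ (differentiable_gamma hj ur)).
have van j : \forall x \near q, L x -> vanishing_order_ge a (chi j \o g) x.
  apply: (gsa (eta := g q)) => //.
    have : nbhs (g q) (cball c' P' r') by apply: open_nbhs_nbhs; split => //; exact: open_cball.
    apply: filterS => y [c'y yr] e ae ey.
    apply: (@differentiable_comp _ 'rV[C]_n 'rV[C]_n C (fwd c' \o bwd e)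
       (fun u : 'rV[C]_n => u 0 j - fwd c' (line_param s' (Zc' u)) 0 j)).
      exact: chart_compat_diff.
    rewrite /= (fwdK ey); exact: dchi.
  have : nbhs (g q) (cball c' P' r') by apply: open_nbhs_nbhs; split => //; exact: open_cball.
  by apply: filterS => y hy Ly; rewrite /chi /zco -(hL' _ Ly hy) subrr.
have van' : \forall x \near q, forall j, L x -> vanishing_order_ge a (chi j \o g) x.
  have [|k hk] := @near_finite R n N 'I_n (enum 'I_n) q (fun j _ x => L x -> vanishing_order_ge a (chi j \o g) x) (fun _ _ _ _ _ h => h).
    by move=> j _; exists 0; exact: van.
  by apply: filterS hk => x hx j; apply: hx; rewrite mem_enum.
have nU : \forall x \near q, [/\ cball c P r x, cball c' P' r' (g x) & forall j, L x -> vanishing_order_ge a (chi j \o g) x].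
  have n1 : nbhs q (cball c P r) by apply: open_nbhs_nbhs; split => //; exact: open_cball.
  have n2 : nbhs q (g @^-1` cball c' P' r').
    by apply: gc; apply: open_nbhs_nbhs; split => //; exact: open_cball.
  by apply: filterS3 n1 n2 van' => x x1 x2 x3; split.
have cdq : dom c q by case: cq.
have [r1 r10 hr1] := bwd_near cdq nU.
have Phi_dom v : vn (v - v0) < r1 -> vn (v - P) < r /\ cball c' P' r' (g (bwd c v)).
  by move=> /hr1[_ e [[_ h] h2 _]]; split => //; rewrite -e.
have dPhi v : vn (v - v0) < r1 -> differentiable Phi v.
  move=> /hr1[cv e [_ [c'g _] _]].
  by have := differentiable_local ac ac' cv c'g; rewrite e.
have nearv (Q : 'rV[C]_n -> Prop) : (forall v, vn (v - v0) < r1 -> Q v) -> \forall v \near v0, Q v.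
  by move=> h; apply/nbhs_vn; exists r1.
have dW j : \forall v \near v0, differentiable (chi j \o g \o bwd c) v.
  apply: nearv => v vr; have [_ [_ gr]] := Phi_dom v vr.
  apply: (@differentiable_comp _ 'rV[C]_n 'rV[C]_n C Phi
       (fun u : 'rV[C]_n => u 0 j - fwd c' (line_param s' (Zc' u)) 0 j)); first exact: dPhi.
  exact: dchi.
have dPj j : \forall v \near v0, differentiable (fun v => Phi v 0 j) v.
  by apply: nearv => v vr; apply: (differentiable_entry j); exact: dPhi.
have dZ1 : \forall v \near v0, differentiable (Zc' \o Phi) v.
  apply: nearv => v vr; have [_ [_ gr]] := Phi_dom v vr.
  apply: (@differentiable_comp _ 'rV[C]_n 'rV[C]_n C Phi Zc'); first exact: dPhi.
  by have [] := hZ' _ gr.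
have [r2 [M2 [r20 h2]]] := holb_family dPj.
have [r3 [M3 [r30 h3]]] := holb_family dW.
have [r4 [M4 [r40 h4]]] := holb_near dZ1.
have [K K0 hK] := @vanishing_bound R n a.
(* The foot of v on L: [delta] is the distance from v to pr v. *)
pose pr v := fwd c (line_param s (Zc v)).
have v0r : vn (v0 - P) < r by case: cq.
have pr0 : pr v0 = v0 by rewrite /pr -[Zc v0]/(zco c Zc q) /zco -(hL _ Lq cq).
pose rho := Num.min (Num.min r1 r2) (Num.min r3 r4).
have rho0 : 0 < rho by rewrite !lt_min r10 r20 r30.
have rr1 : rho <= r1 by rewrite !ge_min lexx.
have rr2 : rho <= r2 by rewrite !ge_min lexx !orbT.
have rr3 : rho <= r3 by rewrite !ge_min lexx !orbT.
have rr4 : rho <= r4 by rewrite !ge_min lexx !orbT.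
(* [vanishing_bound] holds on the fraction 2^-a of its radius, and the balls are shrunk in that
   proportion. *)
pose A : R := 2 ^+ a; have A1 : 1 <= A by rewrite exprn_ege1 // ler1n.
have A0 : 0 < A by rewrite (lt_le_trans ltr01).
pose e := rho / (8 * A).
have e0 : 0 < e by rewrite divr_gt0 // mulr_gt0.
have e8 : e * 8 <= rho.
  rewrite /e invfM mulrA mulrAC divfK // ler_pdivrMr // ler_peMr //; exact: ltW.
have /continuous_vn /(_ e e0) /nbhs_vn[r5 r50 hr5] := differentiable_continuous (differentiable_gamma hi v0r).
rewrite -/(pr v0) pr0 in hr5.
pose t := Num.min (Num.min r5 e) 1; have t0 : 0 < t by rewrite !lt_min r50 e0 ltr01.
have te : t <= e by rewrite !ge_min lexx !orbT.
have t5 : t <= r5 by rewrite !ge_min lexx.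
(* Nonnegativity of M2 and M3 comes only with an index j, hence the absolute values in k1 and k3. *)
have M20 (j : 'I_n) : 0 <= M2 by exact: holb_ge0 r20 (h2 j).
have M30 (j : 'I_n) : 0 <= M3 by exact: holb_ge0 r30 (h3 j).
have M40 : 0 <= M4 by exact: holb_ge0 r40 h4.
pose k1 := 32 * `|M2| / r2; pose k2 := 32 * M4 / r4 * 2 ^+ d; pose k2' := 32 * M4 / r4.
pose k3 := K * `|M3| * (2 / rho) ^+ a.
pose k := k1 + k2 + k2' + k3 + 2 / t + 1.
have k10 : 0 <= k1 by rewrite divr_ge0 ?mulr_ge0 // ltW.
have k2'0 : 0 <= k2' by rewrite divr_ge0 ?mulr_ge0 // ltW.
have k20 : 0 <= k2 by rewrite mulr_ge0 ?exprn_ge0.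
have k30 : 0 <= k3 by rewrite mulr_ge0 ?mulr_ge0 ?exprn_ge0 // divr_ge0 // ltW.
have kt0 : 0 < 2 / t by rewrite divr_gt0.
have [k0 [kk1 kk2 kk2' kk3 kkt]] := ge_summands k10 k20 k2'0 k30 kt0.
rewrite -/k in k0 kk1 kk2 kk2' kk3 kkt.
have kinv : k^-1 <= t / 2 by rewrite -[t / 2]invrK lef_pV2 ?posrE ?invr_gt0 ?divr_gt0 // invf_div.
have t20 : 0 < t / 2 by rewrite divr_gt0.
exists k; apply: filterS (fwd_near cdq t20) => x [cx xq] _; split => // y cy yx.
have yq : vn (fwd c y - v0) < t.
  apply: le_lt_trans (vn_tri _ (fwd c x) _) _; rewrite (splitr t) ltrD //.
  exact: lt_le_trans yx kinv.
have xq' : vn (fwd c x - v0) < t by apply: lt_trans xq _; rewrite ltr_pdivrMr // ltr_pMr // ltr1n.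
set u := fwd c y; set w := fwd c x.
have bu : bwd c u = y by exact: fwdK.
have bw : bwd c w = x by exact: fwdK.
have rho8 := quarter_lt e0 e8.
have [er1 _] := lt_of_quarter rho0 rho8 rr1.
have ue : vn (u - v0) < e by exact: lt_le_trans te.
have we : vn (w - v0) < e by exact: lt_le_trans te.
have prue : vn (pr u - v0) < e by apply: hr5; exact: lt_le_trans t5.
have [ur [c'gy gyr]] := Phi_dom u (lt_trans ue er1).
have [_ er2] := lt_of_quarter rho0 rho8 rr2.
have [_ er3] := lt_of_quarter rho0 rho8 rr3.
have [_ er4] := lt_of_quarter rho0 rho8 rr4.
have [c'p e'p [cpr gpr vpr]] := hr1 _ (lt_trans prue er1).
have pE : bwd c (pr u) = line_param s (Zc u).
  by have [_ _ cZ] := hZ u ur; rewrite /pr fwdK.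
split.
- by rewrite -bu; split.
- apply: (@le_trans _ _ (k1 * vn (u - w))); last by rewrite ler_wpM2r ?vn_ge0.
  rewrite -bu -bw; apply: vn_le => [|j]; first by rewrite mulr_ge0 ?vn_ge0.
  rewrite !mxE; have := holb_lip r20 (h2 j) (lt_trans ue er2) (lt_trans we er2).
  by rewrite /k1 ger0_norm //; exact: M20 j.
- have pL : L (g (bwd c (pr u))) by rewrite pE ghh; exact: line_param_L.
  have gE := hL' _ pL gpr; rewrite pE ghh in gE.
  have lipZ : cabs (Zc' (Phi u) - Zc' (Phi (pr u))) <= k2' * delta s c Zc y.
    exact: (holb_lip r40 h4 (lt_trans ue er4) (lt_trans prue er4)).
  rewrite -[zco c Zc y]/(Zc u) -{1 2}bu -[zco c' Zc' (g (bwd c u))]/(Zc' (Phi u)).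
  have ZE : fwd c' (g (line_param s (Zc u))) = Phi (pr u) by rewrite /Phi /= pE.
  rewrite -ghh ZE in gE; rewrite ghh in gE.
  case: eqP => [ss|ss].
    rewrite -ss in gE; have e1 := line_param_inj hiota gE.
    rewrite e1; apply: le_trans lipZ _; rewrite ler_wpM2r ?delta_ge0 //.
  have ss' := bool_neq ss.
  rewrite ss' in gE; have e1 := line_param_cross hiota gE.
  have -> : Zc' (Phi u) * Zc u ^+ d - 1 = (Zc' (Phi u) - Zc' (Phi (pr u))) * Zc u ^+ d.
    by rewrite mulrBl -[X in _ = _ - X]mulrC e1.
  rewrite cabsM cabsX.
  have Z2 : cabs (Zc u) ^+ d <= 2 ^+ d by apply: lerXn2r; rewrite ?nnegrE ?cabs_ge0 //; have [] := hZ u ur.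
  apply: le_trans (ler_pM (cabs_ge0 _) (exprn_ge0 _ (cabs_ge0 _)) lipZ Z2) _.
  rewrite mulrAC; apply: ler_wpM2r; [exact: delta_ge0|exact: kk2].
- apply: (@le_trans _ _ (k3 * delta s c Zc y ^+ a)); last by rewrite ler_wpM2r ?exprn_ge0 ?delta_ge0.
  apply: vn_le => [|j]; first by rewrite mulr_ge0 ?exprn_ge0 ?delta_ge0.
  rewrite !mxE -[fwd c' (g y) 0 j - _]/(chi j (g y)).
  have -> : chi j (g y) = chi j (g (bwd c u)) by rewrite bu.
  have hw : holb (chi j \o g \o bwd c) (pr u) (rho / 2) M3.
    apply: holb_sub (h3 j) _; exact: lt_half_add prue rho8 rr3 rho0.
  have := hK _ _ _ _ (_ : 0 < rho / 2) hw _ (u - pr u).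
  rewrite (addrC (pr u)) subrK => h.
  have -> : k3 * delta s c Zc y ^+ a = K * M3 * (vn (u - pr u) / (rho / 2)) ^+ a.
    rewrite /k3 ger0_norm; last exact: M30 j.
    have -> : vn (u - pr u) / (rho / 2) = 2 / rho * vn (u - pr u) by field; rewrite gt_eqF.
    by rewrite (exprMn a (2 / rho)) mulrA.
  apply: h.
  + by rewrite divr_gt0.
  + move=> sq sa; have := vpr j _ c ac c'p sq sa; rewrite e'p; apply.
    by rewrite pE; exact: line_param_L.
  + apply: (@lt_le_trans _ _ (2 * e)).
      apply: le_lt_trans (vn_tri u v0 (pr u)) _; rewrite (vn_sub v0) mulr_natl mulr2n; exact: ltrD.
    rewrite -/A /e; have -> : 2 * (rho / (8 * A)) = rho / 2 / A / 2 by field; rewrite gt_eqF.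
    by rewrite ler_pdivrMr // ler_peMr ?ler1n // divr_ge0 ?divr_ge0 // ltW.
Qed.

End Compare.

(** * Finitely many charts along the line *)

Section FiniteAtlas.
Variables (R : realType) (n : nat) (N : complexManifold R n).
Local Notation C := (Cplx R).
Variable iota : P1 R -> N.
Hypothesis hiota : P1_embedding iota.
Local Notation L := (range iota).
Local Notation line_param := (line_param iota).
Local Notation chartN := (chart N 'rV[C]_n).
Local Notation coord := ('rV[C]_n -> C).
Local Notation I := (bool * C)%type.

Lemma near_differentiable (V W : normedModType C) (g h : V -> W) (x : V) :
  (\forall y \near x, g y = h y) -> differentiable g x -> differentiable h x.
Proof.
move=> gh dg; have -> : h = g - (g - h) by apply/funext => y; rewrite !fctE opprB addrC subrK.
apply: differentiableB; first exact: dg.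
apply: (@flat_differentiable _ V W) => e e0.
have gx := nbhs_singleton gh.
have gh' : \forall y \near (0 : V), g (y + x) = h (y + x).
  have : (fun y : V => y + x) @ (0 : V) --> 0 + x by apply: cvgD; [exact: cvg_id|exact: cvg_cst].
  by rewrite add0r => /(_ _ gh).
apply: filterS gh' => y gy.
have -> : (g - h) (y + x) = 0 by rewrite -[LHS]/(g (y + x) - h (y + x)) gy subrr.
have -> : (g - h) x = 0 by rewrite -[LHS]/(g x - h x) gx subrr.
rewrite subr0 normr0; apply: mulr_ge0; last exact: normr_ge0.
by rewrite ler0c ltW.
Qed.

Lemma holomorphic_comp (g h : N -> N) : holomorphic g -> holomorphic h -> holomorphic (g \o h).
Proof.
move=> [cg dg] [ch dh]; split; first by move=> x; apply: continuous_comp; [exact: ch|exact: cg].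
move=> x c d ac ad cx dghx.
have [e ae ehx] := @atlas_cover R n N (h x).
apply: (@near_differentiable 'rV[C]_n 'rV[C]_n ((fwd d \o g \o bwd e) \o (fwd e \o h \o bwd c))).
  have : \forall y \near x, dom e (h y) by exact: (ch x _ (chart_near ehx)).
  move=> /(bwd_near cx)[r r0 hr]; apply/nbhs_vn; exists r => // v /hr[_ _ ev].
  have e2 : bwd e (fwd e (h (bwd c v))) = h (bwd c v) by exact: fwdK.
  by rewrite /= e2.
apply: (@differentiable_comp _ 'rV[C]_n 'rV[C]_n 'rV[C]_n); first exact: dh.
have e1 : bwd c (fwd c x) = x by exact: fwdK.
have -> : ((fwd e \o h) \o bwd c) (fwd c x) = fwd e (h x) by rewrite /= e1.
exact: dg.
Qed.

Lemma holomorphic_id : holomorphic (@id N).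
Proof. by split=> [x|x c d ac ad cx dx]; [exact: cvg_id|exact: chart_compat_diff]. Qed.

Lemma holomorphic_iter (g : N -> N) k : holomorphic g -> holomorphic (iter k g).
Proof.
move=> hg; elim: k => [|k ih]; first exact: holomorphic_id.
exact: (holomorphic_comp hg ih).
Qed.

(** Order of contact 1 for the identity lets [compare], with d = a = 1, treat changes of charts in
    the same way as the dynamics. *)
Lemma superattracting_id : transversally_superattracting (@id N) L 1.
Proof.
move=> eta chi Leta hchi van xi Lxi /= e; rewrite e; apply: filterS van => y hy Ly c ac cy [|//] _.
have e1 : bwd c (fwd c y) = y by exact: fwdK.
by rewrite /= e1 hy.
Qed.

(** [ldata_ex] produces charts for |z| <= 1; other indices receive the chart at 0, so that the
    family is total. *)
Definition clip (z : C) : C := if cabs z <= 1 then z else 0.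

(** A finite subcover of L. The quarter balls already cover, so a point in the quarter ball of a
    chart has a neighbourhood of definite size in the half ball. *)
Lemma finite_atlas : exists (lc : I -> chartN) (lP : I -> 'rV[C]_n) (lr : I -> R) (lZ : I -> coord) (D : seq I),
  (forall i, ldata iota i.1 (lc i) (lP i) (lr i) (lZ i)) /\
  (forall q, L q -> exists2 i, i \in D & cball (lc i) (lP i) (lr i / 4) q).
Proof.
have clip1 z : cabs (clip z) <= 1 by rewrite /clip; case: ifP => // _; rewrite cabs0.
have /choice[F hF] : forall i : I, exists d : chartN * 'rV[C]_n * R * coord,
   [/\ ldata iota i.1 d.1.1.1 d.1.1.2 d.1.2 d.2, dom d.1.1.1 (line_param i.1 (clip i.2)) & fwd d.1.1.1 (line_param i.1 (clip i.2)) = d.1.1.2].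
  by move=> i; have [c [P [r [Zc h]]]] := ldata_ex hiota i.1 (clip1 i.2); exists (c, P, r, Zc).
pose lc i := (F i).1.1.1; pose lP i := (F i).1.1.2; pose lr i := (F i).1.2; pose lZ i := (F i).2.
pose V i := cball (lc i) (lP i) (lr i / 4).
(* Lists ordered by inclusion: membership of a fixed index holds eventually, which puts the
   extraction of a finite subcover in the form of a near covering. *)
pose FF : set_system (seq I) := filter_from setT (fun D0 : seq I => [set D : seq I | {subset D0 <= D}]).
have FFF : Filter FF.
  apply: filter_from_filter; first by exists [::].
  move=> D1 D2 _ _; exists (D1 ++ D2) => // D h; split => j jD; apply: h; by rewrite mem_cat jD ?orbT.
have [] := proj1 (compact_near_coveringP L) (L_compact hiota) (seq I) FF (fun D x => exists2 i, i \in D & V i x) FFF.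
  move=> q /L_cover[s [z [z1 qz]]]; pose i : I := (s, z).
  have Viq : V i q.
    have [[_ r0 _ _ _] h1 h2] := hF i.
    have cz : clip i.2 = z by rewrite /clip /i /= z1.
    rewrite cz in h1 h2; split; first by rewrite qz.
    by rewrite qz [fwd _ _]h2 subrr vn0 divr_gt0.
  exists (V i, [set D : seq I | i \in D]) => /=.
    split; first by apply: open_nbhs_nbhs; split => //; exact: open_cball.
    by exists [:: i] => // D h; apply: h; rewrite mem_head.
  by move=> [x D] [/= Vx iD]; exists i.
move=> D0 _ hD; exists lc, lP, lr, lZ, D0; split; first by move=> i; case: (hF i).
by move=> q Lq; have := hD D0 (fun j h => h) q Lq.
Qed.

(** Where w is positive it is locally bounded below, and where it is zero O is a neighbourhood;
    [near_compact] makes the inverse of the bound uniform on A. *)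
Lemma tube (A : set N) (w : N -> R) (O : set N) : compact A ->
  (forall q, A q -> forall e : R, 0 < e -> \forall x \near q, `|w x - w q| < e) ->
  (forall q, A q -> 0 <= w q) -> open O -> (forall q, A q -> w q = 0 -> O q) ->
  exists2 e : R, 0 < e & forall x, A x -> w x <= e -> O x.
Proof.
move=> cA cw w0 oO AO.
have [||k [U [oU AU hU]]] := near_compact (Pr := fun k x => 0 < k /\ (k * w x <= 1 -> O x)) cA.
- move=> k k' x kk [k0 h]; have k'0 : 0 < k' by exact: lt_le_trans kk.
  split => // kx; apply: h; have [wx|wx] := leP 0 (w x).
    by apply: le_trans kx; rewrite ler_wpM2r.
  by rewrite (@le_trans _ _ 0) // pmulr_rle0 // ltW.
- move=> q Aq; have [wq|wq] := eqVneq (w q) 0.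
    exists 1; have : nbhs q O by apply: open_nbhs_nbhs; split => //; exact: AO.
    by apply: filterS => x Ox.
  have {}wq : 0 < w q by rewrite lt_neqAle eq_sym wq w0.
  have w2 : 0 < w q / 2 by rewrite divr_gt0.
  exists (3 / w q); apply: filterS (cw q Aq _ w2) => x hx; split; first by rewrite divr_gt0.
  rewrite mulrAC ler_pdivrMr // mul1r => h; exfalso.
  move: hx; rewrite ltr_norml => /andP[h1 _]; lra.
have [[x0 Ax0]|hn] := pselect (A !=set0).
  have k0 : 0 < k by case: (hU x0 (AU _ Ax0)).
  exists k^-1; first by rewrite invr_gt0.
  by move=> x Ax wx; apply: (proj2 (hU x (AU _ Ax))); rewrite mulrC -ler_pdivlMr // div1r.
by exists 1 => // x Ax; exfalso; apply: hn; exists x.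
Qed.

End FiniteAtlas.

(** * Uniform estimates near the line *)

Section ZetaArithmetic.
Variable R : realType.
Local Notation C := (Cplx R).
Implicit Types (z w : C) (s : bool).

(* The coordinate z in both cases, so that it is conjugate to z^b. *)
Definition zt (s : bool) (z : C) : C := if s then z else z^-1.

Lemma inv_sub1_le z t : cabs (z - 1) <= t -> t <= 1 / 2 -> z != 0 /\ cabs (z^-1 - 1) <= 2 * t.
Proof.
move=> h t2.
have z2 : 1 / 2 <= cabs z.
  have := cabsD (1 - z) z; rewrite subrK cabs1 cabs_sub; lra.
have z0 : z != 0 by rewrite -cabs_gt0; lra.
split => //; have -> : z^-1 - 1 = (1 - z) / z by rewrite mulrBl divff // div1r.
rewrite cabsM cabsV cabs_sub ler_pdivrMr ?cabs_gt0 //.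
have := cabs_ge0 (z - 1); nra.
Qed.

Lemma zt_ratio s s' z z' d K (dl e M : R) : z != 0 -> cabs z ^+ d <= M -> 0 <= K -> 0 <= dl ->
  0 <= e -> 1 <= M -> dl <= e * cabs z ^+ d -> K * (M * e) <= 1 / 2 ->
  cabs (if s == s' then z' - z ^+ d else z' * z ^+ d - 1) <= K * dl ->
  [/\ z' != 0, cabs (zt s' z' / zt s z ^+ d - 1) <= 2 * (K * (M * e))
    & (cabs z')^-1 <= if s == s' then 2 / cabs z ^+ d else 2 * M].
Proof.
move=> z0 zM K0 dl0 e0 M1 dle KM h.
have zd0 : z ^+ d != 0 by rewrite expf_neq0.
have zp : 0 < cabs z ^+ d by rewrite exprn_gt0 // cabs_gt0.
have Ke : K * e <= K * (M * e) by rewrite ler_wpM2l // ler_peMl.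
have dM : dl <= M * e by rewrite (le_trans dle) // mulrC ler_wpM2r.
have KdM : K * dl <= K * (M * e) by rewrite ler_wpM2l.
have [w [wE w1]] : exists w, z' = (if s == s' then w * z ^+ d else w / z ^+ d) /\ cabs (w - 1) <= K * (M * e).
  case: (s == s') h => h.
    exists (z' / z ^+ d); rewrite divfK //; split => //.
    have -> : z' / z ^+ d - 1 = (z' - z ^+ d) / z ^+ d by rewrite mulrBl divff.
    rewrite cabsM cabsV cabsX ler_pdivrMr //; apply: le_trans h _.
    apply: le_trans (ler_wpM2l K0 dle) _; rewrite mulrA.
    by apply: ler_wpM2r => //; exact: ltW.
  by exists (z' * z ^+ d); rewrite mulfK //; split => //; exact: le_trans h KdM.
have [w0 wi] := inv_sub1_le w1 KM.
have w2 : (cabs w)^-1 <= 2.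
  rewrite -cabsV; have := cabsD (w^-1 - 1) 1; rewrite subrK cabs1; lra.
have w1' : cabs (w - 1) <= 2 * (K * (M * e)) by have := cabs_ge0 (w - 1); lra.
rewrite wE; case: (eqVneq s s') => [ss|ss].
  split; first by rewrite mulf_neq0.
    rewrite -ss; case: (s) => /=; first by rewrite mulfK.
    by rewrite exprVn invfM invrK mulfVK.
  rewrite cabsM invfM cabsX mulrC [in X in _ <= X]mulrC.
  by apply: ler_wpM2l => //; rewrite invr_ge0 ltW.
have -> : s' = ~~ s by move: ss; case: (s); case: (s').
split; first by rewrite mulf_neq0 // invr_eq0.
  case: (s) => /=; first by rewrite invfM invrK mulfK.
  by rewrite exprVn invrK mulfVK.
rewrite cabsM cabsV invfM invrK cabsX; apply: ler_pM => //; first by rewrite invr_ge0 cabs_ge0.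
exact: ltW.
Qed.

(* The condition a >= b is used here. *)
Lemma excess_step (b a : nat) (K dl dl' e M r ri : R) (same : bool) : (2 <= b)%N -> (b <= a)%N ->
  0 <= K -> 1 <= M -> 0 < r -> 0 <= dl <= 1 -> dl = e * r -> 0 <= e -> r <= M -> 0 <= ri ->
  0 <= dl' -> dl' <= K * dl ^+ a -> ri <= (if same then 2 / r else 2 * M) -> e <= 1 ->
  dl' * ri ^+ b <= K * (2 * M) ^+ b * M ^+ 2 * e ^+ 2.
Proof.
move=> b2 ba K0 M1 r0 /andP[dl0 dl1] dlE e0 rM ri0 dl'0 h hri e1.
have M0 : 0 < M by lra.
have r1 : dl ^+ a <= dl ^+ b.
  rewrite -(subnK ba) exprD ler_piMl ?exprn_ge0 //; exact: exprn_ile1.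
have e2 : e ^+ b <= e ^+ 2.
  rewrite -(subnK b2) exprD ler_piMl ?exprn_ge0 //; exact: exprn_ile1.
have rib : ri ^+ b <= (if same then 2 / r else 2 * M) ^+ b.
  apply: lerXn2r => //; rewrite nnegrE //; case: (same); first by rewrite divr_ge0 // ltW.
  by rewrite mulr_ge0 // ltW.
have M2 : 1 <= M ^+ 2 by exact: exprn_ege1.
have main : dl' * ri ^+ b <= K * dl ^+ a * (if same then 2 / r else 2 * M) ^+ b.
  by apply: ler_pM => //; exact: exprn_ge0.
apply: le_trans main _; rewrite -mulrA.
have -> : K * (2 * M) ^+ b * M ^+ 2 * e ^+ 2 = K * ((2 * M) ^+ b * (M ^+ 2 * e ^+ 2)) by ring.
apply: ler_wpM2l => //.
(* For equal types dl^b * (2 / r)^b = (2 * e)^b, with r standing for |z|^b. Otherwise 1 / |z'| is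
   bounded and dl^2 = (e * r)^2 is enough. *)
case: (same).
  have -> : (2 * M) ^+ b * (M ^+ 2 * e ^+ 2) = e ^+ 2 * (2 ^+ b) * (M ^+ b * M ^+ 2).
    by rewrite exprMn; ring.
  have Mb : 1 <= M ^+ b * M ^+ 2 by rewrite -exprD; exact: exprn_ege1.
  apply: (@le_trans _ _ (e ^+ b * 2 ^+ b)).
    have -> : e ^+ b * 2 ^+ b = dl ^+ b * (2 / r) ^+ b.
      by rewrite dlE -!exprMn; congr (_ ^+ _); field; rewrite gt_eqF.
    by apply: ler_wpM2r => //; rewrite exprn_ge0 // divr_ge0 // ltW.
  apply: (@le_trans _ _ (e ^+ 2 * 2 ^+ b)); first by apply: ler_wpM2r => //; exact: exprn_ge0.
  by apply: ler_peMr => //; rewrite mulr_ge0 ?exprn_ge0.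
rewrite mulrC; apply: ler_wpM2l; first by rewrite exprn_ge0 // mulr_ge0 // ltW.
apply: (@le_trans _ _ (dl ^+ 2)).
  rewrite -(subnK (leq_trans b2 ba)) exprD ler_piMl ?exprn_ge0 //; exact: exprn_ile1.
rewrite -exprMn; apply: lerXn2r => //; rewrite ?nnegrE //; first by rewrite mulr_ge0 // ltW.
by rewrite dlE mulrC; apply: ler_wpM2r.
Qed.

End ZetaArithmetic.

Section UniformComparison.
Variables (R : realType) (n : nat) (N : complexManifold R n).
Local Notation C := (Cplx R).
Variable iota : P1 R -> N.
Hypothesis hiota : P1_embedding iota.
Local Notation L := (range iota).
Local Notation line_param := (line_param iota).
Local Notation chartN := (chart N 'rV[C]_n).
Local Notation coord := ('rV[C]_n -> C).
Local Notation I := (bool * C)%type.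
Variables (lc : I -> chartN) (lP : I -> 'rV[C]_n) (lr : I -> R) (lZ : I -> coord) (D : seq I).
Hypothesis hl : forall i, ldata iota i.1 (lc i) (lP i) (lr i) (lZ i).

Definition lV (i : I) (t : R) : set N := cball (lc i) (lP i) (lr i / t).

Lemma closed_lball i : closed [set x | dom (lc i) x /\ vn (fwd (lc i) x - lP i) <= lr i / 2].
Proof.
have [_ r0 gb _ _] := hl i; apply: compact_closed; first exact: manifold_hausdorff.
apply: compact_cball gb _; rewrite divr_ge0 ?ltW //=; lra.
Qed.

(** The closed half ball is closed in N, so a point outside the full ball has a neighbourhood free
    of the half ball. *)
Lemma notin_lV i q : ~ cball (lc i) (lP i) (lr i) q -> \forall x \near q, ~ lV i 2 x.
Proof.
move=> nq; have [_ r0 _ _ _] := hl i.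
have : nbhs q (~` [set x | dom (lc i) x /\ vn (fwd (lc i) x - lP i) <= lr i / 2]).
  apply: open_nbhs_nbhs; split; first by apply: closed_openC; exact: closed_lball.
  move=> [cq h]; apply: nq; split => //; apply: le_lt_trans h _; lra.
by apply: filterS => x h [cx hx]; apply: h; split => //; exact: ltW.
Qed.

(** [compare] applies near q to the pairs of charts whose full balls contain q and g q; for the
    other pairs the half balls are avoided near q and the claim is void there. Compactness of L then
    gives one constant. *)
Lemma uniform_cmp (g : N -> N) (d a : nat) : holomorphic g ->
  (forall s z, g (line_param s z) = line_param s (z ^+ d)) -> transversally_superattracting g L a ->
  exists k, exists O : set N, [/\ open O, L `<=` O & forall x : N, O x -> forall i j : I, i \in D -> j \in D ->
    lV i 2 x -> lV j 2 (g x) ->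
    cmp_near iota i.1 (lc i) (lP i) (lr i) (lZ i) j.1 (lc j) (lP j) (lr j) (lZ j) g d a k x].
Proof.
move=> hg ghh gsa.
pose DD : seq (I * I) := [seq (i, j) | i <- D, j <- D].
pose Q (t : I * I) k x := lV t.1 2 x -> lV t.2 2 (g x) ->
  cmp_near iota t.1.1 (lc t.1) (lP t.1) (lr t.1) (lZ t.1) t.2.1 (lc t.2) (lP t.2) (lr t.2) (lZ t.2) g d a k x.
have Qmono t k k' x : k <= k' -> Q t k x -> Q t k' x.
  by move=> kk h h1 h2; apply: cmp_near_mono kk _; exact: h.
have [||k [U [oU LU hU]]] := near_compact (Pr := fun k x => forall t, t \in DD -> Q t k x) (L_compact hiota).
- by move=> k k' x kk h t tD; apply: Qmono kk _; exact: h.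
- move=> q Lq; apply: near_finite => [t k k' x|t tD]; first exact: Qmono.
  have [h1|h1] := pselect (cball (lc t.1) (lP t.1) (lr t.1) q); last first.
    by exists 0; apply: filterS (notin_lV h1) => x nx h; exfalso; exact: nx.
  have [h2|h2] := pselect (cball (lc t.2) (lP t.2) (lr t.2) (g q)); last first.
    have [cg _] := hg; have h3 : \forall x \near q, ~ lV t.2 2 (g x) by exact: (cg q _ (notin_lV h2)).
    by exists 0; apply: filterS h3 => x nx _ h; exfalso; exact: nx.
  have [k hk] := compare hiota hg ghh gsa (hl t.1) (hl t.2) Lq h1 h2.
  by exists k; apply: filterS hk => x h [cx _] _; exact: h.
exists k, U; split => // x Ux i j iD jD; apply: (hU x Ux (i, j)).
by apply/allpairsP; exists (i, j).
Qed.

Lemma uniform_min (A : I -> R -> Prop) : (forall i e e', 0 < e' -> e' <= e -> A i e -> A i e') ->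
  (forall i, i \in D -> exists2 e, 0 < e & A i e) -> exists2 e, 0 < e & forall i, i \in D -> A i e.
Proof.
move=> mono; elim: D => [|i s ih] h; first by exists 1.
have [e1 e10 h1] := h i (mem_head _ _).
have [|e2 e20 h2] := ih; first by move=> j js; apply: h; rewrite inE js orbT.
have e0 : 0 < Num.min e1 e2 by rewrite lt_min e10.
exists (Num.min e1 e2) => // j; rewrite inE => /orP[/eqP ->|js].
  by apply: mono h1 => //; rewrite ge_min lexx.
by apply: mono (h2 j js) => //; rewrite ge_min lexx orbT.
Qed.

Variables (f : N -> N) (b a : nat).
Hypothesis fH : holomorphic f.
Hypothesis fhh : forall s z, f (line_param s z) = line_param s (z ^+ b).
Hypothesis fsa : transversally_superattracting f L a.
Hypothesis b2 : (2 <= b)%N.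
Hypothesis ba : (b <= a)%N.
Hypothesis Dcover : forall q, L q -> exists2 i, i \in D & lV i 4 q.

Definition lz (i : I) (x : N) : C := zco (lc i) (lZ i) x.
Definition ldl (i : I) (x : N) : R := delta iota i.1 (lc i) (lZ i) x.
Definition lzt (i : I) (x : N) : C := zt i.1 (lz i x).
(* Dividing by |z|^b makes the estimates uniform near the superattracting points
   0 and oo of P^1. *)
Definition excess (i : I) (x : N) : R := ldl i x / cabs (lz i x) ^+ b.
Definition lgood (eps : R) (i : I) (x : N) := [/\ i \in D, lV i 2 x, lz i x != 0 & excess i x < eps].

Lemma excess_ge0 i x : 0 <= excess i x.
Proof. by rewrite divr_ge0 ?delta_ge0 ?exprn_ge0 ?cabs_ge0. Qed.

Lemma lV_ball i t x : 1 <= t -> lV i t x -> cball (lc i) (lP i) (lr i) x.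
Proof.
move=> t1; apply: cball_sub; have [_ r0 _ _ _] := hl i.
by rewrite ler_pdivrMr ?(lt_le_trans ltr01) // ler_peMr // ltW.
Qed.

Lemma lz_le2 i x : cball (lc i) (lP i) (lr i) x -> cabs (lz i x) <= 2.
Proof. by move=> [cx xr]; have [_ _ _ hZ _] := hl i; have [] := hZ _ xr. Qed.

Lemma ldl0_L i x : cball (lc i) (lP i) (lr i) x -> ldl i x = 0 -> x = line_param i.1 (lz i x).
Proof.
move=> [cx xr]; have [_ _ _ hZ _] := hl i; have [_ _ cZ] := hZ _ xr.
move/eqP; rewrite vn_eq0 subr_eq0 => /eqP e; have := congr1 (bwd (lc i)) e.
have e1 : bwd (lc i) (fwd (lc i) x) = x by exact: fwdK.
have e2 : bwd (lc i) (fwd (lc i) (line_param i.1 (lz i x))) = line_param i.1 (lz i x) by exact: fwdK.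
by rewrite e1 e2.
Qed.

Lemma lz_continuous i x : cball (lc i) (lP i) (lr i) x -> {for x, continuous (lz i)}.
Proof.
move=> [cx xr]; have [_ _ _ hZ _] := hl i; have [dZ _ _] := hZ _ xr.
apply: (@continuous_comp _ _ _ (fwd (lc i)) (lZ i)); first exact: fwd_cont.
exact: differentiable_continuous dZ.
Qed.

Lemma ldl_near i x e : cball (lc i) (lP i) (lr i) x -> 0 < e -> \forall y \near x, `|ldl i y - ldl i x| < e.
Proof.
move=> hx e0; have [cx xr] := hx; have [_ _ _ hZ _] := hl i; have [dZ _ cZ] := hZ _ xr.
have e2 : 0 < e / 2 by rewrite divr_gt0.
have h1 := fwd_near cx e2.
have h2 : \forall y \near x, vn (fwd (lc i) (line_param i.1 (lz i y)) - fwd (lc i) (line_param i.1 (lz i x))) < e / 2.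
  have hc : {for x, continuous (line_param i.1 \o lz i)}.
    by apply: continuous_comp; [exact: lz_continuous|exact: line_param_cont].
  have h : \forall y \near x, dom (lc i) (line_param i.1 (lz i y)) /\
    vn (fwd (lc i) (line_param i.1 (lz i y)) - fwd (lc i) (line_param i.1 (lz i x))) < e / 2 by exact: (hc _ (fwd_near cZ e2)).
  by apply: filterS h => y [].
apply: filterS2 h1 h2 => y [_ y1] y2; rewrite /ldl /delta -!/(lz i _).
have vD (u v : 'rV[C]_n) : `|vn u - vn v| <= vn (u - v).
  rewrite ler_norml lerBlDr; apply/andP; split.
    have := vnD (v - u) u; rewrite subrK (vn_sub v); lra.
  by have := vnD (u - v) v; rewrite subrK.
apply: le_lt_trans (vD _ _) _.
set A := fwd _ y; set A' := fwd _ x; set B := fwd _ (line_param i.1 (lz i y)); set B' := fwd _ (line_param i.1 (lz i x)).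
have -> : A - B - (A' - B') = (A - A') - (B - B') by apply/rowP => m; rewrite !mxE; ring.
by rewrite (splitr e); apply: le_lt_trans (vnD _ _) _; rewrite vnN; exact: ltrD.
Qed.

Lemma in_tube (O : set N) (w : I -> N -> R) : open O ->
  (forall i q, cball (lc i) (lP i) (lr i) q -> forall e : R, 0 < e -> \forall x \near q, `|w i x - w i q| < e) ->
  (forall i q, 0 <= w i q) -> (forall i q, cball (lc i) (lP i) (lr i) q -> w i q = 0 -> O q) ->
  exists2 e : R, 0 < e & forall i, i \in D -> forall x, lV i 2 x -> w i x <= e -> O x.
Proof.
move=> oO cw w0 wO.
apply: (@uniform_min (fun i e => forall x, lV i 2 x -> w i x <= e -> O x)).
  by move=> i e e' e'0 ee h x xV wx; apply: h xV _; exact: le_trans ee.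
move=> i _; have [_ r0 gb _ _] := hl i.
have sub q : dom (lc i) q /\ vn (fwd (lc i) q - lP i) <= lr i / 2 -> cball (lc i) (lP i) (lr i) q.
  by move=> [cq h]; split => //; apply: le_lt_trans h _; lra.
have cA : compact [set x | dom (lc i) x /\ vn (fwd (lc i) x - lP i) <= lr i / 2].
  by apply: compact_cball gb _; rewrite divr_ge0 ?ltW //=; lra.
have [||||e e0 he] := @tube _ _ N _ (w i) O cA.
- by move=> q /sub; exact: cw.
- by move=> q _; exact: w0.
- exact: oO.
- by move=> q /sub; exact: wO.
exists e => // x [cx xr]; apply: he; split => //; exact: ltW.
Qed.

(** Collects with one constant [k1] what the rest uses: a quarter ball containing the image, one
    step of the dynamics, a change of chart, and the spreading of nearby points. The condition on
    [eps] turns the quadratic estimate of the excess into a contraction by 1 / (2 * k1). *)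
Lemma step_data : exists k1 eps : R, [/\ 1 <= k1, 0 < eps, eps * k1 <= (2 * k1)^-1 &
  forall i x, lgood eps i x -> [/\
    exists2 j, j \in D & lV j 4 (f x),
    forall j, j \in D -> lV j 2 (f x) -> [/\ lz j (f x) != 0,
      cabs (lzt j (f x) / lzt i x ^+ b - 1) <= k1 * excess i x & excess j (f x) <= k1 * excess i x ^+ 2],
    forall j, j \in D -> lV j 2 x -> lz j x != 0 /\ cabs (lzt j x / lzt i x - 1) <= k1 * excess i x
    & forall j, j \in D -> lV j 4 (f x) -> forall y, dom (lc i) y ->
        vn (fwd (lc i) y - fwd (lc i) x) < k1^-1 ->
        lV j 2 (f y) /\ vn (fwd (lc j) (f y) - fwd (lc j) (f x)) <= k1 * vn (fwd (lc i) y - fwd (lc i) x)]].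
Proof.
have [kf [U1 [oU1 LU1 hU1]]] := uniform_cmp fH fhh fsa.
have idhh s z : id (line_param s z) = line_param s (z ^+ 1) by [].
have [ki [U2 [oU2 LU2 hU2]]] := uniform_cmp (@holomorphic_id R n N) idhh (superattracting_id (iota := iota)).
pose k0 := Num.max 1 (Num.max kf ki).
have k01 : 1 <= k0 by rewrite le_max lexx.
have kf0 : kf <= k0 by rewrite !le_max lexx !orbT.
have ki0 : ki <= k0 by rewrite !le_max lexx !orbT.
pose W4 : set N := \bigcup_(i in [set i | i \in D]) lV i 4.
have oW4 : open W4 by apply: bigcup_open => i _; exact: open_cball.
have LW4 : L `<=` W4 by move=> q /Dcover[i iD qi]; exists i.
have [cf _] := fH.
pose O := U1 `&` U2 `&` (f @^-1` (W4 `&` U1)).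
have oO : open O.
  apply: openI; first exact: openI.
  by apply: open_comp; [move=> x _; exact: cf|exact: openI].
have LO : L `<=` O.
  move=> q Lq; have Lfq : L (f q).
    by have [s [z [_ ->]]] := L_cover Lq; rewrite fhh; exact: line_param_L.
  by split; [split; [exact: LU1|exact: LU2]|split; [exact: LW4|exact: LU1]].
have [|||et et0 het] := @in_tube O ldl oO.
- by move=> i q qV e e0; exact: (ldl_near qV e0).
- by move=> i q; exact: delta_ge0.
- by move=> i q qV q0; apply: LO; rewrite (ldl0_L qV q0); exact: line_param_L.
have [rm rm0 hrm] : exists2 e, 0 < e & forall i, i \in D -> e <= lr i / 4.
  apply: (@uniform_min (fun i e => e <= lr i / 4)); first by move=> i e e' _; exact: le_trans.
  by move=> i _; have [_ r0 _ _ _] := hl i; exists (lr i / 4) => //; rewrite divr_gt0.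
pose M : R := 2 ^+ b.
have M1 : 1 <= M by apply: exprn_ege1; rewrite ler1n.
have M2 : 2 <= M by rewrite /M -(subnK (ltnW b2)) addn1 exprS ler_peMr // exprn_ege1 // ler1n.
have zM z : cabs z <= 2 -> cabs z ^+ b <= M /\ cabs z ^+ b <= M * cabs z.
  move=> z2; split; first by apply: lerXn2r; rewrite ?nnegrE ?cabs_ge0.
  rewrite -(subnK (ltnW b2)) addn1 exprSr; apply: ler_wpM2r; first exact: cabs_ge0.
  apply: (@le_trans _ _ (2 ^+ (b - 1))); first by apply: lerXn2r; rewrite ?nnegrE ?cabs_ge0.
  by rewrite /M; apply: ler_weXn2l; [rewrite ler1n|exact: leq_subr].
pose Mb : R := (2 * M) ^+ b.
have exs := excess_step (R := R) b2 ba (M := M); rewrite -/Mb in exs.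
have Mb1 : 1 <= Mb * M ^+ 2 by apply: mulr_ege1; apply: exprn_ege1; lra.
have k0p : 0 < k0 by lra.
have Mp : 0 < M by lra.
(* The terms serve, in this order, the two ratio estimates from [zt_ratio], the constant of
   [excess_step], and the condition that images move by less than rm, which keeps a point of a
   quarter ball in the half ball. *)
pose k1 := 4 * (k0 * M) + k0 * Mb * M ^+ 2 + k0 / rm.
have k0M : k0 <= k0 * M by rewrite ler_peMr // ltW.
have kMb : 0 <= k0 * Mb * M ^+ 2 by rewrite -mulrA mulr_ge0 // ltW // (lt_le_trans ltr01).
have krm : 0 < k0 / rm by rewrite divr_gt0.
have [k11 k1a k1b k1c] : [/\ 1 <= k1, 4 * (k0 * M) <= k1, k0 * Mb * M ^+ 2 <= k1 & k0 / rm <= k1].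
  by rewrite /k1; move: k01 k0M kMb krm; drop_order => *; split; lra.
have k1p : 0 < k1 by exact: lt_le_trans ltr01 k11.
have k1i : 0 < (2 * k1)^-1 / k1 by rewrite divr_gt0 // invr_gt0 mulr_gt0.
pose eps := Num.min ((2 * k1)^-1 / k1) (et / M).
have eps0 : 0 < eps by rewrite lt_min k1i divr_gt0.
have eps1 : eps * k1 <= (2 * k1)^-1.
  by rewrite -ler_pdivlMr // ge_min lexx.
have epst : M * eps <= et.
  by rewrite mulrC -ler_pdivlMr // ge_min lexx orbT.
have epsk : k1 * eps <= 1 / 2.
  rewrite mulrC; apply: le_trans eps1 _; rewrite invfM ler_pdivrMr // div1r; move: k11; drop_order; lra.
clearbody k0 k1 M Mb eps.
exists k1, eps; split => // i x [iD xV z0 xe].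
have e0 := excess_ge0 i x.
set e := excess i x in xe e0 *.
have xB : cball (lc i) (lP i) (lr i) x by apply: lV_ball xV; rewrite ler1n.
have z2 := lz_le2 xB.
have zb0 : 0 < cabs (lz i x) ^+ b by rewrite exprn_gt0 // cabs_gt0.
have [zbM zbz] := zM _ z2.
have dE : ldl i x = e * cabs (lz i x) ^+ b by rewrite /e /excess divfK // gt_eqF.
have dl0 : 0 <= ldl i x by exact: delta_ge0.
have k0M0 : 0 <= k0 * M by rewrite mulr_ge0 // ltW.
have e1 : e <= 1.
  have : k1 * e <= 1 / 2 by apply: le_trans epsk; rewrite ler_wpM2l // ltW.
  have : e <= k1 * e by rewrite ler_peMl.
  drop_order; lra.
have k1e : k1 * e <= 1 / 2 by apply: le_trans epsk; rewrite ler_wpM2l // ltW.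
have kMe : 4 * (k0 * M) * e <= k1 * e by rewrite ler_wpM2r.
have dle : ldl i x <= M * e by rewrite dE mulrC ler_wpM2r.
have dl1 : ldl i x <= 1.
  have : M * e <= k0 * M * e by rewrite -mulrA ler_peMl // mulr_ge0 // ltW.
  move: dle kMe k1e; rewrite -!mulrA; drop_order; lra.
have Ox : O x.
  apply: (het i iD x xV); apply: le_trans dle _; apply: le_trans epst; apply: ler_wpM2l; exact: ltW.
have [[U1x U2x] [W4fx U1fx]] := Ox.
split.
- by have [j jD jV] := W4fx; exists j.
- move=> j jD jV; have [kf1 hkf] := hU1 x U1x i j iD jD xV jV.
  have [cx _] := xB.
  have [|_ _ h3 h4] := hkf x cx; first by rewrite subrr vn0 invr_gt0.
  have {}h3 := le_trans h3 (ler_wpM2r dl0 kf0).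
  have {}h4 := le_trans h4 (ler_wpM2r (exprn_ge0 a dl0) kf0).
  have kMe2 : k0 * (M * e) <= 1 / 2 by rewrite mulrA; move: kMe k1e; have := mulr_ge0 k0M0 e0; rewrite -!mulrA; drop_order; lra.
  have dE' : ldl i x <= e * cabs (lz i x) ^+ b by rewrite -dE.
  have [zj0 r1 r2] := zt_ratio z0 zbM (ltW k0p) dl0 e0 M1 dE' kMe2 h3.
  split; first exact: zj0.
  + by apply: le_trans r1 _; rewrite mulrA; have := mulr_ge0 k0M0 e0; move: kMe; rewrite -!mulrA; drop_order; lra.
  + have ri0 : 0 <= (cabs (lz j (f x)))^-1 by rewrite invr_ge0 cabs_ge0.
    have dl01 : 0 <= ldl i x <= 1 by rewrite dl0.
    have := exs _ _ _ _ _ _ _ (ltW k0p) M1 zb0 dl01 dE e0 zbM ri0 (delta_ge0 _ _ _ _ _) h4 r2 e1.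
    rewrite exprVn => /le_trans; apply; apply: ler_wpM2r => //; exact: exprn_ge0.
- move=> j jD jV; have [ki1 hki] := hU2 x U2x i j iD jD xV jV.
  have [cx _] := xB.
  have [|_ _ h3 _] := hki x cx; first by rewrite subrr vn0 invr_gt0.
  have {}h3 := le_trans h3 (ler_wpM2r dl0 ki0).
  have Me0 : 0 <= M * e by rewrite mulr_ge0 // ltW.
  have z1 : cabs (lz i x) ^+ 1 <= 2 by rewrite expr1.
  (* A change of chart compares with |z|, the excess with |z|^b; the factor M = 2^b bridges them
     because |z| <= 2. *)
  have dle1 : ldl i x <= M * e * cabs (lz i x) ^+ 1.
    by rewrite expr1 dE [M * e]mulrC -[e * M * _]mulrA; apply: ler_wpM2l.
  have k2 : k0 * (2 * (M * e)) <= 1 / 2.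
    by have := mulr_ge0 (ltW k0p) Me0; move: kMe k1e; rewrite -!mulrA; drop_order; lra.
  have [zj0 r1 _] := zt_ratio z0 z1 (ltW k0p) dl0 Me0 (ler1n _ _) dle1 k2 h3.
  split; first exact: zj0.
  by rewrite -[lzt i x]expr1; apply: le_trans r1 _; have := mulr_ge0 (ltW k0p) Me0; move: kMe; rewrite -!mulrA; drop_order; lra.
- move=> j jD jV y cy yx.
  have jV2 : lV j 2 (f x).
    apply: cball_sub jV; have [_ r0 _ _ _] := hl j; move: r0; drop_order; lra.
  have [kf1 hkf] := hU1 x U1x i j iD jD xV jV2.
  have [|h1 h2 _ _] := hkf y cy.
    by apply: lt_le_trans yx _; rewrite lef_pV2 ?posrE //; move: kf0 k0M k1a k0M0; drop_order; lra.
  have {}h2 := le_trans h2 (ler_wpM2r (vn_ge0 _) kf0).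
  split; last by apply: le_trans h2 _; rewrite ler_wpM2r ?vn_ge0 //; move: k0M k1a k0M0; drop_order; lra.
  have [cfy _] := h1; split => //.
  have rj := hrm j jD.
  have : k0 * vn (fwd (lc i) y - fwd (lc i) x) < rm.
    rewrite mulrC -ltr_pdivlMr //; apply: lt_le_trans yx _.
    by rewrite -[rm / k0]invf_div lef_pV2 ?posrE.
  have [_ fxr] := jV; have := vn_tri (fwd (lc j) (f y)) (fwd (lc j) (f x)) (lP j).
  move: h2 rj fxr; drop_order; lra.
Qed.

End UniformComparison.

(** * Straightening a holomorphic coordinate *)

Section Realification.
Variables (R : realType) (n : nat).
Local Notation C := (Cplx R).
Implicit Types (v w : 'rV[C]_n) (x y : 'rV[R]_(n + n)).

Lemma real_row_entry_le m (x : 'rV[R]_m) j : `|x 0 j| <= `|x|.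
Proof. by have := @mx_normrE R 1 m x; rewrite /Num.norm /= => ->; rewrite (bigD1 (0, j)) //= le_max lexx. Qed.

Lemma real_row_le m (x : 'rV[R]_m) r : 0 <= r -> (forall j, `|x 0 j| <= r) -> `|x| <= r.
Proof.
move=> r0 h; have := @mx_normrE R 1 m x; rewrite {2}/Num.norm /= => ->.
by apply/bigmax_leP; split => // -[i j] _ /=; rewrite ord1.
Qed.

Lemma realify_lshift v j : realify v 0 (lshift n j) = complex.Re (v 0 j).
Proof. by rewrite /realify row_mxEl mxE. Qed.

Lemma realify_rshift v j : realify v 0 (rshift n j) = complex.Im (v 0 j).
Proof. by rewrite /realify row_mxEr mxE. Qed.

Lemma realifyK v : complexify (realify v) = v.
Proof.
by apply/rowP => j; rewrite mxE realify_lshift realify_rshift; case: (v 0 j).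
Qed.

Lemma complexifyK x : realify (complexify x) = x.
Proof.
apply/rowP => j; case: (split_ordP j) => k ->.
  by rewrite realify_lshift mxE.
by rewrite realify_rshift mxE.
Qed.

Lemma realify_dist v w : `|realify v - realify w| <= vn (v - w).
Proof.
apply: real_row_le => [|j]; first exact: vn_ge0.
case: (split_ordP j) => k ->; rewrite [(realify v - realify w) 0 _]mxE [(- realify w) 0 _]mxE.
  rewrite !realify_lshift -ReN -ReD; apply: le_trans (Re_le_cabs _) _.
  by have := cabs_le_vn (v - w) k; rewrite !mxE.
rewrite !realify_rshift -ImN -ImD; apply: le_trans (Im_le_cabs _) _.
by have := cabs_le_vn (v - w) k; rewrite !mxE.
Qed.

Lemma complexify_dist x y : vn (complexify x - complexify y) <= 2 * `|x - y|.
Proof.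
apply: vn_le => [|j]; first by rewrite mulr_ge0.
apply: le_trans (cabs_le_ReIm _) _; rewrite !mxE /= mulr_natl mulr2n; apply: lerD.
  by have := real_row_entry_le (x - y) (lshift n j); rewrite !mxE.
by have := real_row_entry_le (x - y) (rshift n j); rewrite !mxE.
Qed.

Lemma realify_continuous : continuous (@realify R n).
Proof.
move=> v; apply/(cvgrPdist_lt (FF := nbhs_filter v)) => e e0; apply/nbhs_vn; exists e => // w wv.
by apply: le_lt_trans (realify_dist _ _) _; rewrite vn_sub.
Qed.

Lemma complexify_continuous : continuous (@complexify R n).
Proof.
move=> x; apply/continuous_vn => e e0; have e2 : 0 < e / 2 by rewrite divr_gt0.
have h : \forall y \near x, `|x - y| < e / 2 by apply/nbhs_normP; exists (e / 2).
by apply: filterS h => y xy; apply: le_lt_trans (complexify_dist _ _) _; rewrite distrC mulrC -ltr_pdivlMr.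
Qed.

Lemma differentiable_row_entries (V : normedModType C) (F : V -> 'rV[C]_n) (p : V) :
  (forall j, differentiable (fun q : V => F q 0 j : C) p) -> differentiable F p.
Proof.
move=> h; have -> : F = \sum_(j < n) (fun v : V => (F v 0 j : C) *: (delta_mx 0 j : 'rV[C]_n)).
  by apply/funext => v; rewrite fct_sumE {1}[F v]row_sum_delta.
by apply: differentiable_sum => j; apply: differentiableZl; exact: h.
Qed.

Lemma real_analytic_row m (F : 'rV[R]_m -> 'rV[C]_n) p :
  (forall j, real_analytic_fun_at (fun q => complex.Re (F q 0 j)) p /\
             real_analytic_fun_at (fun q => complex.Im (F q 0 j)) p) ->
  real_analytic_at (fun q => realify (F q)) p.
Proof.
move=> h j; case: (split_ordP j) => k ->.
  have -> : (fun q => realify (F q) 0 (lshift n k)) = (fun q => complex.Re (F q 0 k)).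
    by apply/funext => q; rewrite realify_lshift.
  by case: (h k).
have -> : (fun q => realify (F q) 0 (rshift n k)) = (fun q => complex.Im (F q 0 k)).
  by apply/funext => q; rewrite realify_rshift.
by case: (h k).
Qed.

Lemma holomorphic_real_analytic (F : 'rV[C]_n -> 'rV[C]_n) (p : 'rV[C]_n) :
  (forall j, \forall v \near p, differentiable (fun u : 'rV[C]_n => F u 0 j : C) v) ->
  real_analytic_at (fun x => realify (F (complexify x))) (realify p).
Proof.
move=> h; apply: real_analytic_row => j; split.
  apply: (@holo_real_analytic _ _ (fun v => F v 0 j) p (@complex.Re R)) => //.
  - by move=> z w; rewrite ReD ReN.
  - by move=> z x; rewrite mulrC; case: z => a b /=; rewrite mul0r subr0 mulrC.
  - exact: Re_le_cabs.
apply: (@holo_real_analytic _ _ (fun v => F v 0 j) p (@complex.Im R)) => //.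
- by move=> z w; rewrite ImD ImN.
- by move=> z x; case: z => a b /=; rewrite mulr0 add0r.
- exact: Im_le_cabs.
Qed.

End Realification.

Section Straightening.
Variables (R : realType) (n : nat) (N : complexManifold R n).
Local Notation C := (Cplx R).

Definition ii : C := Complex 0 1.

Lemma Im_ii (z : C) : complex.Im (ii * z) = complex.Re z.
Proof. by case: z => a b /=; rewrite mul0r mul1r add0r. Qed.

Lemma ii_neq0 : ii != 0.
Proof. by rewrite eq_complex /= oner_eq0 andbF. Qed.

Definition swap_coords (m l : 'I_n) (v : 'rV[C]_n) : 'rV[C]_n := \row_j v 0 (tperm m l j).

Lemma swap_coordsK m l : involutive (swap_coords m l).
Proof. by move=> v; apply/rowP => j; rewrite !mxE tpermK. Qed.

Lemma differentiable_setc (V : normedModType C) (F : V -> 'rV[C]_n) (H : V -> C) m x :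
  differentiable F x -> differentiable H x -> differentiable (fun v => setc m (F v) (H v)) x.
Proof.
move=> dF dH; apply: differentiable_row_entries => j.
case: (eqVneq j m) => [->|jm].
  have -> : (fun v => setc m (F v) (H v) 0 m : C) = H by apply/funext => v; rewrite setc_i.
  exact: dH.
have -> : (fun v => setc m (F v) (H v) 0 j : C) = (fun v => F v 0 j).
  by apply/funext => v; rewrite mxE (negbTE jm).
exact: differentiable_entry.
Qed.

Lemma differentiable_idv v : differentiable (fun w : 'rV[C]_n => w) v.
Proof. by apply: differentiable_row_entries => j; exact: differentiable_coord. Qed.

Lemma differentiable_swap_coords m l v : differentiable (swap_coords m l) v.
Proof.
apply: differentiable_row_entries => j.
have -> : (fun v => swap_coords m l v 0 j : C) = (fun v => v 0 (tperm m l j)) by apply/funext => w; rewrite mxE.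
exact: differentiable_coord.
Qed.

(** Coordinate m is replaced by i * G and exchanged with the last one. In [realify], the real
    coordinate of index 2n - 1 is the imaginary part of the last complex coordinate, which is now Re
    G. Inverting the change of one coordinate gives a holomorphic inverse, so both transition maps
    are real analytic. *)
Lemma straighten (c : chart N 'rV[C]_n) (G : 'rV[C]_n -> C) (m : 'I_n) (x : N) (U : set N) :
  atlas c -> dom c x -> nbhs x U -> (\forall v \near fwd c x, differentiable G v) ->
  'D_(delta_mx 0 m) G (fwd c x) != 0 ->
  exists kappa : chart N 'rV[R]_(n + n),
    [/\ real_analytic_chart kappa, dom kappa x, dom kappa `<=` U
      & forall y, dom kappa y -> forall j : 'I_(n + n), (2 * n - 1 <= j)%N ->
          fwd kappa y 0 j = complex.Re (G (fwd c y))].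
Proof.
move=> ac cx xU dG DG.
pose G1 (v : 'rV[C]_n) : C := ii * G v.
have dG1 v : differentiable G v -> differentiable G1 v.
  by move=> d; exact: (@differentiableZ _ _ C G ii v d).
have dG1n : \forall v \near fwd c x, differentiable G1 v by apply: filterS dG => v; exact: dG1.
have DG1 : 'D_(delta_mx 0 m) G1 (fwd c x) != 0.
  have -> : 'D_(delta_mx 0 m) G1 (fwd c x) = ii * 'D_(delta_mx 0 m) G (fwd c x).
    have dx := nbhs_singleton dG.
    by rewrite -[RHS]/(ii *: _) -deriveZ //; apply: diff_derivable.
  by rewrite mulf_neq0 // ii_neq0.
have n0 : (0 < n)%N := leq_ltn_trans (leq0n m) (ltn_ord m).
have lP : (n.-1 < n)%N by rewrite prednK.
pose l : 'I_n := Ordinal lP.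
set p := fwd c x in dG dG1n DG DG1.
have [r [s [K [r0 s0 K1 K2 K3]]]] := inverse_coordinate dG1n DG1.
pose Phi v := setc m v (G1 v); pose Psi y := setc m y (K y).
pose q := Phi p; rewrite -/(Phi p) -/q in K1 K2 K3.
have PhiPsi y : vn (y - q) < s -> Phi (Psi y) = y.
  by move=> ys; have [_ e] := K1 y ys; rewrite /Phi [G1 _]e /Psi setc_set setc_id.
have PsiPhi v : vn (v - p) <= r -> vn (Phi v - q) < s -> Psi (Phi v) = v.
  by move=> vr vs; rewrite /Psi (K2 v vr vs) /Phi setc_set setc_id.
have Psiq : Psi q = p by apply: PsiPhi; rewrite subrr vn0 // ltW.
have dPsi y : vn (y - q) < s -> differentiable Psi y.
  by move=> ys; apply: differentiable_setc; [exact: differentiable_idv|exact: K3].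
have [r1 r10 hr1] := bwd_near cx xU.
have /nbhs_vn[r2 r20 hr2] := dG1n.
pose r3 := Num.min r (Num.min r1 r2).
have r30 : 0 < r3 by rewrite !lt_min r0 r10.
have r3r : r3 <= r by rewrite ge_min lexx.
have r31 : r3 <= r1 by rewrite !ge_min lexx !orbT.
have r32 : r3 <= r2 by rewrite !ge_min lexx !orbT.
have /continuous_vn /(_ r3 r30) /nbhs_vn[s1 s10 hs1] : {for q, continuous Psi}.
  by apply: differentiable_continuous; apply: dPsi; rewrite subrr vn0.
rewrite Psiq in hs1.
pose s2 := Num.min s s1.
have s20 : 0 < s2 by rewrite lt_min s0.
have s2s : s2 <= s by rewrite ge_min lexx.
have s2s1 : s2 <= s1 by rewrite ge_min lexx orbT.
(* The first bound keeps to points where [Phi] is holomorphic and inverted by [Psi]; the second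
   makes the image a full ball, up to the exchange of coordinates and [realify]. *)
pose dk : set N := [set y | [/\ dom c y, vn (fwd c y - p) < r3 & vn (Phi (fwd c y) - q) < s2]].
have dPhi v : vn (v - p) < r3 -> differentiable Phi v.
  move=> vr; apply: differentiable_setc; first exact: differentiable_idv.
  by apply: hr2; exact: lt_le_trans r32.
have cPhi y : dom c y -> vn (fwd c y - p) < r3 -> {for y, continuous (Phi \o fwd c)}.
  move=> cy yr; apply: (@continuous_comp _ _ _ (fwd c) Phi); first exact: fwd_cont.
  by apply: differentiable_continuous; exact: dPhi.
have oK : open dk.
  rewrite openE => y [cy yr ys].
  have e1 : 0 < r3 - vn (fwd c y - p) by rewrite subr_gt0.
  have e2 : 0 < s2 - vn (Phi (fwd c y) - q) by rewrite subr_gt0.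
  have h2 : \forall z \near y, vn (Phi (fwd c z) - Phi (fwd c y)) < s2 - vn (Phi (fwd c y) - q).
    by have /continuous_vn /(_ _ e2) := cPhi y cy yr.
  apply: filterS2 (fwd_near cy e1) h2 => z [cz zy] zs; split => //.
    by apply: le_lt_trans (vn_tri _ (fwd c y) _) _; rewrite -ltrBrDr.
  by apply: le_lt_trans (vn_tri _ (Phi (fwd c y)) _) _; rewrite -ltrBrDr.
pose fk y := realify (swap_coords m l (Phi (fwd c y))).
pose bk w := bwd c (Psi (swap_coords m l (complexify w))).
have ball_dk w : vn (w - q) < s2 -> dk (bwd c (Psi w)) /\ fwd c (bwd c (Psi w)) = Psi w.
  move=> ws; have wr := hs1 w (lt_le_trans ws s2s1).
  have [cw ew _] := hr1 _ (lt_le_trans wr r31).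
  by split => //; split; rewrite ?ew // PhiPsi //; exact: lt_le_trans s2s.
have fkE : fk @` dk = [set w | vn (swap_coords m l (complexify w) - q) < s2].
  apply/seteqP; split => [w [y [cy yr ys] <-]|w ws].
    by rewrite /fk /= realifyK swap_coordsK.
  have [h1 h2] := ball_dk _ ws; exists (bwd c (Psi (swap_coords m l (complexify w)))) => //.
  by rewrite /fk h2 PhiPsi ?swap_coordsK ?complexifyK //; exact: lt_le_trans s2s.
have cTp w : {for w, continuous (swap_coords m l \o @complexify R n)}.
  apply: (@continuous_comp _ _ _ (@complexify R n) (swap_coords m l)); first exact: complexify_continuous.
  by apply: differentiable_continuous; exact: differentiable_swap_coords.
have oIm : open (fk @` dk).
  rewrite fkE openE => w /= ws; have e2 : 0 < s2 - vn (swap_coords m l (complexify w) - q) by rewrite subr_gt0.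
  have /continuous_vn /(_ _ e2) := cTp w.
  by apply: filterS => u uw; apply: le_lt_trans (vn_tri _ (swap_coords m l (complexify w)) _) _; rewrite -ltrBrDr.
have fkK y : dk y -> bk (fk y) = y.
  move=> [cy yr ys]; rewrite /bk /fk realifyK swap_coordsK PsiPhi; first by exact: fwdK.
    exact: le_trans (ltW yr) r3r.
  exact: lt_le_trans s2s.
have fkC y : dk y -> {for y, continuous fk}.
  move=> [cy yr _].
  apply: (@continuous_comp _ _ _ (Phi \o fwd c) (@realify R n \o swap_coords m l)); first exact: cPhi.
  apply: (@continuous_comp _ _ _ (swap_coords m l) (@realify R n)); last exact: realify_continuous.
  by apply: differentiable_continuous; exact: differentiable_swap_coords.
have bPsi w : vn (w - q) < s2 -> {for w, continuous (bwd c \o Psi)}.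
  move=> ws; have [[cw _ _] ew] := ball_dk w ws.
  apply: (@continuous_comp _ _ _ Psi (bwd c)).
    by apply: differentiable_continuous; apply: dPsi; exact: lt_le_trans s2s.
  exact: bwd_continuous_at.
have bkC y : dk y -> {for fk y, continuous bk}.
  move=> [cy yr ys].
  apply: (@continuous_comp _ _ _ (swap_coords m l \o @complexify R n) (bwd c \o Psi)); first exact: cTp.
  by apply: bPsi; rewrite /fk /= realifyK swap_coordsK.
pose kappa := Chart oK oIm fkK fkC bkC.
exists kappa; split.
- move=> c' ac' y cy' ky; have [cy yr ys] := ky; split.
    have h : \forall v \near fwd c' y, [/\ dom c' (bwd c' v), fwd c' (bwd c' v) = v & dk (bwd c' v)].
      by apply/nbhs_vn; have [e e0 he] := bwd_near cy' (open_nbhs_nbhs (conj oK ky)); exists e.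
    apply: (@holomorphic_real_analytic R n (fun v => swap_coords m l (Phi (fwd c (bwd c' v))))) => j.
    apply: filterS h => v [cv ev [kv1 kv2 kv3]].
    have dch := chart_compat_diff ac' ac cv kv1; rewrite ev in dch.
    apply: differentiable_entry.
    apply: (@differentiable_comp _ 'rV[C]_n 'rV[C]_n 'rV[C]_n _ (swap_coords m l)); last exact: differentiable_swap_coords.
    apply: (@differentiable_comp _ 'rV[C]_n 'rV[C]_n 'rV[C]_n _ Phi); first exact: dch.
    exact: dPhi.
  pose w0 := swap_coords m l (Phi (fwd c y)).
  have w0s : vn (swap_coords m l w0 - q) < s2 by rewrite /w0 swap_coordsK.
  have y0E : bwd c (Psi (swap_coords m l w0)) = y by rewrite -[RHS](fkK y ky) /bk /fk realifyK.
  have h : \forall w \near w0, vn (swap_coords m l w - q) < s2 /\ dom c' (bwd c (Psi (swap_coords m l w))).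
    have e2 : 0 < s2 - vn (swap_coords m l w0 - q) by rewrite subr_gt0.
    have ct : {for w0, continuous (swap_coords m l)} by apply: differentiable_continuous; exact: differentiable_swap_coords.
    have h1 : \forall w \near w0, vn (swap_coords m l w - swap_coords m l w0) < s2 - vn (swap_coords m l w0 - q).
      by have /continuous_vn /(_ _ e2) := ct.
    have cb : {for w0, continuous ((bwd c \o Psi) \o swap_coords m l)}.
      by apply: (@continuous_comp _ _ _ (swap_coords m l) (bwd c \o Psi)); [exact: ct|exact: bPsi].
    have ny : nbhs (((bwd c \o Psi) \o swap_coords m l) w0) (dom c') by rewrite /= y0E; exact: chart_near.
    have h2 : \forall w \near w0, dom c' (bwd c (Psi (swap_coords m l w))) by exact: (cb _ ny).
    apply: filterS2 h1 h2 => w ws cw; split => //.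
    by apply: le_lt_trans (vn_tri _ (swap_coords m l w0) _) _; rewrite -ltrBrDr.
  apply: (@holomorphic_real_analytic R n (fun w => fwd c' (bwd c (Psi (swap_coords m l w))))) => j.
  apply: filterS h => w [ws cw'].
  have [[cw _ _] ew] := ball_dk _ ws.
  have dch := chart_compat_diff ac ac' cw cw'; rewrite ew in dch.
  apply: differentiable_entry.
  apply: (@differentiable_comp _ 'rV[C]_n 'rV[C]_n 'rV[C]_n (swap_coords m l) ((fwd c' \o bwd c) \o Psi)).
    exact: differentiable_swap_coords.
  apply: (@differentiable_comp _ 'rV[C]_n 'rV[C]_n 'rV[C]_n Psi (fwd c' \o bwd c)); last exact: dch.
  by apply: dPsi; exact: lt_le_trans s2s.
- by split; rewrite ?subrr ?vn0.
- move=> y [cy yr _]; have [_ _] := hr1 _ (lt_le_trans yr r31).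
  by have -> : bwd c (fwd c y) = y by exact: fwdK.
- move=> y _ j jn.
  have -> : j = rshift n l.
    apply: val_inj; apply/eqP; rewrite /= eqn_leq.
    move: jn; rewrite mul2n -addnn -addnBA // subn1 => ->; rewrite andbT.
    by rewrite -ltnS -addnS prednK.
  by rewrite [fwd _ _]/= /fk realify_rshift mxE tpermR setc_i Im_ii.
Qed.

End Straightening.

(** * The Boettcher coordinate and the stable manifold *)

Section LogCocycle.
Variable R : realType.
Local Notation C := (Cplx R).

Lemma cabs_dist (u v w : C) : cabs (u - w) <= cabs (u - v) + cabs (v - w).
Proof. by have := cabsD (u - v) (v - w); rewrite addrA subrK. Qed.

Lemma cabs_dist_half (u v w : C) (r e : R) : cabs (u - v) <= r -> cabs (w - v) <= r -> r <= e / 2 ->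
  cabs (u - w) <= e.
Proof. by rewrite (cabs_sub w) => h1 h2 h3; apply: le_trans (cabs_dist u v w) _; lra. Qed.

Lemma half_lt (t r : R) : 0 < r -> t <= r / 2 -> t < r.
Proof. lra. Qed.

Lemma Re_scale (x : R) (z : C) : complex.Re (x%:C * z) = x * complex.Re z.
Proof. by case: z => p q /=; rewrite mul0r subr0. Qed.

Lemma halving_le (A B c : R) : 0 <= A -> 2 * c <= 1 -> B - A + c * A <= B - c * A.
Proof. by move=> A0 c2; have := ler_wpM2r A0 c2; lra. Qed.

Lemma expc0 : expc (0 : C) = 1.
Proof. by rewrite /expc /= expR0 cis0 mulr1. Qed.

Lemma expcN (s : C) : expc (- s) = (expc s)^-1.
Proof.
have h : expc s * expc (- s) = 1 by rewrite -expcD subrr expc0.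
have s0 : expc s != 0 by rewrite -cabs_gt0 cabs_expc expR_gt0.
by apply: (mulfI s0); rewrite h divff.
Qed.

Lemma Log1 : Log (1 : C) = 0.
Proof. by rewrite -expc0 Log_expc //= normr0. Qed.

Lemma expc_Log_near (z : C) t b : (0 < b)%N -> cabs (z - 1) <= t -> 100 * b%:R * t <= 1 ->
  expc (Log z) = z /\ cabs (Log z) <= 6 * t.
Proof.
move=> b0 zt bt; have b1 : 1 <= b%:R :> R by rewrite ler1n.
have t0 : 0 <= t by apply: le_trans zt; exact: cabs_ge0.
have h : cabs (z - 1) <= 1 / 4.
  apply: le_trans zt _; have := ler_wpM2r t0 b1; move: bt; rewrite -mulrA; lra.
split; first by rewrite expc_Log //; exact: Re_near1_gt0.
by have := Log_le1 h; lra.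
Qed.

(** Each logarithm is at most 6 * t, so the right side has imaginary part at most 18 * b * t < 1,
    the range in which [Log] inverts [expc]. *)
Lemma Log_cocycle (rho d0 d1 : C) b t : (0 < b)%N -> 100 * b%:R * t <= 1 ->
  cabs (rho - 1) <= t -> cabs (d0 - 1) <= t -> cabs (d1 - 1) <= t ->
  Log (rho * d1 / d0 ^+ b) = Log rho + Log d1 - b%:R * Log d0.
Proof.
move=> b0 bt h hd0 hd1.
have [E L] := expc_Log_near b0 h bt; have [E0 L0] := expc_Log_near b0 hd0 bt; have [E1 L1] := expc_Log_near b0 hd1 bt.
rewrite -{1}E -{1}E0 -{1}E1 -expcMn -expcN -!expcD mulr_natl Log_expc //.
apply: le_trans (Im_le_cabs _) _; apply: le_trans (cabsB _ _) _.
rewrite -mulr_natl cabsM cabs_nat.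
have b1 : 1 <= b%:R :> R by rewrite ler1n.
have t0 : 0 <= t by apply: le_trans h; exact: cabs_ge0.
have := ler_wpM2l (ler0n _ b) L0; have := cabsD (Log rho) (Log d1); have := ler_wpM2r t0 b1.
lra.
Qed.

End LogCocycle.

(** * The logarithmic series and the local stable set *)

Section LogSeries.
Variables (R : realType) (n : nat) (N : complexManifold R n).
Local Notation C := (Cplx R).
Variable iota : P1 R -> N.
Hypothesis hiota : P1_embedding iota.
Local Notation L := (range iota).
Local Notation line_param := (line_param iota).
Local Notation chartN := (chart N 'rV[C]_n).
Local Notation coord := ('rV[C]_n -> C).
Local Notation I := (bool * C)%type.
Variables (lc : I -> chartN) (lP : I -> 'rV[C]_n) (lr : I -> R) (lZ : I -> coord) (D : seq I).
Hypothesis hl : forall i, ldata iota i.1 (lc i) (lP i) (lr i) (lZ i).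
Variables (f : N -> N) (b : nat).
Hypothesis fH : holomorphic f.
Hypothesis b2 : (2 <= b)%N.
Local Notation V := (lV lc lP lr).
Local Notation zo := (lz lc lZ).
Local Notation ze := (lzt lc lZ).
Local Notation exc := (excess iota lc lZ b).
Variables (k1 eps : R).
Local Notation good := (lgood iota lc lP lr lZ D b eps).
Hypothesis k11 : 1 <= k1.
Hypothesis eps0 : 0 < eps.
Hypothesis epsk : eps * k1 <= (2 * k1)^-1.
Hypothesis epsb : 100 * b%:R * (eps * k1) <= 1.
Hypothesis step_cover : forall i x, good i x -> exists2 j, j \in D & V j 4 (f x).
Hypothesis step_map : forall i x, good i x -> forall j, j \in D -> V j 2 (f x) ->
  [/\ zo j (f x) != 0, cabs (ze j (f x) / ze i x ^+ b - 1) <= k1 * exc i x & exc j (f x) <= k1 * exc i x ^+ 2].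
Hypothesis step_switch : forall i x, good i x -> forall j, j \in D -> V j 2 x ->
  zo j x != 0 /\ cabs (ze j x / ze i x - 1) <= k1 * exc i x.
Hypothesis step_lip : forall i x, good i x -> forall j, j \in D -> V j 4 (f x) -> forall y, dom (lc i) y ->
  vn (fwd (lc i) y - fwd (lc i) x) < k1^-1 ->
  V j 2 (f y) /\ vn (fwd (lc j) (f y) - fwd (lc j) (f x)) <= k1 * vn (fwd (lc i) y - fwd (lc i) x).

Local Notation th := ((2 * k1)^-1).
Local Notation cb := ((b%:R : R)^-1).

Lemma b1R : 2 <= b%:R :> R. Proof. by rewrite ler_nat. Qed.
Lemma bR0 : 0 < b%:R :> R. Proof. by rewrite ltr0n ltnW. Qed.
Lemma cb0 : 0 < cb. Proof. by rewrite invr_gt0 bR0. Qed.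
Lemma cb_half : 2 * cb <= 1. Proof. by rewrite ler_pdivrMr ?bR0 // mul1r b1R. Qed.
Lemma k1p : 0 < k1. Proof. exact: lt_le_trans ltr01 k11. Qed.
Lemma th0 : 0 < th. Proof. by rewrite invr_gt0 mulr_gt0 // k1p. Qed.
Lemma th1 : th <= 1. Proof. by rewrite invf_le1 ?mulr_gt0 ?k1p //; have := k11; lra. Qed.

Lemma exc0 i x : 0 <= exc i x. Proof. exact: excess_ge0. Qed.

Lemma ze_neq0 i x : (ze i x != 0) = (zo i x != 0).
Proof. by rewrite /lzt /zt; case: i.1; rewrite ?invr_eq0. Qed.

Lemma good_ze i x : good i x -> ze i x != 0.
Proof. by case=> _ _ h _; rewrite ze_neq0. Qed.

Lemma small_t i x : good i x -> 100 * b%:R * (k1 * exc i x) <= 1.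
Proof.
case=> _ _ _ xe; apply: le_trans epsb; apply: ler_wpM2l; first by rewrite mulr_ge0 ?ltW ?bR0.
by rewrite mulrC ler_wpM2r ?ltW ?k1p.
Qed.

Lemma good_map i x j : good i x -> j \in D -> V j 2 (f x) -> good j (f x) /\ exc j (f x) <= th * exc i x.
Proof.
move=> gx jD jV; have [z0 _ h] := step_map gx jD jV; have [_ _ _ xe] := gx.
have h2 : exc j (f x) <= th * exc i x.
  apply: le_trans h _; rewrite expr2 mulrA; apply: ler_wpM2r; first exact: exc0.
  by apply: le_trans epsk; rewrite mulrC; apply: ler_wpM2r; rewrite ltW ?k1p.
split => //; split => //; apply: le_lt_trans h2 _; apply: le_lt_trans xe.
by rewrite ler_piMl ?exc0 // th1.
Qed.

(** The choice depends on the point alone and not on its past, so the indices along the orbit of f x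
    are those of x shifted by one. The pair (true, 0) is a default value. *)
Definition next_index (y : N) : I := xget (true, 0) [set j | j \in D /\ V j 4 y].

Lemma next_indexP i x : good i x -> next_index (f x) \in D /\ V (next_index (f x)) 4 (f x).
Proof. by case/step_cover => j jD jV; apply: (@xgetPex _ (true, 0) [set j | j \in D /\ V j 4 (f x)]); exists j. Qed.

Lemma V42 j y : V j 4 y -> V j 2 y.
Proof. by apply: cball_sub; have [_ r0 _ _ _] := hl j; lra. Qed.

Definition orbit_index (i : I) (x : N) (l : nat) : I := if l is l'.+1 then next_index (iter l f x) else i.

(** A sequence of indices through which the orbit of x can be read up to time K. Arbitrary sequences
    are allowed because the indices chosen for one point must also serve for its neighbours. *)
Definition route (j : nat -> I) (x : N) (K : nat) :=
  good (j 0%N) x /\ forall l, (l <= K)%N -> j l \in D /\ V (j l) 2 (iter l f x).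

Lemma route_le j x K m : (K <= m)%N -> route j x m -> route j x K.
Proof. by move=> Km [g h]; split => // l lK; apply: h; exact: leq_trans Km. Qed.

Lemma route_good j x K : route j x K ->
  good (j K) (iter K f x) /\ exc (j K) (iter K f x) <= th ^+ K * exc (j 0%N) x.
Proof.
elim: K => [|K ih] h; first by have [g _] := h; rewrite expr0 mul1r.
have [g1 e1] := ih (route_le (leqnSn K) h).
have [_ /(_ K.+1 (leqnn _))[jD jV]] := h.
have [g2 e2] := good_map g1 jD jV; split => //; apply: le_trans e2 _.
by rewrite exprS -mulrA; apply: ler_wpM2l => //; rewrite ltW ?th0.
Qed.

Lemma orbit_index_good i x : good i x -> forall l, good (orbit_index i x l) (iter l f x) /\ (0 < l -> V (orbit_index i x l) 4 (iter l f x))%N.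
Proof.
move=> gx; elim => [|l [ih _]]; first by [].
have [jD jV] := next_indexP ih; split; last by [].
by have [] := good_map ih jD (V42 jV).
Qed.

Lemma orbit_index_route i x K : good i x -> route (orbit_index i x) x K.
Proof. by move=> gx; split => // l _; have [[? ? _ _] _] := orbit_index_good gx l. Qed.

Definition step_ratio (j : nat -> I) (x : N) (l : nat) : C :=
  ze (j l.+1) (iter l.+1 f x) / ze (j l) (iter l f x) ^+ b.

Definition log_series (j : nat -> I) (x : N) (K : nat) : C :=
  \sum_(l < K) (cb ^+ l.+1)%:C * Log (step_ratio j x l).

Lemma log_seriesS j x K : log_series j x K.+1 = log_series j x K + (cb ^+ K.+1)%:C * Log (step_ratio j x K).
Proof. by rewrite /log_series big_ord_recr. Qed.

Lemma step_ratio_le j x K : route j x K.+1 -> cabs (step_ratio j x K - 1) <= k1 * exc (j K) (iter K f x).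
Proof.
move=> h; have [g1 _] := route_good (route_le (leqnSn K) h).
have [_ /(_ K.+1 (leqnn _))[jD jV]] := h.
by have [] := step_map g1 jD jV.
Qed.

Lemma b0N : (0 < b)%N. Proof. exact: ltnW. Qed.

(* Changing charts along the orbit telescopes. *)
Lemma log_series_route j j' x K : route j x K -> route j' x K ->
  log_series j' x K = log_series j x K + (cb ^+ K)%:C * Log (ze (j' K) (iter K f x) / ze (j K) (iter K f x))
    - Log (ze (j' 0%N) x / ze (j 0%N) x).
Proof.
elim: K => [|K ih] h h'; first by rewrite /log_series !big_ord0 expr0 add0r mul1r subrr.
have r := route_le (leqnSn K) h; have r' := route_le (leqnSn K) h'.
rewrite !log_seriesS (ih r r'); have [g e] := route_good r; have [g' e'] := route_good r'.
have [g1 _] := route_good h; have [g1' _] := route_good h'.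
set d0 := ze (j' K) _ / _; set d1 := ze (j' K.+1) _ / _.
have -> : step_ratio j' x K = step_ratio j x K * d1 / d0 ^+ b.
  rewrite /step_ratio /d0 /d1; move: (good_ze g) (good_ze g1) (good_ze g') (good_ze g1').
  move: (ze (j K) _) (ze (j K.+1) _) (ze (j' K) _) (ze (j' K.+1) _) => w w1 w' w1' n0 n1 n2 n3.
  by rewrite expr_div_n; field; rewrite !expf_neq0 // n1.
have [jD jV _ _] := g; have [jD1 jV1 _ _] := g1; have [jD' jV' _ _] := g'; have [jD1' jV1' _ _] := g1'.
have sw := step_switch g jD' jV'; have sw1 := step_switch g1 jD1' jV1'.
have ee : k1 * exc (j K.+1) (iter K.+1 f x) <= k1 * exc (j K) (iter K f x).
  apply: ler_wpM2l; first by rewrite ltW ?k1p.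
  have [_ le1] := good_map g jD1 jV1; apply: le_trans le1 _.
  by rewrite ler_piMl ?exc0 ?th1.
rewrite (@Log_cocycle _ _ _ _ b (k1 * exc (j K) (iter K f x)) b0N).
- have cE : (cb ^+ K)%:C = (cb ^+ K.+1)%:C * b%:R :> C.
    have -> : b%:R = (b%:R : R)%:C :> C by rewrite -(rmorph_nat (real_complex R)).
    by rewrite -rmorphM exprSr mulfVK // gt_eqF ?bR0.
  rewrite cE; move: (Log (step_ratio j x K)) (Log d0) (Log d1) (Log _) (log_series _ _ _) ((cb ^+ K.+1)%:C : C) (b%:R : C) => u1 u2 u3 u4 u5 u6 u7.
  ring.
- exact: small_t.
- exact: step_ratio_le.
- by have [] := sw.
- by apply: le_trans ee; have [] := sw1.
Qed.

Lemma Log_term_le rho t : cabs (rho - 1) <= t -> 100 * b%:R * t <= 1 -> cabs (Log rho : C) <= 6 * t.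
Proof. by move=> h1 h2; have [] := expc_Log_near b0N h1 h2. Qed.

Lemma route_exc j x K l : route j x (l + K)%N -> exc (j (l + K)%N) (iter (l + K) f x) <= exc (j K) (iter K f x).
Proof.
elim: l => [//|l ih] h; rewrite addSn in h *.
have r : route j x (l + K)%N := route_le (leqnSn _) h.
have [_ /(_ _ (leqnn _))[jD jV]] := h.
have [_ e] := good_map (proj1 (route_good r)) jD jV.
apply: le_trans e _; apply: le_trans (ih r).
by rewrite ler_piMl ?exc0 ?th1.
Qed.

(** The excess does not increase along a route, so each logarithm is at most a fixed E. As 2 * cb <=
    1, each weight cb^(l+1) is at most cb^l - cb^(l+1), and the bounds telescope. *)
Lemma log_series_tail_add j x K l : route j x (l + K)%N ->
  cabs (log_series j x (l + K) - log_series j x K) <= 6 * (k1 * exc (j K) (iter K f x)) * (cb ^+ K - cb ^+ (l + K)).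
Proof.
elim: l => [|l ih] h; first by rewrite add0n !subrr cabs0 mulr0.
rewrite addSn in h *.
have r : route j x (l + K)%N := route_le (leqnSn _) h.
rewrite log_seriesS -addrA [_ * _ - _]addrC addrA; apply: le_trans (cabsD _ _) _.
rewrite cabsM cabs_real ger0_norm; last by rewrite exprn_ge0 ?ltW ?cb0.
have [g _] := route_good r.
have lt := Log_term_le (step_ratio_le h) (small_t g).
have e6 : 6 * (k1 * exc (j (l + K)%N) (iter (l + K) f x)) <= 6 * (k1 * exc (j K) (iter K f x)).
  by apply: ler_wpM2l => //; apply: ler_wpM2l; [rewrite ltW ?k1p|exact: route_exc].
have {}lt := le_trans lt e6; have {}ih := ih r.
set E := 6 * (k1 * exc (j K) _) in e6 ih lt *.
have E0 : 0 <= E by apply: le_trans lt; exact: cabs_ge0.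
have ck0 : 0 <= cb ^+ (l + K) by rewrite exprn_ge0 ?ltW ?cb0.
apply: le_trans (lerD ih (ler_wpM2l (exprn_ge0 _ (ltW cb0)) lt)) _.
rewrite -[cb ^+ _ * E]mulrC -mulrDr; apply: ler_wpM2l => //.
by rewrite exprS; apply: halving_le => //; exact: cb_half.
Qed.

Lemma log_series_tail j x K m : (K <= m)%N -> route j x m ->
  cabs (log_series j x m - log_series j x K) <= 6 * (k1 * exc (j K) (iter K f x)) * cb ^+ K.
Proof.
move=> /subnK <- h; apply: le_trans (log_series_tail_add h) _; apply: ler_wpM2l.
  by rewrite mulr_ge0 // mulr_ge0 ?exc0 ?ltW ?k1p.
by rewrite lerBlDr lerDl exprn_ge0 ?ltW ?cb0.
Qed.

Definition log_corr (i : I) (x : N) : C := LIM (log_series (orbit_index i x) x).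

Lemma bdd_log_series i x : good i x -> bdd (log_series (orbit_index i x) x).
Proof.
move=> g; exists (6 * (k1 * exc i x) * 1) => m.
by have := log_series_tail (leq0n m) (orbit_index_route m g); rewrite {2}/log_series big_ord0 subr0 expr0.
Qed.

Lemma log_corr_tail i x K : good i x ->
  cabs (log_corr i x - log_series (orbit_index i x) x K) <= 6 * (k1 * exc (orbit_index i x K) (iter K f x)) * cb ^+ K.
Proof.
move=> g; apply: LIM_near; first exact: bdd_log_series.
by exists K => m Km; exact: log_series_tail Km (orbit_index_route m g).
Qed.

Lemma log_corr_le i x : good i x -> cabs (log_corr i x) <= 6 * (k1 * exc i x).
Proof. by move=> g; have := log_corr_tail 0 g; rewrite /log_series big_ord0 subr0 expr0 mulr1. Qed.

Local Notation rate K := (12 * (k1 * eps) * (th * cb) ^+ K).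

Lemma exc_rate j x K : route j x K -> 6 * (k1 * exc (j K) (iter K f x)) * cb ^+ K <= 6 * (k1 * eps) * (th * cb) ^+ K.
Proof.
move=> h; have [_ e] := route_good h; have [[_ _ _ xe] _] := h.
have -> : 6 * (k1 * eps) * (th * cb) ^+ K = 6 * (k1 * eps) * th ^+ K * cb ^+ K by rewrite exprMn -[RHS]mulrA.
apply: ler_wpM2r; first by rewrite exprn_ge0 ?ltW ?cb0.
rewrite -!mulrA; apply: ler_wpM2l => //; apply: ler_wpM2l; first by rewrite ltW ?k1p.
apply: le_trans e _; rewrite mulrC; apply: ler_wpM2r; last exact: ltW.
by rewrite exprn_ge0 ?ltW ?th0.
Qed.

Lemma log_corr_route i x j K : good i x -> route j x K ->
  cabs (log_corr i x + Log (ze i x / ze (j 0%N) x) - log_series j x K) <= rate K.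
Proof.
move=> g h; have ri := orbit_index_route K g.
have h1 := le_trans (log_corr_tail K g) (exc_rate ri); have [gK _] := route_good h.
have [[jD jV _ _] _] := route_good ri; have [_ sw] := step_switch gK jD jV.
have h2 := Log_term_le sw (small_t gK).
have h3 := exc_rate h.
have E : log_corr i x + Log (ze i x / ze (j 0%N) x) - log_series j x K = (log_corr i x - log_series (orbit_index i x) x K)
   + (cb ^+ K)%:C * Log (ze (orbit_index i x K) (iter K f x) / ze (j K) (iter K f x)).
  rewrite (log_series_route h ri) /=; move: (Log _) (Log _) (log_corr _ _) (log_series _ _ _) => ? ? ? ?; ring.
rewrite E; apply: le_trans (cabsD _ _) _.
have h4 : cabs ((cb ^+ K)%:C * Log (ze (orbit_index i x K) (iter K f x) / ze (j K) (iter K f x))) <= 6 * (k1 * eps) * (th * cb) ^+ K.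
  apply: le_trans h3; rewrite cabsM cabs_real ger0_norm; last by rewrite exprn_ge0 ?ltW ?cb0.
  by rewrite mulrC; apply: ler_wpM2r => //; rewrite exprn_ge0 ?ltW ?cb0.
apply: le_trans (lerD h1 h4) _; rewrite -mulrDl; apply: ler_wpM2r; last by rewrite -mulrDl -natrD.
by rewrite exprn_ge0 // mulr_ge0 ?ltW ?th0 ?cb0.
Qed.

Lemma rate_small e : 0 < e -> exists K, rate K <= e.
Proof.
move=> e0; have q : 0 <= th * cb < 1.
  rewrite mulr_ge0 ?ltW ?th0 ?cb0 //=; apply: (@le_lt_trans _ _ cb); last by have := cb_half; have := cb0; lra.
  by rewrite ler_piMl ?th1 // ltW ?cb0.
have p0 : 0 < 12 * (k1 * eps) by rewrite !mulr_gt0 ?k1p.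
have e1 : 0 < e / (12 * (k1 * eps)) by rewrite divr_gt0.
have [K hK] := pow_small q e1; exists K; have := hK K (leqnn _).
by rewrite ler_pdivlMr // mulrC.
Qed.

(** Both sides are approximated by the series along one and the same route. *)
Lemma log_corr_switch i j x : good i x -> good j x -> log_corr j x + Log (ze j x / ze i x) = log_corr i x.
Proof.
move=> gi gj; apply/eqP; rewrite -subr_eq0 -cabs_eq0 eq_le cabs_ge0 andbT; apply: eps_le0 => e e0.
have e2 : 0 < e / 2 by rewrite divr_gt0.
have [K hK] := rate_small e2; have ri := orbit_index_route K gi.
have h1 := log_corr_route gj ri; have h2 := log_corr_route gi ri.
rewrite /= divff ?good_ze // Log1 addr0 in h2.
exact: cabs_dist_half h1 h2 hK.
Qed.

Lemma log_series_shift i x K : log_series (orbit_index i x) x K.+1 =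
  cb%:C * (Log (ze (next_index (f x)) (f x) / ze i x ^+ b) + log_series (orbit_index (next_index (f x)) (f x)) (f x) K).
Proof.
have eJ k : orbit_index i x k.+1 = orbit_index (next_index (f x)) (f x) k by case: k => [//|k]; rewrite [LHS]/orbit_index iterSr.
rewrite /log_series big_ord_recl /= expr1 mulrDr mulr_sumr; congr (_ + _).
apply: eq_bigr => l _; rewrite /bump /= add1n [in RHS]mulrA -rmorphM -exprS; congr (_ * Log _).
by rewrite /step_ratio !eJ !(iterSr _ f x).
Qed.

(** The relation B o f = b B with log z removed from both sides; it comes from the shift of the
    series. *)
Lemma log_corr_f i x : good i x ->
  b%:R * log_corr i x = Log (ze (next_index (f x)) (f x) / ze i x ^+ b) + log_corr (next_index (f x)) (f x).
Proof.
move=> g; have [jD jV] := next_indexP g; have [gj _] := good_map g jD (V42 jV).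
have rj K := orbit_index_route K gj; have ri K := orbit_index_route K g.
apply/eqP; rewrite -subr_eq0 -cabs_eq0 eq_le cabs_ge0 andbT; apply: eps_le0 => e e0.
have e2 : 0 < e / 2 by rewrite divr_gt0.
have [K hK] := rate_small e2.
have h1 := log_corr_route g (ri K.+1); have h2 := log_corr_route gj (rj K).
rewrite /= divff ?good_ze // Log1 addr0 in h1; rewrite /= divff ?good_ze // Log1 addr0 in h2.
have bC : b%:R = (b%:R : R)%:C :> C by rewrite -(rmorph_nat (real_complex R)).
set T := Log _ in h1 *; set B' := log_corr _ (f x) in h2 *; set S' := log_series _ (f x) K in h2.
apply: (@cabs_dist_half _ _ (T + S') _ (rate K)) => //.
  have -> : b%:R * log_corr i x - (T + S') = b%:R * (log_corr i x - log_series (orbit_index i x) x K.+1).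
    rewrite log_series_shift mulrBr mulrA bC -rmorphM divff ?gt_eqF ?bR0 // rmorph1 mul1r -/T -/S'; exact: erefl.
  rewrite cabsM cabs_nat; apply: le_trans (ler_wpM2l (ltW bR0) h1) _.
  have -> : b%:R * rate K.+1 = rate K * th by rewrite exprS; field; rewrite !gt_eqF ?k1p ?bR0.
  rewrite ler_piMr ?th1 // mulr_ge0 ?exprn_ge0 // mulr_ge0 ?ltW ?th0 ?cb0 //.
  by rewrite mulr_gt0 // k1p.
by have -> : T + B' - (T + S') = B' - S' by rewrite opprD addrACA subrr add0r.
Qed.

(** The function u = Re B. Only |z| enters, so no branch of log z has to be chosen. *)
Definition potential (i : I) (x : N) : R := ln (cabs (ze i x)) + complex.Re (log_corr i x).

Lemma potential_switch i j x : good i x -> good j x -> potential i x = potential j x.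
Proof.
move=> gi gj; rewrite /potential -(log_corr_switch gi gj) ReD Re_Log cabsM cabsV.
have zi : 0 < cabs (ze i x) by rewrite cabs_gt0 good_ze.
have zj : 0 < cabs (ze j x) by rewrite cabs_gt0 good_ze.
by rewrite lnM ?posrE ?invr_gt0 // lnV ?posrE //; ring.
Qed.

Lemma potential_f i j x : good i x -> j \in D -> V j 2 (f x) -> potential j (f x) = b%:R * potential i x.
Proof.
move=> g jD jV; have [gj _] := good_map g jD jV.
have [kD kV] := next_indexP g; have [gk _] := good_map g kD (V42 kV).
rewrite (potential_switch gj gk) /potential.
have : b%:R * complex.Re (log_corr i x) = complex.Re (b%:R * log_corr i x).
  have -> : b%:R = (b%:R : R)%:C :> C by rewrite -(rmorph_nat (real_complex R)).
  by rewrite Re_scale.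
rewrite log_corr_f // ReD Re_Log cabsM cabsV cabsX mulrDr => ->.
have zi : 0 < cabs (ze i x) by rewrite cabs_gt0 good_ze.
have zk : 0 < cabs (ze (next_index (f x)) (f x)) by rewrite cabs_gt0 good_ze.
by rewrite lnM ?posrE ?invr_gt0 ?exprn_gt0 // lnV ?posrE ?exprn_gt0 // lnXn // -mulr_natl; ring.
Qed.

Lemma potential_le i x : good i x -> `|potential i x - ln (cabs (ze i x))| <= 6 * (k1 * exc i x).
Proof. by move=> g; rewrite /potential addrC addKr; apply: le_trans (Re_le_cabs _) _; exact: log_corr_le. Qed.

Lemma lgood_near i x : good i x -> \forall y \near x, good i y.
Proof.
move=> [iD xV z0 xe]; have xB : cball (lc i) (lP i) (lr i) x by apply: (lV_ball hl _ xV); rewrite ler1n.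
have n1 : \forall y \near x, V i 2 y by apply: open_nbhs_nbhs; split => //; exact: open_cball.
have cz := lz_continuous hl xB.
have zp : 0 < cabs (zo i x) by rewrite cabs_gt0.
have cq : cabs (zo i y) @[y --> x] --> cabs (zo i x).
  apply/cvgrPdist_lt => e e0; have /continuous_cabs /(_ e e0) := cz.
  apply: filterS => y; apply: le_lt_trans; rewrite ler_norml lerBlDr.
  have h1 := cabs_dist (zo i x) (zo i y) 0; have h2 := cabs_dist (zo i y) (zo i x) 0.
  rewrite !subr0 in h1 h2; rewrite (cabs_sub (zo i x)) in h1; apply/andP; split; lra.
have cl : ldl iota lc lZ i y @[y --> x] --> ldl iota lc lZ i x.
  apply/cvgrPdist_lt => e e0; have := ldl_near hiota hl xB e0.
  by apply: filterS => y; rewrite distrC.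
have zb0 : cabs (zo i x) ^+ b != 0 by rewrite gt_eqF // exprn_gt0.
have cqb : cabs (zo i y) ^+ b @[y --> x] --> cabs (zo i x) ^+ b.
  exact: (cvg_comp _ _ cq (@exprn_continuous R b _)).
have ce : exc i y @[y --> x] --> exc i x.
  by apply: cvgM; [exact: cl|apply: cvgV; [exact: zb0|exact: cqb]].
have n2 : \forall y \near x, exc i y < eps by exact: (cvgr_lt _ ce).
have n3 : \forall y \near x, 0 < cabs (zo i y) by exact: (cvgr_gt _ cq).
apply: filterS3 n1 n2 n3 => y y1 y2 y3; split => //.
by rewrite -cabs_gt0.
Qed.

(** * Holomorphy of the limit of the series *)

Lemma differentiable_ze_iter i j l v : dom (lc i) (bwd (lc i) v) -> fwd (lc i) (bwd (lc i) v) = v ->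
  V j 2 (iter l f (bwd (lc i) v)) -> zo j (iter l f (bwd (lc i) v)) != 0 ->
  differentiable (fun w => ze j (iter l f (bwd (lc i) w))) v.
Proof.
move=> cv ev jV z0.
have [ai _ _ _ _] := hl i; have [aj _ _ hZ _] := hl j.
have [cj rj] : cball (lc j) (lP j) (lr j) (iter l f (bwd (lc i) v)).
  by apply: (lV_ball hl _ jV); rewrite ler1n.
have [dZ _ _] := hZ _ rj.
have dF := differentiable_local (holomorphic_iter l fH) ai aj cv cj.
rewrite ev in dF.
have dz : differentiable (fun w => zo j (iter l f (bwd (lc i) w))) v.
  exact: (@differentiable_comp _ 'rV[C]_n 'rV[C]_n C _ (lZ j) v dF dZ).
by rewrite /lzt /zt; case: j.1; [exact: dz|exact: (differentiableV dz)].
Qed.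

Lemma differentiable_log_series (j : nat -> I) i v K : dom (lc i) (bwd (lc i) v) -> fwd (lc i) (bwd (lc i) v) = v ->
  route j (bwd (lc i) v) K -> differentiable (fun w => log_series j (bwd (lc i) w) K) v.
Proof.
move=> cv ev; elim: K => [|K ih] h.
  have -> : (fun w => log_series j (bwd (lc i) w) 0) = cst 0 by apply/funext => w; rewrite /log_series big_ord0.
  exact: differentiable_cst.
have r := route_le (leqnSn K) h; have [g _] := route_good r; have [g1 _] := route_good h.
have -> : (fun w => log_series j (bwd (lc i) w) K.+1) = (fun w => log_series j (bwd (lc i) w) K) +
   ((cb ^+ K.+1)%:C : C) *: (@Log R \o (fun w => step_ratio j (bwd (lc i) w) K)).
  by apply/funext => w; rewrite log_seriesS.
apply: differentiableD; first exact: ih.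
apply: differentiableZ; apply: (@differentiable_comp _ 'rV[C]_n C C).
  have [jD jV z0 _] := g; have [jD1 jV1 z1 _] := g1.
  have d0 := differentiable_ze_iter cv ev jV z0; have d1 := differentiable_ze_iter cv ev jV1 z1.
  have -> : (fun w => step_ratio j (bwd (lc i) w) K) = (fun w => ze (j K.+1) (iter K.+1 f (bwd (lc i) w))) *
     ((fun w => (ze (j K) (iter K f (bwd (lc i) w)))^-1) ^+ b.-1.+1).
    apply/funext => w; rewrite /step_ratio prednK ?b0N // -exprVn.
    by rewrite [in RHS]/GRing.mul /= exprfctE.
  apply: differentiableM; first exact: d1.
  by apply: differentiableX; apply: differentiableV; [exact: d0|exact: good_ze g].
apply: differentiable_Log; apply: le_trans (step_ratio_le h) _.
have := small_t g; have := b1R; have t0 : 0 <= k1 * exc (j K) (iter K f (bwd (lc i) v)) by rewrite mulr_ge0 ?exc0 ?ltW ?k1p.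
move: (k1 * _) t0 => t t0 bb; have := ler_wpM2r t0 bb.
rewrite -mulrA; lra.
Qed.

(** Orbits separate by at most a factor k1 per step. If y starts within r * k1^-K of x, then before
    time K its orbit is less than k1^-1 away from that of x, which is what [step_lip] needs to carry
    the indices of x one step further. *)
Lemma route_lip i x y K r : good i x -> good i y -> 0 < r <= 1 ->
  vn (fwd (lc i) y - fwd (lc i) x) < r * k1 ^- K ->
  forall l, (l <= K)%N -> route (orbit_index i x) y l /\
    vn (fwd (lc (orbit_index i x l)) (iter l f y) - fwd (lc (orbit_index i x l)) (iter l f x)) <= k1 ^+ l * vn (fwd (lc i) y - fwd (lc i) x).
Proof.
move=> gx gy /andP[r0 r1] yx; elim=> [|l ih] lK.
  split; last by rewrite expr0 mul1r.
  by split => // l; rewrite leqn0 => /eqP ->; have [? ? _ _] := gy.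
have [rl vl] := ih (ltnW lK); have [gl _] := orbit_index_good gx l; have [gl1 jV] := orbit_index_good gx l.+1.
have [jD _ _ _] := gl1; have [gyl _] := route_good rl.
have [_ [cyl _] _ _] := gyl.
have lt1 : vn (fwd (lc (orbit_index i x l)) (iter l f y) - fwd (lc (orbit_index i x l)) (iter l f x)) < k1^-1.
  apply: le_lt_trans vl _; rewrite mulrC -ltr_pdivlMr ?exprn_gt0 ?k1p //.
  apply: lt_le_trans yx _; rewrite -invfM -exprS.
  apply: (@le_trans _ _ (k1 ^- K)).
    by rewrite ler_piMl // invr_ge0 exprn_ge0 // ltW ?k1p.
  by rewrite lef_pV2 ?posrE ?exprn_gt0 ?k1p // ler_weXn2l.
have [yV vl1] := step_lip gl jD (jV isT) cyl lt1.
split.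
  split => // m; rewrite leq_eqVlt => /orP[/eqP ->|]; first by [].
  by have [_ h] := rl; exact: h.
by apply: le_trans vl1 _; rewrite exprS -mulrA; apply: ler_wpM2l => //; rewrite ltW ?k1p.
Qed.

Lemma good_ball_near i x : good i x -> exists2 r, 0 < r & forall v, vn (v - fwd (lc i) x) < r ->
  [/\ dom (lc i) (bwd (lc i) v), fwd (lc i) (bwd (lc i) v) = v & good i (bwd (lc i) v)].
Proof. by move=> g; have [_ [cx _] _ _] := g; exact: bwd_near cx (lgood_near g). Qed.

(* The partial sums are taken along the indices of the orbit of x, which remain
   valid on a ball of radius comparable to k1^-K, whereas the error decays like
   (2 k1 b)^-K. *)
Lemma log_corr_AHn i x : good i x -> AHn (fun v => log_corr i (bwd (lc i) v)) (fwd (lc i) x).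
Proof.
move=> gx e r0 e0 r00; have [s s0 hs] := good_ball_near gx.
pose r := Num.min s (Num.min r0 1).
have rp : 0 < r by rewrite !lt_min s0 r00 ltr01.
have rs : r <= s by rewrite ge_min lexx.
have rr0 : r <= r0 by rewrite !ge_min lexx !orbT.
have r1 : r <= 1 by rewrite !ge_min lexx !orbT.
(* Since th * cb = (cb / 2) / k1, the error at level K is (cb / 2)^K times k1^-K. The last factor is
   matched by the radius, and (cb / 2)^K is made as small as desired. *)
have [||K hK] := @pow_small R (cb / 2) (e * r / (12 * (k1 * eps))).
- by have := cb_half; have := cb0; move: cb => c; lra.
- by rewrite divr_gt0 ?mulr_gt0 ?k1p.
have {}hK := hK K (leqnn _).
have kK : 0 < k1 ^+ K by rewrite exprn_gt0 // k1p.
have kKi : k1 ^- K <= 1 by rewrite invf_le1 // exprn_ege1.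
have rK : r * k1 ^- K <= r by rewrite ler_piMr // ltW.
exists (r * k1 ^- K), (fun v => log_series (orbit_index i x) (bwd (lc i) v) K); split.
- by rewrite divr_gt0.
- exact: le_trans rK rr0.
move=> v vr; have [cv ev gv] := hs v (lt_le_trans vr (le_trans rK rs)).
have r01 : 0 < r <= 1 by rewrite rp.
have yx : vn (fwd (lc i) (bwd (lc i) v) - fwd (lc i) x) < r * k1 ^- K by rewrite ev.
have [rt _] := route_lip gx gv r01 yx (leqnn K).
split; first exact: differentiable_log_series.
have h := log_corr_route gv rt; rewrite /= divff ?good_ze // Log1 addr0 in h.
apply: le_trans h _.
have E : (th * cb) ^+ K = (cb / 2) ^+ K * k1 ^- K.
  by rewrite -[k1 ^- K]exprVn -exprMn; congr (_ ^+ _); rewrite invfM; ring.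
rewrite E [leLHS]mulrA [leRHS]mulrA; apply: ler_wpM2r; first by rewrite invr_ge0 ltW.
by rewrite mulrC -ler_pdivlMr ?mulr_gt0 ?k1p.
Qed.

Lemma log_corr_differentiable i x : good i x ->
  differentiable (fun v => log_corr i (bwd (lc i) v)) (fwd (lc i) x).
Proof.
move=> gx; have [s s0 hs] := good_ball_near gx.
apply: (@AHn_differentiable _ _ _ _ s (6 * (k1 * eps))) => // v vs.
have [cv ev gv] := hs v vs; split; first by have := log_corr_AHn gv; rewrite ev.
apply: le_trans (log_corr_le gv) _; rewrite !ler_wpM2l // ?ltW ?k1p //.
by have [_ _ _] := gv.
Qed.

(** * The coordinate B near the invariant circle *)

Definition invariant_circle : set N := line_param true @` [set z : C | cabs z = 1].

(** A branch of B up to a constant: zeta will be a number of modulus 1 close to z, so that [Log] is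
    taken near 1 and the real part is still [potential]. *)
Definition log_coord (i : I) (zeta : C) (v : 'rV[C]_n) : C := Log (ze i (bwd (lc i) v) / zeta) + log_corr i (bwd (lc i) v).

Lemma bwdK i x : dom (lc i) x -> bwd (lc i) (fwd (lc i) x) = x.
Proof. by move=> cx; exact: fwdK. Qed.

Lemma good_dom i x : good i x -> dom (lc i) x.
Proof. by case=> _ [cx _] _ _. Qed.

Lemma log_coord_differentiable i zeta x : good i x -> cabs (ze i x / zeta - 1) <= 1 / 16 ->
  differentiable (log_coord i zeta) (fwd (lc i) x).
Proof.
move=> g h; have [iD iV z0 _] := g; have cx := good_dom g; have ex := bwdK cx.
have dz : differentiable (fun w => ze i (iter 0 f (bwd (lc i) w))) (fwd (lc i) x).
  by apply: differentiable_ze_iter; rewrite ?ex.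
apply: (@differentiableD _ _ C); last exact: log_corr_differentiable.
apply: (@differentiable_comp _ 'rV[C]_n C C (fun v => ze i (bwd (lc i) v) / zeta) (@Log R)).
  by apply: (@differentiableM _ _ _ (cst zeta^-1)); [exact: dz|exact: differentiable_cst].
by apply: differentiable_Log; rewrite ex.
Qed.

Lemma ze_near i x e : good i x -> 0 < e -> \forall y \near x, cabs (ze i y - ze i x) < e.
Proof.
move=> g e0; have [iD iV z0 _] := g.
have xB : cball (lc i) (lP i) (lr i) x by apply: (lV_ball hl _ iV); rewrite ler1n.
have cz := lz_continuous hl xB.
suff /continuous_cabs /(_ e e0) : {for x, continuous (ze i)} by [].
rewrite /lzt /zt; case: i.1; [exact: cz|exact: (cvgV z0 cz)].
Qed.

Lemma close_near i zeta x : good i x -> cabs zeta = 1 -> cabs (ze i x / zeta - 1) < 1 / 16 ->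
  \forall y \near x, good i y /\ cabs (ze i y / zeta - 1) < 1 / 16.
Proof.
move=> g z1 h; have e0 : 0 < 1 / 16 - cabs (ze i x / zeta - 1) by rewrite subr_gt0.
apply: filterS2 (lgood_near g) (ze_near g e0) => y gy yx; split => //.
apply: le_lt_trans (cabs_dist _ (ze i x / zeta) _) _.
by rewrite -mulrBl cabsM cabsV z1 invr1 mulr1 -ltrBrDr.
Qed.

Lemma log_coord_near i zeta x : good i x -> cabs zeta = 1 -> cabs (ze i x / zeta - 1) < 1 / 16 ->
  \forall v \near fwd (lc i) x, differentiable (log_coord i zeta) v.
Proof.
move=> g z1 h; have [r r0 hr] := bwd_near (good_dom g) (close_near g z1 h).
apply/nbhs_vn; exists r; first exact: r0.
move=> v /hr[cv ev [gv hv]]; have := log_coord_differentiable gv (ltW hv).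
by rewrite ev; exact: id.
Qed.

Lemma Re_log_coord i zeta x : good i x -> cabs zeta = 1 -> complex.Re (log_coord i zeta (fwd (lc i) x)) = potential i x.
Proof.
move=> g z1; have e := bwdK (good_dom g).
transitivity (complex.Re (Log (ze i x / zeta) + log_corr i x)); first by rewrite /log_coord e.
by rewrite ReD Re_Log cabsM cabsV z1 invr1 mulr1.
Qed.

Definition sgood i m zeta x :=
  [/\ good i x, cabs zeta = 1, cabs (ze i x / zeta - 1) < 1 / 16 & 'D_(delta_mx 0 m) (log_coord i zeta) (fwd (lc i) x) != 0].

(** The points near which some branch of B can replace a chart coordinate, and hence where
    [straighten] applies. *)
Definition regular : set N := [set x | exists i m zeta, sgood i m zeta x].

Lemma exc_L i x : L x -> V i 2 x -> exc i x = 0.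
Proof.
move=> Lx xV; have xB : cball (lc i) (lP i) (lr i) x by apply: (lV_ball hl _ xV); rewrite ler1n.
by rewrite /excess /ldl (delta_L (hl i) Lx xB) mul0r.
Qed.

Lemma log_corr_L i x : L x -> good i x -> log_corr i x = 0.
Proof.
move=> Lx g; have [_ xV _ _] := g; have := log_corr_le g; rewrite (exc_L Lx xV) mulr0 mulr0 => h.
by apply/eqP; rewrite -cabs_eq0 eq_le cabs_ge0 h.
Qed.

(** For |t| <= 1/40 the quadratic error 20 * |t|^2 of [Log_bound] takes away at most half of |t|. *)
Lemma Log_lower (s : bool) (t : C) : cabs t <= 1 / 40 -> cabs t / 2 <= cabs (Log (zt s (1 + t))).
Proof.
move=> h; have t4 : cabs (1 + t - 1) <= 1 / 4 by rewrite addrAC subrr add0r; lra.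
have h4 : cabs t <= 1 / 4 by lra.
have hL : cabs t / 2 <= cabs (Log (1 + t)).
  have := Log_bound h4; have := cabs_dist t (Log (1 + t)) 0; rewrite !subr0 (cabs_sub t).
  have := ler_wpM2l (cabs_ge0 t) h; rewrite expr2; lra.
case: s => //=; rewrite LogV ?cabsN //; first exact: Re_near1_gt0.
by have := Log_le h4; lra.
Qed.

Lemma differentiable_lip (g : C -> 'rV[C]_n) w : differentiable g w -> exists r K : R, [/\ 0 < r, 0 <= K &
  forall t, cabs t < r -> vn (g (w + t) - g w) <= K * cabs t].
Proof.
move=> dg; have /nbhs_cabs[r r0 hr] := differentiable_eps dg (@ltr01 R).
exists r, (1 + vn ('D_1 g w)); split; [exact: r0|by rewrite addr_ge0 ?vn_ge0|move=> t].
rewrite -{1}[t]subr0 => /hr; rewrite normvE cabsE -rmorphM lecR mul1r => h.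
have dE : 'd g w t = t *: 'D_1 g w.
  by rewrite deriveE // -{1}[t]mulr1 -[t * 1]/(t *: (1 : C)) linearZ.
rewrite dE in h; move: h; move: ('D_1 g w) => d h.
have := vnD (g (w + t) - g w - t *: d) (t *: d); rewrite subrK vnZ mulrDl mul1r [vn d * _]mulrC.
by move/le_trans; apply; rewrite lerD2r.
Qed.

Lemma quadratic_absurd (t A : R) : 0 < t -> 0 <= A -> t * (2 * A + 1) <= 1 / 2 -> t / 2 <= A * t ^+ 2 -> False.
Proof.
move=> t0 A0 h1 h2; have : t / 2 <= t * (A * t) by rewrite mulrCA -expr2.
rewrite ler_pM2l // => h3; lra.
Qed.

(** On L the correction vanishes, so along the curve the coordinate is Log(1 + u) or its opposite
    and grows linearly. With zero gradient its growth would be quadratic, a contradiction for a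
    small enough parameter t0. *)
Lemma log_coord_gradient i w : good i (line_param i.1 w) -> zo i (line_param i.1 w) = w -> cabs w = 1 ->
  exists m, 'D_(delta_mx 0 m) (log_coord i (ze i (line_param i.1 w))) (fwd (lc i) (line_param i.1 w)) != 0.
Proof.
move=> g zw w1; set p := line_param i.1 w in g zw *; set zeta := ze i p.
have zetaE : zeta = zt i.1 w by rewrite /zeta /lzt zw.
have z1 : cabs zeta = 1 by rewrite zetaE /zt; case: i.1; rewrite ?cabsV ?w1 ?invr1.
have h0 : cabs (ze i p / zeta - 1) < 1 / 16 by rewrite divff ?good_ze // subrr cabs0 divr_gt0.
apply: contrapT => hn.
have [r [M [r0 hM]]] := holb_near (log_coord_near g z1 h0).
have [_ h2] := holb_first_order r0 hM.
have gr0 : grad (log_coord i zeta) (fwd (lc i) p) = 0.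
  apply/rowP => m; rewrite !mxE; apply/eqP; apply: contrapT => /negP h; apply: hn; by exists m.
have [_ hd] := line_param_imm hiota i.1; have [ai _ _ _ _] := hl i.
have [dg _] := hd w (lc i) ai (good_dom g).
have [r1 [K [r10 K0 hK]]] := differentiable_lip dg.
have hc : \forall z \near w, good i (line_param i.1 z) by exact: (line_param_cont hiota (lgood_near g)).
have /nbhs_cabs[r2 r20 hr2] := hc.
have M0 := holb_ge0 r0 hM.
pose A := 8 * M * (K / r) ^+ 2.
have Kr : 0 <= K / r by rewrite divr_ge0 // ltW.
have A0 : 0 <= A by apply: mulr_ge0; [exact: mulr_ge0|exact: exprn_ge0].
pose t0 : R := Num.min (Num.min (r1 / 2) (r2 / 2)) (Num.min (1 / 40) (Num.min (r / 4 / (K + 1)) ((1 / 2) / (2 * A + 1)))).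
have K1 : 0 < K + 1 by lra.
have A1 : 0 < 2 * A + 1 by lra.
have t00 : 0 < t0 by rewrite !lt_min !divr_gt0.
have t01 : t0 <= r1 / 2 by rewrite !ge_min lexx.
have t02 : t0 <= r2 / 2 by rewrite !ge_min lexx ?orbT.
have t03 : t0 <= 1 / 40 by rewrite !ge_min lexx ?orbT.
have t04 : t0 <= r / 4 / (K + 1) by rewrite !ge_min lexx ?orbT.
have t05 : t0 <= (1 / 2) / (2 * A + 1) by rewrite !ge_min lexx ?orbT.
clearbody t0.
rewrite ler_pdivlMr // in t04; rewrite ler_pdivlMr // in t05.
pose t : C := t0%:C; have ct : cabs t = t0 by rewrite /t cabs_real ger0_norm // ltW.
have w0 : w != 0 by rewrite -cabs_gt0 w1.
pose u := t / w; have cu : cabs u = t0 by rewrite /u cabsM cabsV w1 invr1 mulr1.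
have g' : good i (line_param i.1 (w + t)) by apply: hr2; rewrite addrAC subrr add0r ct; exact: half_lt r20 t02.
have zwt : ze i (line_param i.1 (w + t)) / zeta = zt i.1 (1 + u).
  have [_ iV' _ _] := g'.
  have zE : zo i (line_param i.1 (w + t)) = w + t.
    by apply: (zco_L hiota (hl i)); apply: (lV_ball hl _ iV'); rewrite ler1n.
  rewrite /lzt zE zetaE; have -> : w + t = (1 + u) * w by rewrite mulrDl mul1r /u divfK.
  by rewrite /zt; case: i.1; rewrite ?mulfK // invfM mulrK // unitfE invr_eq0.
have lip := hK t; rewrite ct in lip; have {}lip := lip (half_lt r10 t01).
set gw := (fwd (lc i) \o line_param i.1) w in lip; set gwt := (fwd (lc i) \o line_param i.1) (w + t) in lip.
have E1 : log_coord i zeta gwt = Log (zt i.1 (1 + u)).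
  rewrite /log_coord /gwt /= (bwdK (good_dom g')) (log_corr_L (line_param_L iota _ _) g') addr0 zwt; exact: erefl.
have E2 : log_coord i zeta gw = 0.
  rewrite /log_coord /gw /= (bwdK (good_dom g)) (log_corr_L (line_param_L iota _ _) g) addr0 divff ?good_ze //; exact: Log1.
have := h2 (gwt - gw); rewrite gr0.
have -> : dotv (0 : 'rV[C]_n) (gwt - gw) = 0 by rewrite /dotv big1 // => m _; rewrite mxE mul0r.
have -> : fwd (lc i) p = gw by [].
rewrite subr0 [gw + _]addrC subrK E1 E2 subr0 => hq.
have v1 : vn (gwt - gw) <= r / 4.
  by apply: le_trans lip _; apply: le_trans t04; rewrite mulrC ler_wpM2l ?(ltW t00) // lerDl.
have {}hq := hq v1.
have cu40 : cabs u <= 1 / 40 by rewrite cu.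
have hlow := Log_lower i.1 cu40; rewrite cu in hlow.
apply: (quadratic_absurd t00 A0); first by apply: le_trans t05 _.
apply: le_trans hlow _; apply: le_trans hq _.
have -> : A * t0 ^+ 2 = 8 * M * (K * t0 / r) ^+ 2 by rewrite /A; field; rewrite gt_eqF.
apply: ler_wpM2l; first by rewrite mulr_ge0.
apply: lerXn2r; rewrite ?nnegrE ?divr_ge0 ?vn_ge0 ?mulr_ge0 ?(ltW r0) ?(ltW t00) //.
by apply: ler_wpM2r => //; rewrite invr_ge0 ltW.
Qed.

Hypothesis Dcover : forall q, L q -> exists2 i, i \in D & V i 4 q.

Lemma near_nonzero (d1 d2 : C) : cabs (d1 - d2) < cabs d2 -> d1 != 0.
Proof. by rewrite -cabs_gt0; have := cabs_dist d2 d1 0; rewrite !subr0 (cabs_sub d2); lra. Qed.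

Lemma invariant_circle_L p : invariant_circle p -> L p.
Proof. by case=> z _ <-; exact: line_param_L. Qed.

(** At p the number zeta = z(p) gives a nonzero partial derivative. Partial derivatives of a
    holomorphic function are continuous, so m and zeta keep serving near p. *)
Lemma invariant_circle_regular p : invariant_circle p -> \forall x \near p, regular x.
Proof.
move=> cp; have Lp := invariant_circle_L cp; have [i iD iV4] := Dcover Lp; have iV := V42 iV4.
have xB : cball (lc i) (lP i) (lr i) p by apply: (lV_ball hl _ iV); rewrite ler1n.
have [_ _ _ _ hp] := hl i; have pE := hp p Lp xB.
set w := zo i p; rewrite -[lZ i _]/w in pE.
have w1 : cabs w = 1.
  have [z0 z01 zE] := cp; have {}z01 : cabs z0 = 1 := z01; rewrite pE in zE.
  have : i.1 = true \/ i.1 = ~~ true by case: i.1; [left|right].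
  case=> e; rewrite e in zE; first by rewrite -(line_param_inj hiota zE).
  have := congr1 (@cabs R) (line_param_cross hiota zE); rewrite cabsM z01 mul1r cabs1; exact: id.
have w0 : w != 0 by rewrite -cabs_gt0 w1.
have g : good i p by split => //; rewrite exc_L.
have g' := g; rewrite pE in g'.
have zE : zo i (line_param i.1 w) = w by rewrite -pE.
have [m] := log_coord_gradient g' zE w1; rewrite -pE => Dm.
set zeta := ze i p in Dm.
have z1 : cabs zeta = 1 by rewrite /zeta /lzt /zt -/w; case: i.1; rewrite ?cabsV ?w1 ?invr1.
have h0 : cabs (ze i p / zeta - 1) < 1 / 16 by rewrite divff ?good_ze // subrr cabs0 divr_gt0.
have [r [M [r0 hM]]] := holb_near (log_coord_near g z1 h0).
have r2 : 0 < r / 2 by rewrite divr_gt0.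
have [|dD _] := holb_partial m r0 hM (y := fwd (lc i) p); first by rewrite subrr vn0.
have cD := differentiable_continuous dD.
have D0 : 0 < cabs ('D_(delta_mx 0 m) (log_coord i zeta) (fwd (lc i) p)) by rewrite cabs_gt0.
have cDf : {for p, continuous ((fun y => 'D_(delta_mx 0 m) (log_coord i zeta) y) \o fwd (lc i))}.
  apply: (@continuous_comp _ _ _ (fwd (lc i))); last exact: cD.
  by apply: fwd_cont; exact: good_dom g.
have /continuous_cabs /(_ _ D0) nD := cDf.
apply: filterS2 (close_near g z1 h0) nD => y [gy hy] Dy.
exists i, m, zeta; split; [exact: gy|exact: z1|exact: hy|].
exact: near_nonzero Dy.
Qed.

(** * The local stable set as the zero set of the potential *)

Lemma potential_orbit_index i x k : good i x -> potential (orbit_index i x k) (iter k f x) = b%:R ^+ k * potential i x.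
Proof.
move=> g; elim: k => [|k ih]; first by rewrite expr0 mul1r.
have [gk _] := orbit_index_good g k; have [[jD jV _ _] _] := orbit_index_good g k.+1.
by rewrite exprS -mulrA -ih; exact: potential_f gk jD jV.
Qed.

Lemma ln_ze_bound i zeta x : good i x -> cabs zeta = 1 -> cabs (ze i x / zeta - 1) < 1 / 16 ->
  `|ln (cabs (ze i x))| <= 1.
Proof.
move=> g z1 h; have -> : ln (cabs (ze i x)) = complex.Re (Log (ze i x / zeta)).
  by rewrite Re_Log cabsM cabsV z1 invr1 mulr1.
apply: le_trans (Re_le_cabs _) _.
have h4 : cabs (ze i x / zeta - 1) <= 1 / 4 by lra.
have := Log_le1 h4; lra.
Qed.

Lemma regular_potential i x : good i x -> regular x -> `|potential i x| <= 1 + 6 * (k1 * eps).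
Proof.
move=> g [i' [m [zeta [g' z1 h _]]]]; rewrite (potential_switch g g').
have h1 := potential_le g'; have h2 := ln_ze_bound g' z1 h.
have h3 : 6 * (k1 * exc i' x) <= 6 * (k1 * eps).
  by rewrite !ler_wpM2l // ?ltW ?k1p //; have [_ _ _] := g'.
have := ler_normD (potential i' x - ln (cabs (ze i' x))) (ln (cabs (ze i' x))); rewrite subrK; lra.
Qed.

(** Along the orbit u is multiplied by b^k, but on regular points it is bounded; hence u = 0. *)
Lemma regular_orbit i x : good i x -> (forall k, regular (iter k f x)) -> potential i x = 0.
Proof.
move=> g h; apply/eqP; rewrite -normr_eq0 eq_le normr_ge0 andbT; apply: eps_le0 => e e0.
pose M := 1 + 6 * (k1 * eps).
have M0 : 0 < M by rewrite ltr_wpDr // mulr_ge0 // mulr_ge0 ?ltW ?k1p.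
have cq : 0 <= cb < 1 by have := cb_half; have := cb0; move: cb => c; lra.
have eM : 0 < e / M by rewrite divr_gt0.
have [K hK] := pow_small cq eM; have {}hK := hK K (leqnn _).
have [gK _] := orbit_index_good g K; have := regular_potential gK (h K).
rewrite potential_orbit_index // normrM normrX normr_nat -/M => hb.
have bK : 0 < (b%:R : R) ^+ K by rewrite exprn_gt0 ?bR0.
have : `|potential i x| <= cb ^+ K * M by rewrite exprVn mulrC ler_pdivlMr // mulrC.
move/le_trans; apply; by rewrite -ler_pdivlMr.
Qed.

Lemma ln_near1 (y t : R) : 0 < y -> `|ln y| <= t -> t <= 1 / 2 -> `|y - 1| <= 2 * t.
Proof.
move=> y0; rewrite ler_norml => /andP[h1 h2] t2.
have e1 : 1 + ln y <= y by have := expR_ge1Dx (ln y); rewrite lnK ?posrE.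
have e2 : 1 - ln y <= y^-1 by have := expR_ge1Dx (- ln y); rewrite expRN lnK ?posrE.
have e3 : (1 - t) * y <= 1.
  rewrite -ler_pdivlMr // div1r; apply: le_trans e2; lra.
rewrite ler_norml; apply/andP; split; first lra.
nra.
Qed.

(** The function ldl + ||z| - 1| vanishes on the circle only, so by compactness it suffices to make
    it small. If u = 0, then |ln |z|| <= 6 * k1 * exc, and both terms are bounded by multiples of
    the excess: 2^b from |z| <= 2, and 12 * k1 after [ln_near1] doubles the bound. *)
Lemma invariant_circle_tube (O : set N) : open O -> invariant_circle `<=` O ->
  exists2 e : R, 0 < e & forall i x, good i x -> potential i x = 0 -> exc i x <= e -> O x.
Proof.
move=> oO cO; pose w (i : I) (x : N) := ldl iota lc lZ i x + `|cabs (zo i x) - 1|.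
have [|||e e0 he] := @in_tube R n N iota lc lP lr lZ D hl O w oO.
- move=> i q qB e e0; have e2 : 0 < e / 2 by rewrite divr_gt0.
  have /continuous_cabs /(_ _ e2) n2 := lz_continuous hl qB.
  apply: filterS2 (ldl_near hiota hl qB e2) n2 => y y1 y2.
  have h1 := cabs_dist (zo i y) (zo i q) 0; have h2 := cabs_dist (zo i q) (zo i y) 0.
  rewrite !subr0 in h1 h2; rewrite (cabs_sub (zo i q)) in h2.
  rewrite /w (splitr e); have -> : ldl iota lc lZ i y + `|cabs (zo i y) - 1| - (ldl iota lc lZ i q + `|cabs (zo i q) - 1|)
    = (ldl iota lc lZ i y - ldl iota lc lZ i q) + (`|cabs (zo i y) - 1| - `|cabs (zo i q) - 1|) by ring.
  apply: le_lt_trans (ler_normD _ _) _; apply: ltrD => //.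
  apply: le_lt_trans (ler_dist_dist _ _) _; apply: le_lt_trans y2.
  by rewrite opprB addrA subrK ler_norml; apply/andP; split; lra.
- by move=> i q; rewrite addr_ge0 ?delta_ge0.
- move=> i q qB /eqP; rewrite paddr_eq0 ?delta_ge0 // => /andP[/eqP d0 /eqP z0].
  apply: cO; rewrite (ldl0_L hl qB d0).
  have z1 : cabs (zo i q) = 1 by apply/eqP; rewrite -subr_eq0 -normr_eq0 z0.
  case e : i.1; first by exists (zo i q).
  exists (zo i q)^-1; first by rewrite /= cabsV z1 invr1.
  by rewrite (line_param_switch iota true) ?invrK // invr_eq0 -cabs_gt0 z1.
have kb : 0 < 2 ^+ b + 12 * k1 by rewrite addr_gt0 ?exprn_gt0 // mulr_gt0 ?k1p.
exists (e / (2 ^+ b + 12 * k1)); first by rewrite divr_gt0.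
move=> i x g u0 xe; have [iD xV z0 _] := g; apply: (he i iD x xV).
rewrite ler_pdivlMr // mulrDr in xe; apply: le_trans xe; rewrite /w; apply: lerD.
  have zb : 0 < cabs (zo i x) ^+ b by rewrite exprn_gt0 // cabs_gt0.
  have -> : ldl iota lc lZ i x = exc i x * cabs (zo i x) ^+ b by rewrite /excess divfK // gt_eqF.
  apply: ler_wpM2l; first exact: exc0.
  apply: lerXn2r; rewrite ?nnegrE ?cabs_ge0 //.
  by apply: (lz_le2 hl); apply: (lV_ball hl _ xV); rewrite ler1n.
have hu := potential_le g; rewrite u0 sub0r normrN in hu.
have lnz : `|ln (cabs (ze i x))| = `|ln (cabs (zo i x))|.
  by rewrite /lzt /zt; case: i.1 => //; rewrite cabsV lnV ?normrN // posrE cabs_gt0.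
rewrite lnz in hu.
have t2 : 6 * (k1 * exc i x) <= 1 / 2.
  have := small_t g; have t0 : 0 <= k1 * exc i x by rewrite mulr_ge0 ?exc0 ?ltW ?k1p.
  move: (k1 * _) t0 => t t0; have := ler_wpM2r t0 b1R; rewrite -mulrA; lra.
have zp : 0 < cabs (zo i x) by rewrite cabs_gt0.
by have := ln_near1 zp hu t2; rewrite mulrC; lra.
Qed.

Lemma iter_near (O : set N) x K : open O -> (forall k, O (iter k f x)) ->
  \forall y \near x, forall k, (k < K)%N -> O (iter k f y).
Proof.
move=> oO h; elim: K => [|K ih]; first exact: nearW.
have [ck _] := holomorphic_iter K fH.
have n1 : \forall y \near x, O (iter K f y) by apply: (ck x); exact: open_nbhs_nbhs (conj oO (h K)).
apply: filterS2 ih n1 => y y1 y2 k; rewrite ltnS leq_eqVlt => /orP[/eqP ->|]; [exact: y2|exact: y1].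
Qed.

Lemma exc_small e : 0 < e -> exists K, forall k i y, (K <= k)%N -> good i y ->
  exc (orbit_index i y k) (iter k f y) <= e.
Proof.
move=> e0; have q : 0 <= th < 1.
  rewrite ltW ?th0 //= invf_lt1 ?mulr_gt0 ?k1p //; have := k11; lra.
have e1 : 0 < e / eps by rewrite divr_gt0.
have [K hK] := pow_small q e1; exists K => k i y Kk g.
have [_ h] := route_good (orbit_index_route k g); apply: le_trans h _.
have := hK k Kk; rewrite ler_pdivlMr // => /(le_trans _); apply.
by apply: ler_wpM2l; [rewrite exprn_ge0 // ltW ?th0|have [_ _ _ xe] := g; exact: ltW].
Qed.

Lemma potential0_iter i y k : good i y -> potential i y = 0 -> potential (orbit_index i y k) (iter k f y) = 0.
Proof. by move=> g u0; rewrite potential_orbit_index // u0 mulr0. Qed.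

(** The excess tends to 0 at a rate common to all good points, so from some time K on every orbit
    with u = 0 is in Om. The finitely many earlier iterates of y are in Om by continuity, being
    close to those of x. *)
Lemma stable_near Om i x : open Om -> invariant_circle `<=` Om -> good i x -> (forall k, Om (iter k f x)) ->
  \forall y \near x, good i y /\ (potential i y = 0 -> local_stable_manifold f invariant_circle Om y).
Proof.
move=> oO cO g hx; have [e e0 he] := invariant_circle_tube oO cO; have [K hK] := exc_small e0.
apply: filterS2 (lgood_near g) (iter_near K oO hx) => y gy hy; split => // u0.
have attr (U : set N) : open U -> invariant_circle `<=` U -> exists K', forall k, (K' <= k)%N -> U (iter k f y).
  move=> oU cU; have [e' e'0 he'] := invariant_circle_tube oU cU; have [K' hK'] := exc_small e'0.
  exists K' => k Kk; have [gk _] := orbit_index_good gy k.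
  by apply: (he' _ _ gk (potential0_iter k gy u0)); exact: hK'.
split=> [k|U oU cU].
  have [kK|Kk] := ltnP k K; first exact: hy.
  by have [gk _] := orbit_index_good gy k; apply: (he _ _ gk (potential0_iter k gy u0)); exact: hK.
by have [K' h] := attr U oU cU; exists K'.
Qed.

(** Around a point of the stable set, the chart of [straighten] has u as its last coordinate. A
    point of the stable set has u = 0 by [regular_orbit], its orbit staying in Om; conversely, u = 0
    near x implies stability by [stable_near]. *)
Theorem stable_submanifold Om : open Om -> invariant_circle `<=` Om -> Om `<=` regular ->
  real_analytic_submanifold (local_stable_manifold f invariant_circle Om) (2 * n - 1).
Proof.
move=> oO cO Or; split; first by rewrite mul2n -addnn leq_subr.
move=> x [hx _]; have [i [m [zeta [g z1 h Dm]]]] := Or _ (hx 0%N).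
have [ai _ _ _ _] := hl i.
have [kappa [rk kx kU kE]] := straighten ai (good_dom g) (stable_near oO cO g hx) (log_coord_near g z1 h) Dm.
exists kappa; split => // y ky; have [gy hy] := kU y ky.
have n0 : (0 < n)%N := leq_ltn_trans (leq0n m) (ltn_ord m).
have jP : (2 * n - 1 < n + n)%N by rewrite mul2n -addnn subn1 prednK // addn_gt0 n0.
split=> [[Wy _] j jd|hj].
  rewrite kE // Re_log_coord //; apply: regular_orbit gy _ => k; exact: Or.
apply: hy; have := hj (Ordinal jP) (leqnn _); by rewrite kE // Re_log_coord.
Qed.

End LogSeries.

(** * From the hypotheses to the uniform estimates *)

Section Assembly.
Variables (R : realType) (n : nat) (N : complexManifold R n).
Local Notation C := (Cplx R).

Lemma power_line_param (iota : P1 R -> N) (f : N -> N) b : (2 <= b)%N ->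
  (forall p, f (iota p) = iota (P1_power b p)) -> forall s (z : C), f (line_param iota s z) = line_param iota s (z ^+ b).
Proof.
move=> b2 h [] z; rewrite /line_param /= h //; congr iota; rewrite /affoo expf_eq0 (ltnW b2) /=.
by case: (z == 0); rewrite //= exprVn.
Qed.

Lemma invariant_circleE (iota : P1 R -> N) : iota @` unit_circle R = invariant_circle iota.
Proof.
have n1 (z : C) : (`|z| = 1) <-> (cabs z = 1).
  by rewrite cabsE; split => [h|-> //]; apply: (@complexI R); rewrite h.
apply/seteqP; split => [p [q [z -> /n1 z1] <-]|p [z /n1 z1 <-]]; first by exists z.
by exists (Some z) => //; exists z.
Qed.

End Assembly.

Theorem theoremA (R : realType) (n : nat) (hn : (2 <= n)%N)
    (N : complexManifold R n) (L : set N) (hL : embedded_projective_line L)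
    (f : N -> N) (hf : holomorphic f) (hdom : dominant f)
    (hinv : f @` L `<=` L)
    (a : nat) (ha : transversally_superattracting f L a)
    (b : nat) (hb : (2 <= b)%N) (iota : P1 R -> N)
    (hconj : conjugates_power f L b iota)
    (S : set N) (hS : S = iota @` unit_circle R) (hab : (b <= a)%N) :
  exists2 Omega0 : set N, open Omega0 /\ S `<=` Omega0 &
    forall Omega : set N, open Omega -> S `<=` Omega -> Omega `<=` Omega0 ->
      real_analytic_submanifold (local_stable_manifold f S Omega) (2 * n - 1).
Proof.
case: hconj => hiota LE hpow; rewrite LE in ha; rewrite {}hS invariant_circleE.
have fhh := power_line_param hb hpow.
have [lc [lP [lr [lZ [D [hl cov]]]]]] := finite_atlas hiota.
have [k1 [e1 [k11 e10 e1k step]]] := step_data hiota hl hf fhh ha hb hab cov.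
have k1p : 0 < k1 by exact: lt_le_trans ltr01 k11.
have b0 : 0 < b%:R :> R by rewrite ltr0n ltnW.
(* Lowered below the value of [step_data] so that every ratio is within 1 / (100 * b) of 1, as the
   logarithm estimates require. *)
pose eps := Num.min e1 (100 * b%:R * k1)^-1.
have eps0 : 0 < eps by rewrite lt_min e10 invr_gt0 !mulr_gt0.
have epsk : eps * k1 <= (2 * k1)^-1.
  by apply: le_trans e1k; rewrite ler_pM2r // ge_min lexx.
have epsb : 100 * b%:R * (eps * k1) <= 1.
  by rewrite [eps * k1]mulrC mulrA mulrC -ler_pdivlMr ?mulr_gt0 // div1r ge_min lexx orbT.
have good1 i x : lgood iota lc lP lr lZ D b eps i x -> lgood iota lc lP lr lZ D b e1 i x.
  by case=> ? ? ? xe; split => //; apply: lt_le_trans xe _; rewrite ge_min lexx.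
have s1 i x (g : lgood iota lc lP lr lZ D b eps i x) := let: And4 h _ _ _ := step i x (good1 i x g) in h.
have s2 i x (g : lgood iota lc lP lr lZ D b eps i x) := let: And4 _ h _ _ := step i x (good1 i x g) in h.
have s3 i x (g : lgood iota lc lP lr lZ D b eps i x) := let: And4 _ _ h _ := step i x (good1 i x g) in h.
have s4 i x (g : lgood iota lc lP lr lZ D b eps i x) := let: And4 _ _ _ h := step i x (good1 i x g) in h.
(* [invariant_circle_regular] shows that the regular set is a neighbourhood of each point of the
   circle, so its interior contains S. *)
exists (interior (regular iota lc lP lr lZ D f b eps)).
  split; first exact: open_interior.
  by move=> p cp; exact: (invariant_circle_regular hiota hl hf hb k11 eps0 epsk epsb s1 s2 s3 s4 cov cp).
move=> Om oO cO Or.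
apply: (stable_submanifold hiota hl hf hb k11 eps0 epsk epsb s1 s2 s3 s4 oO cO).
by move=> x /Or; exact: interior_subset.
Qed.
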